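(* Let $(L_I,\mathfrak n_I^+)$ be a regular prehomogeneous vector space of commutative parabolic type with $I=I_0\setminus\{i_0\}$, and for $s\in\mathbb Z_{\ge0}$ let $\tilde b_{q,r,s}\in\mathbb C(q)$ be the scalar determined by ${}^tf_{q,r}(\partial)(f_{q,r}^{s+1})=\tilde b_{q,r,s}\,f_{q,r}^s$. Then there exists a polynomial $\tilde b_{q,r}(t)\in\mathbb C(q)[t]$ such that $\tilde b_{q,r,s}=\tilde b_{q,r}(q_{i_0}^s)$ for any $s\in\mathbb Z_{\ge0}$.
   Context: Quantum group. $\mathfrak g$ is a simple complex Lie algebra with Cartan subalgebra $\mathfrak h$, roots $\Delta$, positive roots $\Delta^+$, simple roots $\alpha_i$ ($i\in I_0$), simple coroots $h_i$, fundamental weights $\varpi_i$, Weyl group $W$ with simple reflections $s_i$ and longest element $w_0$; $(\ ,\ )$ is the invariant form with $(\alpha,\alpha)=2$ for short roots (all roots are short in the simply laced case). $d_i=(\alpha_i,\alpha_i)/2$, $a_{ij}=2(\alpha_i,\alpha_j)/(\alpha_i,\alpha_i)$, $q_i=q^{d_i}$, $[m]_t=\frac{t^m-t^{-m}}{t-t^{-1}}$. $U_q(\mathfrak g)$ is the $\mathbb C(q)$-algebra generated by $E_i,F_i,K_i^{\pm1}$ with relations $K_iK_j=K_jK_i$, $K_iE_jK_i^{-1}=q_i^{a_{ij}}E_j$, $K_iF_jK_i^{-1}=q_i^{-a_{ij}}F_j$, $E_iF_j-F_jE_i=\delta_{ij}\frac{K_i-K_i^{-1}}{q_i-q_i^{-1}}$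 and the quantum Serre relations $\sum_{k=0}^{1-a_{ij}}(-1)^kX_i^{(1-a_{ij}-k)}X_jX_i^{(k)}=0$ ($i\ne j$, $X=E$ or $F$), where $X_i^{(k)}=X_i^k/[k]_{q_i}!$. $U_q(\mathfrak n^{+}),U_q(\mathfrak n^-)$ are generated by the $E_i$, resp. the $F_i$; $U_q(\mathfrak b^{\pm})$ by these and the $K_i^{\pm1}$. The antiautomorphism ${}^t$ of $U_q(\mathfrak g)$ fixes $K_i$ and exchanges $E_i,F_i$. Coproduct: $\Delta(K_i)=K_i\otimes K_i$, $\Delta(E_i)=E_i\otimes K_i^{-1}+1\otimes E_i$, $\Delta(F_i)=F_i\otimes1+K_i\otimes F_i$; antipode: $S(K_i)=K_i^{-1}$, $S(E_i)=-E_iK_i$, $S(F_i)=-K_i^{-1}F_i$; $\mathrm{ad}(x)(y)=\sum x^{(1)}yS(x^{(2)})$. Braid automorphisms: $T_i(K_j)=K_jK_i^{-a_{ij}}$, $T_i(E_i)=-F_iK_i$, $T_i(F_i)=-K_i^{-1}E_i$, and for $j\ne i$, $T_i(E_j)=\sum_{k=0}^{-a_{ij}}(-q_i)^{-k}E_i^{(-a_{ij}-k)}E_jE_i^{(k)}$, $T_i(F_j)=\sum_{k=0}^{-a_{ij}}(-q_i)^kF_i^{(k)}F_jF_i^{(-a_{ij}-k)}$; $T_w=T_{i_1}\cdots T_{i_k}$ for a reduced expression $w=s_{i_1}\cdots s_{i_k}$. $(\ ,\ ):U_q(\mathfrak b^-)\times U_q(\mathfrak b^+)\to\mathbb C(q)$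 is the unique bilinear form with $(y,xx')=(\Delta(y),x'\otimes x)$, $(yy',x)=(y\otimes y',\Delta(x))$, $(K_i,K_j)=q^{-(\alpha_i,\alpha_j)}$, $(F_i,E_j)=-\delta_{ij}(q_i-q_i^{-1})^{-1}$, $(F_i,K_j)=(K_i,E_j)=0$. Commutative parabolic type. For $I\subset I_0$ put $\Delta_I=\Delta\cap\sum_{i\in I}\mathbb Z\alpha_i$, $\mathfrak l_I=\mathfrak h\oplus\bigoplus_{\alpha\in\Delta_I}\mathfrak g_\alpha$, $\mathfrak n_I^\pm=\bigoplus_{\alpha\in\Delta^+\setminus\Delta_I}\mathfrak g_{\pm\alpha}$, and let $L_I$ be the algebraic group of $\mathfrak l_I$. Assume $\mathfrak n_I^+\ne0$ and $[\mathfrak n_I^+,\mathfrak n_I^+]=0$; then $I=I_0\setminus\{i_0\}$. Assume $(L_I,\mathfrak n_I^+)$ is a regular prehomogeneous vector space; the pairs $(\mathfrak g,i_0)$ are then $(A_{2n-1},n)$, $(B_n,1)$, $(C_n,n)$, $(D_n,1)$, $(D_{2n},2n)$, $(E_7,1)$ (standard Bourbaki labels in the classical types; in $E_7$ the vertex $1$ is the end of the longest arm). $r$ is the number of non-open $L_I$-orbits on $\mathfrak n_I^+$. Quantum objects. $U_q(\mathfrak l_I)=\langle K_i^{\pm1},E_j,F_j\mid i\in I_0,j\in I\rangle$; $U_q(\mathfrak n_I^-)=U_q(\mathfrak n^-)\cap T_{w_I}^{-1}U_q(\mathfrak n^-)$, with $w_I$ the longest element of $W_I=\langle s_i\mid i\in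 I\rangle$. It is stable under $\mathrm{ad}(U_q(\mathfrak l_I))$ and is a multiplicity free $U_q(\mathfrak l_I)$-module. A weight vector of $U_q(\mathfrak n_I^-)$ of weight $-\mu$ with $\mu\in m\alpha_{i_0}+\sum_{i\in I}\mathbb Z_{\ge0}\alpha_i$ has degree $m$. The bilinear form $\langle\ ,\ \rangle$ on $U_q(\mathfrak n_I^-)$ is defined on weight vectors by $\langle f,g\rangle=(q^{-1}-q)^{\deg f}(f,{}^tg)$; it is symmetric and non-degenerate. For $g\in U_q(\mathfrak n_I^-)$, ${}^tg(\partial)\in\mathrm{End}_{\mathbb C(q)}(U_q(\mathfrak n_I^-))$ is the unique operator with $\langle{}^tg(\partial)h,h'\rangle=\langle h,gh'\rangle$ for all $h,h'$. $f_{q,r}$ is the (unique up to a nonzero scalar) highest weight vector for $\mathrm{ad}(U_q(\mathfrak l_I))$ in $U_q(\mathfrak n_I^-)$ of weight $-2\varpi_{i_0}$; it has degree $r$. For every $s\in\mathbb Z_{\ge0}$ the element ${}^tf_{q,r}(\partial)(f_{q,r}^{s+1})$ is a scalar multiple of $f_{q,r}^s$. *)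

(* Defs.v *)
From HB Require Import structures.
From mathcomp Require Import all_boot all_order all_algebra.
From mathcomp Require Import boolp reals.
From mathcomp Require Import complex.
From mathcomp Require Import monalg.
From mathcomp Require Import mpoly.

Set Implicit Arguments.
Unset Strict Implicit.
Unset Printing Implicit Defensive.

Import Order.TTheory GRing.Theory Num.Theory.
Local Open Scope ring_scope.

(* monalg has a notation of the same form for its own polynomials *)
Local Notation "{ 'mpoly' T [ n ] }" := (mpoly.mpoly n T) : type_scope.

Record lie_algebra (F : fieldType) := LieAlgebra {
  lie_sort :> vectType F;
  lie_br : lie_sort -> lie_sort -> lie_sort;
  lie_brDl : forall c x y z,
    lie_br (c *: x + y) z = c *: lie_br x z + lie_br y z;
  lie_brDr : forall c x y z,
    lie_br x (c *: y + z) = c *: lie_br x y + lie_br x z;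
  lie_brxx : forall x, lie_br x x = 0;
  lie_jacobi : forall x y z,
    lie_br x (lie_br y z) + lie_br y (lie_br z x) + lie_br z (lie_br x y) = 0
}.

Section LieAlgebra.
Context (F : fieldType) (g : lie_algebra F).

Definition brackets (U V : {vspace g}) : {vspace g} :=
  <<[seq lie_br u v | u <- vbasis U, v <- vbasis V]>>%VS.

Definition lie_simple : Prop :=
  brackets fullv fullv <> 0%VS /\
  forall J : {vspace g}, (brackets fullv J <= J)%VS -> J = 0%VS \/ J = fullv.

Definition cartan_subalgebra (h : {vspace g}) : Prop :=
  [/\ (brackets h h <= h)%VS,
      exists k, iter k (brackets h) h = 0%VS &
      forall x, (brackets <[x]> h <= h)%VS -> x \in h].

Definition dual (h : {vspace g}) := 'Hom(subvs_of h, F^o).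

Definition root_space (h : {vspace g}) (b : dual h) : {vspace g} :=
  (\bigcap_(t <- vbasis {:subvs_of h})
     passmx.leigenspace (linfun (lie_br (vsval t))) (b t))%VS.

End LieAlgebra.

(* A complex simple Lie algebra with a Cartan subalgebra, its roots, a choice
   of simple roots indexed by I_0 = 'I_n, the coroots, the invariant form on
   the dual of the Cartan subalgebra, and the integers a_ij and d_i.  All
   fields after [simple_root] are determined by the previous ones. *)
Record simple_lie (R : realType) := SimpleLie {
  glie : lie_algebra R[i];
  glie_simple : lie_simple glie;
  csa : {vspace glie};
  csaP : cartan_subalgebra csa;
  roots : seq (dual csa);
  roots_uniq : uniq roots;
  rootsP : forall b, b \in roots <-> b <> 0 /\ root_space b <> 0%VS;
  rank : nat;
  simple_root : 'I_rank -> dual csa;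
  simple_root_in : forall i, simple_root i \in roots;
  simple_root_basis : basis_of fullv [tuple simple_root i | i < rank];
  simple_root_base : forall b, b \in roots -> exists c : 'I_rank -> nat,
    b = \sum_i (c i)%:R *: simple_root i \/
    b = - \sum_i (c i)%:R *: simple_root i;
  coroot : 'I_rank -> subvs_of csa;
  coroot_in : forall i, vsval (coroot i) \in
    brackets (root_space (simple_root i)) (root_space (- simple_root i));
  coroot_root : forall i, simple_root i (coroot i) = 2%:R;
  (* the Weyl group invariant form, with (b, b) = 2 for short roots b *)
  inv_form : dual csa -> dual csa -> R[i];
  inv_formDl : forall c (x y z : dual csa),
    inv_form (c *: x + y) z = c * inv_form x z + inv_form y z;
  inv_formC : forall x y, inv_form x y = inv_form y x;
  inv_form_refl : forall i (x y : dual csa),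
    inv_form (x - x (coroot i) *: simple_root i)
             (y - y (coroot i) *: simple_root i) = inv_form x y;
  inv_form_short : exists2 b, b \in roots & inv_form b b = 2%:R;
  inv_form_min : forall b, b \in roots -> 2%:R <= inv_form b b;
  cartan_mx : 'M[int]_rank;
  cartan_mxE : forall i j, (cartan_mx i j)%:~R =
    2%:R * inv_form (simple_root i) (simple_root j)
    / inv_form (simple_root i) (simple_root i);
  half_norm : 'I_rank -> nat;
  half_normE : forall i,
    (half_norm i)%:R = inv_form (simple_root i) (simple_root i) / 2%:R
}.

Section Weyl.
Context (R : realType) (D : simple_lie R).
Notation h := (csa D).
Notation n := (rank D).

Definition simple_refl (i : 'I_n) (x : dual h) : dual h :=
  x - x (coroot i) *: simple_root i.

(* the word [:: i_1; ...; i_k] represents the element s_{i_1} ... s_{i_k} *)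
Definition weyl_word (w : seq 'I_n) (x : dual h) : dual h :=
  foldr simple_refl x w.

Definition reduced (w : seq 'I_n) : Prop :=
  forall v, weyl_word v =1 weyl_word w -> (size w <= size v)%N.

(* [w] is a reduced expression of the longest element of W_I *)
Definition reduced_longest (I : {set 'I_n}) (w : seq 'I_n) : Prop :=
  [/\ all (mem I) w, reduced w &
      forall v, all (mem I) v -> reduced v -> (size v <= size w)%N].

End Weyl.

Section Parabolic.
Context (R : realType) (D : simple_lie R) (I : {set 'I_(rank D)}).
Notation C := R[i].
Notation g := (glie D).
Notation h := (csa D).
Notation n := (rank D).
Notation root_coord b i :=
  (coord [tuple simple_root (s := D) k | k < n] i b).

Definition pos_root (b : dual h) : bool :=
  (b \in roots D) && [forall i : 'I_n, 0 <= root_coord b i].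

(* Delta_I; the coordinates of a root are integers by [simple_root_base] *)
Definition levi_root (b : dual h) : bool :=
  (b \in roots D) && [forall i : 'I_n, (i \in I) || (root_coord b i == 0)].

Definition nil_radical : {vspace g} :=
  (\sum_(b <- roots D | pos_root b && ~~ levi_root b) root_space b)%VS.

Definition commutative_parabolic : Prop :=
  nil_radical <> 0%VS /\ brackets nil_radical nil_radical = 0%VS.

(* exp (ad x) for a root vector x, where ad x is nilpotent *)
Definition exp_ad (x y : g) : g :=
  \sum_(k < (\dim {:g}).+1) (k`!%:R : C)^-1 *: iter k (lie_br x) y.

(* The image in GL(g) of the maximal torus of L_I: its elements are the
   homomorphisms from the root lattice to C^*, here alpha_i |-> z i. *)
Definition torus_elt (z : 'I_n -> C) (t : g -> g) : Prop :=
  [/\ linear t, forall x, x \in h -> t x = x &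
      forall b (c : 'I_n -> int), b \in roots D ->
        b = \sum_i (c i)%:~R *: simple_root i ->
        forall x, x \in root_space b -> t x = (\prod_i z i ^ c i) *: x].

(* The image in GL(g) of the connected reductive group L_I, generated by its
   maximal torus and its root subgroups. *)
Inductive levi_group : (g -> g) -> Prop :=
| levi_id : levi_group id
| levi_comp t u : levi_group t -> levi_group u -> levi_group (t \o u)
| levi_torus z t :
    (forall i, z i != 0) -> torus_elt z t -> levi_group t
| levi_exp b x : levi_root b -> x \in root_space b -> levi_group (exp_ad x).

Notation m := (\dim nil_radical).

Definition nil_eval (p : {mpoly C[m]}) (v : g) : C :=
  p.@[fun k => coord (vbasis nil_radical) k v].

(* Some orbit in the nilradical is Zariski open: each of its points has a
   principal open neighbourhood inside the orbit. *)
Definition prehomogeneous : Prop :=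
  exists2 v, v \in nil_radical &
    forall t, levi_group t -> exists2 p, nil_eval p (t v) != 0 &
      forall u, u \in nil_radical -> nil_eval p u != 0 ->
        exists2 t', levi_group t' & u = t' v.

Definition relative_invariant (p : {mpoly C[m]}) : Prop :=
  p != 0 /\ exists chi : (g -> g) -> C, forall t v,
    levi_group t -> v \in nil_radical ->
    nil_eval p (t v) = chi t * nil_eval p v.

(* p ^ (2m) times the Hessian determinant of log p *)
Definition log_hessian (p : {mpoly C[m]}) : {mpoly C[m]} :=
  \det (\matrix_(j, k) (p * p^`M(j)^`M(k) - p^`M(j) * p^`M(k))).

Definition regular_prehomogeneous : Prop :=
  prehomogeneous /\
  exists2 p, relative_invariant p & log_hessian p != 0.

End Parabolic.

Definition freealg (K : fieldType) (X : choiceType) : Type :=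
  {malg K[{fmonom X}]}.

HB.instance Definition _ (K : fieldType) (X : choiceType) :=
  GRing.Lalgebra.copy (freealg K X) {malg K[{fmonom X}]}.

Section FreeAlg.
Context (K : fieldType) (X : choiceType).

Definition fgen (x : X) : freealg K X := << fmu x >>.

Lemma freealg_scalerAr (c : K) (x y : freealg K X) :
  c *: (x * y) = x * (c *: y).
Proof.
apply/monalg.malgP => k; rewrite monalg.mcoeffZ.
rewrite (monalg.mcoeffMlw k (finmap.fsubset_refl (monalg.msupp x)) (finmap.fsubset_refl (monalg.msupp y))).
rewrite (monalg.mcoeffMlw k (finmap.fsubset_refl (monalg.msupp x)) (monalg.msuppZ_le c y)).
rewrite mulr_sumr; apply: eq_bigr => i _; rewrite mulr_sumr.
by apply: eq_bigr => j _; rewrite monalg.mcoeffZ mulrnAr mulrCA.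
Qed.

HB.instance Definition _ :=
  GRing.Lalgebra_isAlgebra.Build K (freealg K X) freealg_scalerAr.

End FreeAlg.

Section QuotAlg.
Context (K : fieldType) (A : algType K) (S : A -> Prop).
Local Open Scope quotient_scope.

Inductive ideal_gen : A -> Prop :=
| ideal_gen0 : ideal_gen 0
| ideal_genS x : S x -> ideal_gen x
| ideal_genD x y : ideal_gen x -> ideal_gen y -> ideal_gen (x + y)
| ideal_genMl a x : ideal_gen x -> ideal_gen (a * x)
| ideal_genMr a x : ideal_gen x -> ideal_gen (x * a).

Definition ideal_pred : {pred A} := [pred x | `[< ideal_gen x >]].

Lemma ideal_predP x : reflect (ideal_gen x) (x \in ideal_pred).
Proof. exact: asboolP. Qed.

Lemma ideal_pred_zmod : zmod_closed ideal_pred.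
Proof.
split=> [|x y /ideal_predP hx /ideal_predP hy]; apply/ideal_predP.
  exact: ideal_gen0.
by apply: ideal_genD => //; rewrite -mulN1r; apply: ideal_genMl.
Qed.

HB.instance Definition _ := GRing.isZmodClosed.Build A ideal_pred ideal_pred_zmod.

Definition quotalg : Type := (Quotient.quot ideal_pred).
HB.instance Definition _ := GRing.Zmodule.on quotalg.
HB.instance Definition _ := EqQuotient.on quotalg.

Definition quotpi (x : A) : quotalg := \pi_(Quotient.quot ideal_pred) x.

Lemma quotpi_eq x y : quotpi x = quotpi y <-> ideal_gen (x - y).
Proof.
split=> [|h].
  by move/eqP; rewrite -Quotient.idealrBE => /ideal_predP.
by apply/eqP; rewrite -Quotient.idealrBE; apply/ideal_predP.
Qed.

Lemma quotpi_surj (u : quotalg) : {x | quotpi x = u}.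
Proof. by exists (repr u); rewrite /quotpi reprK. Qed.

Lemma quotpiB : {morph quotpi : x y / x - y}.
Proof. by move=> x y; rewrite /quotpi raddfB. Qed.

Lemma quotpiD : {morph quotpi : x y / x + y}.
Proof. by move=> x y; rewrite /quotpi raddfD. Qed.

Definition quot_one : quotalg := quotpi 1.
Definition quot_mul (u v : quotalg) : quotalg :=
  quotpi (sval (quotpi_surj u) * sval (quotpi_surj v)).
Definition quot_scale (c : K) (u : quotalg) : quotalg :=
  quotpi (c *: sval (quotpi_surj u)).

Lemma quot_mulE x y : quot_mul (quotpi x) (quotpi y) = quotpi (x * y).
Proof.
rewrite /quot_mul; case: quotpi_surj => x' /= /quotpi_eq hx.
case: quotpi_surj => y' /= /quotpi_eq hy; apply/quotpi_eq.
have -> : x' * y' - x * y = (x' - x) * y' + x * (y' - y).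
  by rewrite mulrBl mulrBr addrA subrK.
by apply: ideal_genD; [apply: ideal_genMr | apply: ideal_genMl].
Qed.

Lemma quot_scaleE c x : quot_scale c (quotpi x) = quotpi (c *: x).
Proof.
rewrite /quot_scale; case: quotpi_surj => x' /= /quotpi_eq hx.
by apply/quotpi_eq; rewrite -scalerBr -mulr_algl; apply: ideal_genMl.
Qed.

Lemma quot_mulA : associative quot_mul.
Proof.
move=> u v w; case: (quotpi_surj u) => x <-; case: (quotpi_surj v) => y <-.
by case: (quotpi_surj w) => z <-; rewrite !quot_mulE mulrA.
Qed.
Lemma quot_mul1 : left_id quot_one quot_mul.
Proof. by move=> u; case: (quotpi_surj u) => x <-; rewrite quot_mulE mul1r. Qed.
Lemma quot_mulr1 : right_id quot_one quot_mul.
Proof. by move=> u; case: (quotpi_surj u) => x <-; rewrite quot_mulE mulr1. Qed.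
Lemma quot_mulDl : left_distributive quot_mul +%R.
Proof.
move=> u v w; case: (quotpi_surj u) => x <-; case: (quotpi_surj v) => y <-.
by case: (quotpi_surj w) => z <-; rewrite -quotpiD !quot_mulE mulrDl quotpiD.
Qed.
Lemma quot_mulDr : right_distributive quot_mul +%R.
Proof.
move=> u v w; case: (quotpi_surj u) => x <-; case: (quotpi_surj v) => y <-.
by case: (quotpi_surj w) => z <-; rewrite -quotpiD !quot_mulE mulrDr quotpiD.
Qed.

HB.instance Definition _ := GRing.Zmodule_isPzRing.Build quotalg
  quot_mulA quot_mul1 quot_mulr1 quot_mulDl quot_mulDr.

Lemma quot_scaleA a b (u : quotalg) :
  quot_scale a (quot_scale b u) = quot_scale (a * b) u.
Proof.
by case: (quotpi_surj u) => x <-; rewrite !quot_scaleE scalerA.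
Qed.
Lemma quot_scale1 : left_id 1 quot_scale.
Proof. by move=> u; case: (quotpi_surj u) => x <-; rewrite quot_scaleE scale1r. Qed.
Lemma quot_scaleDr : right_distributive quot_scale +%R.
Proof.
move=> c u v; case: (quotpi_surj u) => x <-; case: (quotpi_surj v) => y <-.
by rewrite -quotpiD !quot_scaleE scalerDr quotpiD.
Qed.
Lemma quot_scaleDl (u : quotalg) : {morph quot_scale^~ u : a b / a + b}.
Proof.
move=> a b; case: (quotpi_surj u) => x <-.
by rewrite !quot_scaleE scalerDl quotpiD.
Qed.

HB.instance Definition _ := GRing.Zmodule_isLmodule.Build K quotalg
  quot_scaleA quot_scale1 quot_scaleDr quot_scaleDl.

Lemma quotpiM : {morph quotpi : x y / x * y}.
Proof. by move=> x y; rewrite -quot_mulE. Qed.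
Lemma quotpiZ c : {morph quotpi : x / c *: x}.
Proof. by move=> x; rewrite -quot_scaleE. Qed.
Lemma quotpi1 : quotpi 1 = 1. Proof. by []. Qed.

Lemma quot_scalerAl c (u v : quotalg) : c *: (u * v) = (c *: u) * v.
Proof.
case: (quotpi_surj u) => x <-; case: (quotpi_surj v) => y <-.
by rewrite -quotpiZ -!quotpiM -quotpiZ scalerAl.
Qed.
Lemma quot_scalerAr c (u v : quotalg) : c *: (u * v) = u * (c *: v).
Proof.
case: (quotpi_surj u) => x <-; case: (quotpi_surj v) => y <-.
by rewrite -quotpiZ -!quotpiM -quotpiZ scalerAr.
Qed.

End QuotAlg.

(* The tensor product of algebras: products and the unit of the pure tensors
   [tens a b] are pure tensors, so they span, and the other relations are the
   ones of the tensor product of vector spaces. *)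
Section Tensor.
Context (K : fieldType) (A B : algType K).
Notation "a (x) b" := (fgen K (a, b)) (at level 40, only parsing).

Inductive tens_rel : freealg K (A * B)%type -> Prop :=
| tens_relDl a a' b : tens_rel ((a + a') (x) b - (a (x) b + a' (x) b))
| tens_relDr a b b' : tens_rel (a (x) (b + b') - (a (x) b + a (x) b'))
| tens_relZl c a b : tens_rel ((c *: a) (x) b - c *: (a (x) b))
| tens_relZr c a b : tens_rel (a (x) (c *: b) - c *: (a (x) b))
| tens_relM a b a' b' :
    tens_rel ((a (x) b) * (a' (x) b') - (a * a') (x) (b * b'))
| tens_rel1 : tens_rel ((1 : A) (x) (1 : B) - 1).

Definition tensor : Type := quotalg tens_rel.
HB.instance Definition _ := GRing.PzRing.on tensor.
HB.instance Definition _ := GRing.Lmodule.on tensor.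

Definition tens (a : A) (b : B) : tensor := quotpi tens_rel (a (x) b).

(* [t] is the sum of the pure tensors p.1 (x) p.2, for p in the list [s] *)
Definition tens_sum (t : tensor) (s : seq (A * B)) : Prop :=
  t = \sum_(p <- s) tens p.1 p.2.

End Tensor.

Definition qnum (K : fieldType) (t : K) (m : nat) : K :=
  (t ^+ m - t ^- m) / (t - t^-1).
Definition qfact (K : fieldType) (t : K) (m : nat) : K :=
  \prod_(1 <= k < m.+1) qnum t k.
Definition divpow (K : fieldType) (A : algType K) (t : K) (x : A) (m : nat) : A :=
  (qfact t m)^-1 *: x ^+ m.

Section QuantumGroup.
Context (K : fieldType) (q : K) (n : nat).
Context (a : 'M[int]_n) (d : 'I_n -> nat).

Definition qi (i : 'I_n) : K := q ^+ d i.

Definition uq_gen : choiceType := (('I_n + 'I_n) + ('I_n + 'I_n))%type.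
Definition fE i : freealg K uq_gen := fgen K (inl (inl i)).
Definition fF i : freealg K uq_gen := fgen K (inl (inr i)).
Definition fK i : freealg K uq_gen := fgen K (inr (inl i)).
Definition fKV i : freealg K uq_gen := fgen K (inr (inr i)).

Definition serre (x : 'I_n -> freealg K uq_gen) (i j : 'I_n) :=
  \sum_(k < (`|1 - a i j|%N).+1) (-1) ^+ k *:
    (divpow (qi i) (x i) (`|1 - a i j|%N - k) * x j * divpow (qi i) (x i) k).

Inductive uq_rel : freealg K uq_gen -> Prop :=
| uq_relKV i : uq_rel (fK i * fKV i - 1)
| uq_relVK i : uq_rel (fKV i * fK i - 1)
| uq_relKK i j : uq_rel (fK i * fK j - fK j * fK i)
| uq_relKE i j : uq_rel (fK i * fE j * fKV i - qi i ^ a i j *: fE j)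
| uq_relKF i j : uq_rel (fK i * fF j * fKV i - qi i ^ (- a i j) *: fF j)
| uq_relEF i j : uq_rel (fE i * fF j - fF j * fE i
    - ((i == j)%:R / (qi i - (qi i)^-1)) *: (fK i - fKV i))
| uq_relEE i j : i != j -> uq_rel (serre fE i j)
| uq_relFF i j : i != j -> uq_rel (serre fF i j).

Definition Uq : Type := quotalg uq_rel.
HB.instance Definition _ := GRing.PzRing.on Uq.
HB.instance Definition _ := GRing.Lmodule.on Uq.

Definition counit_mon (w : {fmonom uq_gen}) : K :=
  \prod_(x <- (w : seq uq_gen)) (if x is inr _ then 1 else 0).

Lemma counit_mon_morph : mmorphism counit_mon.
Proof.
split=> [x y|]; first by rewrite /counit_mon fmM big_cat.
by rewrite /counit_mon fm1 big_nil.
Qed.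
HB.instance Definition _ :=
  isMultiplicative.Build {fmonom uq_gen} K counit_mon counit_mon_morph.

Definition counit (x : freealg K uq_gen) : K :=
  monalg.mmap idfun (counit_mon : {mmorphism {fmonom uq_gen} -> K}) x.

Lemma counit_gen x :
  counit (fgen K x) = if x is inr _ then 1 else 0.
Proof.
by rewrite /counit /fgen monalg.mmapU mul1r /= /counit_mon fmU big_seq1.
Qed.

Lemma counitD : {morph counit : x y / x + y}.
Proof. exact: monalg.mmapD. Qed.
Lemma counitB : {morph counit : x y / x - y}.
Proof. exact: monalg.mmapB. Qed.
Lemma counitM : {morph counit : x y / x * y}.
Proof. by move=> x y; rewrite /counit rmorphM. Qed.
Lemma counit1 : counit 1 = 1. Proof. exact: rmorph1. Qed.
Lemma counitZ c x : counit (c *: x) = c * counit x.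
Proof. exact: monalg.mmapZ. Qed.
Lemma counit_sum I (r : seq I) (F : I -> freealg K uq_gen) :
  counit (\sum_(i <- r) F i) = \sum_(i <- r) counit (F i).
Proof. exact: raddf_sum. Qed.

Lemma counit_rel x : uq_rel x -> counit x = 0.
Proof.
case=> [i|i|i j|i j|i j|i j|i j _|i j _].
- by rewrite counitB counitM !counit_gen counit1 mulr1 subrr.
- by rewrite counitB counitM !counit_gen counit1 mulr1 subrr.
- by rewrite counitB !counitM !counit_gen subrr.
- by rewrite counitB counitZ !counitM !counit_gen !(mulr0, mul0r) subrr.
- by rewrite counitB counitZ !counitM !counit_gen !(mulr0, mul0r) subrr.
- by rewrite !counitB counitZ counitB !counitM !counit_gen
    !(mulr0, mul0r, subrr).
- rewrite counit_sum big1 // => k _.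
  by rewrite counitZ !counitM counit_gen !(mulr0, mul0r).
- rewrite counit_sum big1 // => k _.
  by rewrite counitZ !counitM counit_gen !(mulr0, mul0r).
Qed.

Lemma uq_neq0 : (1 : Uq) != 0.
Proof.
apply/eqP => e; have /quotpi_eq : quotpi uq_rel 1 = quotpi uq_rel 0.
  by rewrite quotpi1 [LHS]e /quotpi raddf0.
rewrite subr0 => h1.
suff h0 x : ideal_gen uq_rel x -> counit x = 0.
  by have /eqP := h0 _ h1; rewrite counit1 oner_eq0.
elim=> {x} [|x /counit_rel //|x y _ hx _ hy|b x _ hx|b x _ hx].
- exact: monalg.mmap0.
- by rewrite counitD hx hy addr0.
- by rewrite counitM hx mulr0.
- by rewrite counitM hx mul0r.
Qed.

HB.instance Definition _ := GRing.PzSemiRing_isNonZero.Build Uq uq_neq0.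
HB.instance Definition _ :=
  GRing.Lmodule_isLalgebra.Build K Uq (@quot_scalerAl _ _ uq_rel).
HB.instance Definition _ :=
  GRing.Lalgebra_isAlgebra.Build K Uq (@quot_scalerAr _ _ uq_rel).

Definition uE i : Uq := quotpi uq_rel (fE i).
Definition uF i : Uq := quotpi uq_rel (fF i).
Definition uK i : Uq := quotpi uq_rel (fK i).
Definition uKV i : Uq := quotpi uq_rel (fKV i).

Inductive subalg_gen (S : Uq -> Prop) : Uq -> Prop :=
| subalg_genS x : S x -> subalg_gen S x
| subalg_gen1 : subalg_gen S 1
| subalg_genD x y : subalg_gen S x -> subalg_gen S y -> subalg_gen S (x + y)
| subalg_genZ c x : subalg_gen S x -> subalg_gen S (c *: x)
| subalg_genM x y : subalg_gen S x -> subalg_gen S y -> subalg_gen S (x * y).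

Definition uq_nminus : Uq -> Prop :=
  subalg_gen (fun x => exists i, x = uF i).
Definition uq_bminus : Uq -> Prop :=
  subalg_gen (fun x => exists i, [\/ x = uF i, x = uK i | x = uKV i]).
Definition uq_bplus : Uq -> Prop :=
  subalg_gen (fun x => exists i, [\/ x = uE i, x = uK i | x = uKV i]).

(* The predicates below describe maps rather than build them; each map is
   determined by its predicate because U_q(g) is generated by E, F, K, K^-1. *)

Definition is_coproduct (Delta : Uq -> tensor Uq Uq) : Prop :=
  [/\ linear Delta, monoid_morphism Delta,
      forall i, Delta (uK i) = tens (uK i) (uK i),
      forall i, Delta (uE i) = tens (uE i) (uKV i) + tens 1 (uE i) &
      forall i, Delta (uF i) = tens (uF i) 1 + tens (uK i) (uF i)].

Definition anti_morphism (f : Uq -> Uq) : Prop :=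
  [/\ linear f, f 1 = 1 & forall x y, f (x * y) = f y * f x].

Definition is_antipode (S : Uq -> Uq) : Prop :=
  [/\ anti_morphism S,
      forall i, S (uK i) = uKV i,
      forall i, S (uE i) = - (uE i * uK i) &
      forall i, S (uF i) = - (uKV i * uF i)].

Definition is_transpose (tr : Uq -> Uq) : Prop :=
  [/\ anti_morphism tr, forall i, tr (uK i) = uK i,
      forall i, tr (uE i) = uF i & forall i, tr (uF i) = uE i].

Definition is_adjoint_action (Delta : Uq -> tensor Uq Uq) (S : Uq -> Uq)
    (ad : Uq -> Uq -> Uq) : Prop :=
  forall x s, tens_sum (Delta x) s ->
    forall y, ad x y = \sum_(p <- s) p.1 * y * S p.2.

Definition int_Kpow (i : 'I_n) (m : int) : Uq :=
  if m is Negz k then uKV i ^+ k.+1 else uK i ^+ `|m|%N.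

Definition is_braid (T : 'I_n -> Uq -> Uq) : Prop :=
  forall i,
  [/\ linear (T i), monoid_morphism (T i), bijective (T i),
      forall j, T i (uK j) = uK j * int_Kpow i (- a i j) &
  [/\ T i (uE i) = - (uF i * uK i),
      T i (uF i) = - (uKV i * uE i),
      forall j, j != i -> T i (uE j) =
        \sum_(k < (`|a i j|%N).+1) (- qi i) ^- k *:
          (divpow (qi i) (uE i) (`|a i j|%N - k) * uE j
           * divpow (qi i) (uE i) k) &
      forall j, j != i -> T i (uF j) =
        \sum_(k < (`|a i j|%N).+1) (- qi i) ^+ k *:
          (divpow (qi i) (uF i) k * uF j
           * divpow (qi i) (uF i) (`|a i j|%N - k))]].

(* T_w = T_(i_1) ... T_(i_k) for the word w = [:: i_1; ...; i_k] *)
Definition braid_word (T : 'I_n -> Uq -> Uq) (w : seq 'I_n) (x : Uq) : Uq :=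
  foldr T x w.

(* U_q(n_I^-), for a reduced expression [w] of w_I *)
Definition uq_nil (T : 'I_n -> Uq -> Uq) (w : seq 'I_n) (x : Uq) : Prop :=
  uq_nminus x /\ uq_nminus (braid_word T w x).

(* [form y x] is constrained for y in U_q(b^-) and x in U_q(b^+) only. *)
Record is_pairing (Delta : Uq -> tensor Uq Uq) (form : Uq -> Uq -> K) : Prop := {
  pairing_linl : forall c y y' x,
    uq_bminus y -> uq_bminus y' -> uq_bplus x ->
    form (c *: y + y') x = c * form y x + form y' x;
  pairing_linr : forall c y x x',
    uq_bminus y -> uq_bplus x -> uq_bplus x' ->
    form y (c *: x + x') = c * form y x + form y x';
  pairing_mulr : forall y x x' s,
    uq_bminus y -> uq_bplus x -> uq_bplus x' ->
    tens_sum (Delta y) s ->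
    (forall p, p \in s -> uq_bminus p.1 /\ uq_bminus p.2) ->
    form y (x * x') = \sum_(p <- s) form p.1 x' * form p.2 x;
  pairing_mull : forall y y' x s,
    uq_bminus y -> uq_bminus y' -> uq_bplus x ->
    tens_sum (Delta x) s ->
    (forall p, p \in s -> uq_bplus p.1 /\ uq_bplus p.2) ->
    form (y * y') x = \sum_(p <- s) form y p.1 * form y' p.2;
  pairing_KK : forall i j, form (uK i) (uK j) = q ^ (- ((d i)%:Z * a i j));
  pairing_FE : forall i j,
    form (uF i) (uE j) = - ((i == j)%:R / (qi i - (qi i)^-1));
  pairing_FK : forall i j, form (uF i) (uK j) = 0;
  pairing_KE : forall i j, form (uK i) (uE j) = 0
}.

(* [x] has weight lambda for ad, where [m j] = lambda(h_j) *)
Definition ad_weight (ad : Uq -> Uq -> Uq) (m : 'I_n -> int) (x : Uq) : Prop :=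
  forall j, ad (uK j) x = qi j ^ m j *: x.

(* [x] has weight - sum_i c_i alpha_i *)
Definition neg_weight (ad : Uq -> Uq -> Uq) (c : 'I_n -> nat) (x : Uq) : Prop :=
  ad_weight ad (fun j => - \sum_i a j i * (c i)%:Z) x.

(* the form < , > on the subspace N = U_q(n_I^-), I = I_0 \ {i0} *)
Record is_nil_form (i0 : 'I_n) (N : Uq -> Prop) (ad : Uq -> Uq -> Uq)
    (tr : Uq -> Uq) (form nform : Uq -> Uq -> K) : Prop := {
  nil_form_linl : forall c f f' g, N f -> N f' -> N g ->
    nform (c *: f + f') g = c * nform f g + nform f' g;
  nil_form_linr : forall c f g g', N f -> N g -> N g' ->
    nform f (c *: g + g') = c * nform f g + nform f g';
  nil_formE : forall f g c c', N f -> N g ->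
    neg_weight ad c f -> neg_weight ad c' g ->
    nform f g = (q^-1 - q) ^+ c i0 * form f (tr g)
}.

(* [D] is the adjoint of left multiplication by [g], written {}^t g (d) *)
Definition is_tpartial (N : Uq -> Prop) (nform : Uq -> Uq -> K) (g : Uq)
    (D : Uq -> Uq) : Prop :=
  [/\ forall f, N f -> N (D f),
      forall c f f', N f -> N f' -> D (c *: f + f') = c *: D f + D f' &
      forall f f', N f -> N f' -> nform (D f) f' = nform f (g * f')].

(* [f] is a highest weight vector of N for ad(U_q(l_I)), of weight
   - 2 varpi_i0, where I = I_0 \ {i0} *)
Definition is_hwv (i0 : 'I_n) (N : Uq -> Prop) (ad : Uq -> Uq -> Uq)
    (f : Uq) : Prop :=
  [/\ N f, f != 0, forall i, i != i0 -> ad (uE i) f = 0 &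
      ad_weight ad (fun j => - 2%:Z * (j == i0)%:Z) f].

End QuantumGroup.

Definition Cq (R : realType) : fieldType := {fraction {poly R[i]}}.
Definition qvar (R : realType) : Cq R := tofrac ('X : {poly R[i]}).
Definition Uqg (R : realType) (D : simple_lie R) :=
  Uq (qvar R) (cartan_mx D) (half_norm (s := D)).

(* Main.v *)
(** The pairing with U_q(n^+) embeds U_q(n^-) into the quantum shuffle algebra.
    There the commutators with E_i become the left and right derivations l_i and
    r_i, which remove the first or last letter of a word, and the form < , >
    becomes the word pairing twisted by word reversal; so f becomes an element
    phi killed by l_i and r_i for i <> i0.  Let Z_s be the space of elements of
    weight s wt(phi) killed by these derivations.

    Commutativity of the nilradical gives (alpha_i0, b) >= 0 for the roots b of
    the nilradical, and sl_2-theory turns this into bounds on the derivations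
    along i0 which force the elements of Z_s to commute with all generators.
    Since the algebra has no zero divisors, a descent along derivations shows
    that Z_s is the line spanned by phi^s.

    The adjoint P of the multiplication by phi is a combination of products of
    the r_i.  As phi is central, each r_i maps phi^n to q-numbers in n times
    products of phi^(n-1) and derivatives of phi, so phi^L P(phi^n) is
    phi^n Y(q_i0^n) for some L and some polynomial family Y.  As P(phi^(s+1))
    lies in Z_s, it is b_s phi^s, and comparing one coefficient shows that b_s
    is a polynomial in q_i0^s.  That <f^s, f^s> <> 0 follows from a hermitian
    version of the pairing, which is positive definite when a rational function
    of q counts as positive if its leading coefficients are. *)
Require Import Defs.
From HB Require Import structures.
From mathcomp Require Import all_boot all_order all_algebra.
From mathcomp Require Import boolp reals.
From mathcomp Require Import complex.
From mathcomp Require Import ssrAC ring lra zify.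

Set Implicit Arguments.
Unset Strict Implicit.
Unset Printing Implicit Defensive.

Import Order.TTheory GRing.Theory Num.Theory.
Local Open Scope ring_scope.

(** * Weight vectors of sl_2 *)

(** The scalars are ratios of norms: adjointness gives [b s * <f^s, f^s> = <f^(s+1), f^(s+1)>]. Of
    [U_q(n_I^-)] the argument keeps that it lies in [U_q(n^-)], contains 1 and is closed under
    products.

    The number that shapes the proof is the value 2 of [2 varpi_i0] at [h_i0]. An element of Z_s is
    killed by the (s+1)st powers of [l_i0] and [r_i0], and its weight has the value [2s = s + s] at
    [h_i0]. This is exactly the boundary of the sl_2 bound, where the element is extremal and
    commutes with [F_i0] without a scalar.

    The pairing is given by axioms alone. That it has no radical on [U_q(n^-)], and that an element
    commuting with [E_i] is killed by [l_i] and [r_i], is proved without a triangular decomposition;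
    the Serre relations act through the local nilpotency of [ad(F_i)].

    Since the coefficients are complex, positivity needs a hermitian form. Uniqueness in Z_1 makes
    phi proportional to its complex conjugate and to its reversal, which leads from the hermitian
    norm back to [<f^s, f^s>]. *)

(* [br] is either n |-> [n]_t or n |-> n, so that the quantum and the classical
   versions of the sl_2 arguments are the same lemmas. *)
Record is_bracket (K : fieldType) (br : int -> K) : Prop := {
  br0 : br 0 = 0;
  br1 : br 1 = 1;
  br_neq0 : forall m, m != 0 -> br m != 0;
  br_up : forall p m : int, br (p + 1) * br (m + p) =
    br p * br (m + p - 1) + br (m + p + p);
  br_down : forall k m : int, br (k + 1) * br (m - k) =
    br k * br (m - k + 1) + br (m - k - k);
  br_split : forall p k m : int,
    br p * br (m + p + 1) + br k * br (m - k + 1) =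
    br (p + k) * br (m + p - k + 1)
}.

Section Sl2.
Context (K : fieldType) (V : lmodType K) (M : int -> V -> Prop).
Context (e f : V -> V) (br : int -> K).
Hypothesis brP : is_bracket br.
Hypothesis ML : forall m c x y, M m x -> M m y -> M m (c *: x + y).
Hypothesis eL : linear e.
Hypothesis fL : linear f.
Hypothesis eM : forall m x, M m x -> M (m + 2) (e x).
Hypothesis fM : forall m x, M m x -> M (m - 2) (f x).
Hypothesis efM : forall m x, M m x -> e (f x) = f (e x) + br m *: x.
Hypothesis fnil : forall m x, M m x -> exists N, iter N f x = 0.

Let e0 : e 0 = 0.
Proof. by have := eL (-1) 0 0; rewrite scaleN1r oppr0 addr0 scaleN1r addNr. Qed.
Let f0 : f 0 = 0.
Proof. by have := fL (-1) 0 0; rewrite scaleN1r oppr0 addr0 scaleN1r addNr. Qed.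
Let eZ c x : e (c *: x) = c *: e x.
Proof. by have := eL c x 0; rewrite e0 !addr0. Qed.
Let fZ c x : f (c *: x) = c *: f x.
Proof. by have := fL c x 0; rewrite f0 !addr0. Qed.
Let eD x y : e (x + y) = e x + e y.
Proof. by have := eL 1 x y; rewrite !scale1r. Qed.
Let fD x y : f (x + y) = f x + f y.
Proof. by have := fL 1 x y; rewrite !scale1r. Qed.

Let M0 m x : M m x -> M m 0.
Proof. by move=> hx; rewrite -(addNr x) -scaleN1r; apply: ML. Qed.

Lemma sl2_MZ m c x : M m x -> M m (c *: x).
Proof. by move=> hx; rewrite -[_ *: _]addr0; apply: ML => //; apply: M0 hx. Qed.

Lemma sl2_MB m x y : M m x -> M m y -> M m (x - y).
Proof. by move=> hx hy; rewrite addrC -scaleN1r; apply: ML. Qed.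

Lemma sl2_iterM m k x : M m x -> M (m + k%:Z *+ 2) (iter k e x).
Proof.
move=> hx; elim: k => [|k IH]; first by rewrite mul0rn addr0.
have -> : m + k.+1%:Z *+ 2 = m + k%:Z *+ 2 + 2 by lia.
exact: eM.
Qed.

Lemma sl2_fiterM m k x : M m x -> M (m - k%:Z *+ 2) (iter k f x).
Proof.
move=> hx; elim: k => [|k IH]; first by rewrite mul0rn subr0.
have -> : m - k.+1%:Z *+ 2 = m - k%:Z *+ 2 - 2 by lia.
exact: fM.
Qed.

Lemma sl2_iterZ (g : V -> V) (gZ : forall c x, g (c *: x) = c *: g x) k c x :
  iter k g (c *: x) = c *: iter k g x.
Proof. by elim: k => //= k ->. Qed.

Lemma sl2_iterD (g : V -> V) (gD : forall x y, g (x + y) = g x + g y) k x y :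
  iter k g (x + y) = iter k g x + iter k g y.
Proof. by elim: k => //= k ->. Qed.

Lemma sl2_iter0 (g : V -> V) (g0 : g 0 = 0) k : iter k g 0 = 0.
Proof. by elim: k => //= k ->. Qed.

Lemma sl2_eiterf m x k : M m x ->
  iter k.+1 e (f x) = f (iter k.+1 e x)
    + (br k.+1%:Z * br (m + k%:Z)) *: iter k e x.
Proof.
move=> hx; elim: k => [|k IH].
  by rewrite /= (efM hx) addr0 (br1 brP) mul1r.
rewrite iterS IH eD eZ [e (f _)](efM (sl2_iterM k.+1 hx)) -addrA; congr (_ + _).
rewrite -[e (iter k e x)]/(iter k.+1 e x) -scalerDl; congr (_ *: _).
have -> : k.+2%:Z = k.+1%:Z + 1 by lia.
rewrite (br_up brP) addrC; congr (_ * br _ + br _); lia.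
Qed.

Lemma sl2_efiter m x k : M m x ->
  e (iter k.+1 f x) = iter k.+1 f (e x)
    + (br k.+1%:Z * br (m - k%:Z)) *: iter k f x.
Proof.
move=> hx; elim: k => [|k IH].
  by rewrite /= (efM hx) subr0 (br1 brP) mul1r.
rewrite iterS (efM (sl2_fiterM k.+1 hx)) IH fD fZ -addrA; congr (_ + _).
rewrite -[f (iter k f x)]/(iter k.+1 f x) -scalerDl; congr (_ *: _).
have -> : k.+2%:Z = k.+1%:Z + 1 by lia.
rewrite (br_down brP); congr (_ * br _ + br _); lia.
Qed.

(** The hypothesis says that the Casimir element acts on [x] as on a module of highest weight
    [m + 2p]. It makes [e f^(k+1) x] equal to [[p+k+1][m+p-k]] times [f^k x]. As [m + p < 0], no
    factor vanishes, so the vanishing of [f^N x] descends to [x]. *)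
Lemma sl2_fe_eq0 m x (p : nat) : M m x -> m + p%:Z < 0 ->
  f (e x) = (br p%:Z * br (m + p%:Z + 1)) *: x -> x = 0.
Proof.
move=> hx mp hfe; have [N fN] := fnil hx.
have step k : iter k.+1 f x = 0 -> iter k f x = 0.
  move=> hk; have := sl2_efiter k hx; rewrite hk e0.
  have -> : iter k.+1 f (e x) = (br p%:Z * br (m + p%:Z + 1)) *: iter k f x.
    by rewrite iterSr hfe sl2_iterZ.
  rewrite -scalerDl; have -> : br k.+1%:Z * br (m - k%:Z)
      = br k.+1%:Z * br (m - k.+1%:Z + 1) by congr (_ * br _); lia.
  rewrite (br_split brP) => /esym/eqP; rewrite scaler_eq0 mulf_eq0.
  case/orP=> [|/eqP //]; case/orP=> /eqP h.
    by have /eqP [] : br (p%:Z + k.+1%:Z) != 0 by apply: (br_neq0 brP); lia.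
  have /eqP [] : br (m + p%:Z - k.+1%:Z + 1) != 0 by apply: (br_neq0 brP); lia.
  exact: h.
by elim: N fN => // N IH /step.
Qed.

(** For the step from [p] to [p + 1], the difference of [f e x] and [[p+1][m+p+2] x] is killed by
    one power of [e] less than [x], so it vanishes by induction and [sl2_fe_eq0] applies. *)
Lemma sl2_inj m x (p : nat) : M m x -> iter p.+1 e x = 0 -> m + p%:Z < 0 ->
  x = 0.
Proof.
elim: p x => [|p IH] x hx ex mp.
  apply: (sl2_fe_eq0 (p := 0) hx mp).
  by move: ex => /= ->; rewrite f0 (br0 brP) mul0r scale0r.
apply: (sl2_fe_eq0 hx mp); apply/eqP; rewrite -subr_eq0; apply/eqP.
apply: IH; last by lia.
  apply: sl2_MB; last exact: sl2_MZ.
  by have := fM (eM hx); rewrite addrK.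
have iL : forall y z, iter p.+1 e (y - z) = iter p.+1 e y - iter p.+1 e z.
  move=> y z; rewrite -scaleN1r sl2_iterD // sl2_iterZ // scaleN1r //.
rewrite iL sl2_iterZ // (sl2_eiterf p (eM hx)) -iterSr ex f0 add0r -iterSr.
have -> : m + 2 + p%:Z = m + p.+1%:Z + 1 by lia.
by rewrite subrr.
Qed.

(** In the boundary case [m + p = 0] the commutator term of [e^(p+1) f x] carries the factor
    [[m + p]]. So [e^(p+1)] kills [f x], whose weight [m - 2] falls under [sl2_inj]. *)
Lemma sl2_lowest m x (p : nat) : M m x -> iter p.+1 e x = 0 -> m + p%:Z = 0 ->
  f x = 0.
Proof.
move=> hx ex mp; apply: (sl2_inj (p := p) (fM hx)); last by lia.
by rewrite (sl2_eiterf p hx) ex f0 add0r mp (br0 brP) mulr0 scale0r.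
Qed.

Lemma sl2_efiter_hw m x j k : M m x -> e x = 0 -> (j <= k)%N ->
  iter j e (iter k f x) =
  (\prod_(i < j) (br (k - i)%N%:Z * br (m - (k - i)%N%:Z + 1))) *:
     iter (k - j) f x.
Proof.
move=> hx ex; elim: j => [|j IH] jk; first by rewrite big_ord0 scale1r subn0.
rewrite iterS IH ?(ltnW jk) // eZ.
have -> : (k - j = (k - j.+1).+1)%N by lia.
rewrite (sl2_efiter _ hx) ex sl2_iter0 // add0r scalerA big_ord_recr /=.
congr ((_ * _) *: _); have -> : (k - j = (k - j.+1).+1)%N by lia.
congr (_ * br _); lia.
Qed.

(** Subtracting a multiple of [f^p e^p x] lowers the order of nilpotency of [e] on [x]. If
    [m + p >= 0], the scalar by which [e^p f^p] acts on the highest weight vector [e^p x] is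
    invertible; otherwise [x = 0] by [sl2_inj]. *)
Lemma sl2_hw_decomp m x (p : nat) : M m x -> iter p e x = 0 ->
  exists u : nat -> V,
  [/\ forall k, M (m + k%:Z *+ 2) (u k), forall k, e (u k) = 0,
      forall k, m + k%:Z < 0 -> u k = 0
    & x = \sum_(k < p) iter k f (u k)].
Proof.
elim: p x => [|p IH] x hx ex.
  exists (fun=> 0); split=> // [k|]; last by rewrite big_ord0.
  exact: M0 (sl2_iterM k hx).
case: (ltrP (m + p%:Z) 0) => [mp|mp].
  exists (fun=> 0); split=> // [k|]; first exact: M0 (sl2_iterM k hx).
  by rewrite (sl2_inj hx ex mp) big1 // => i _; rewrite sl2_iter0.
pose y := iter p e x.
have hy : M (m + p%:Z *+ 2) y by apply: sl2_iterM.
have ey : e y = 0 by [].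
pose c := \prod_(i < p) (br (p - i)%N%:Z
                         * br (m + p%:Z *+ 2 - (p - i)%N%:Z + 1)).
have c0 : c != 0.
  apply/prodf_neq0 => i _; rewrite mulf_neq0 //; apply: (br_neq0 brP).
    by have := ltn_ord i; lia.
  by have := ltn_ord i; lia.
have hz : M m (x - c^-1 *: iter p f y).
  apply: sl2_MB => //; apply: sl2_MZ.
  by have := sl2_fiterM p hy; rewrite addrK.
have ez : iter p e (x - c^-1 *: iter p f y) = 0.
  rewrite -scaleN1r sl2_iterD // sl2_iterZ // sl2_iterZ //.
  rewrite (sl2_efiter_hw hy ey (leqnn p)) subnn /= -/c.
  by rewrite [c^-1 *: _]scalerA mulVf // scale1r scaleN1r subrr.
have [u [uM ue un ux]] := IH _ hz ez.
exists (fun k => if (k < p)%N then u k else if k == p then c^-1 *: y else 0).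
split=> [k|k|k mk|].
- case: ifP => _ //; case: ifP => [/eqP ->|_] //.
    exact: sl2_MZ.
  exact: M0 (sl2_iterM k hx).
- by case: ifP => _ //; case: ifP => [_|_] //; rewrite eZ ey scaler0.
- case: ifP => _; first exact: un.
  by case: ifP => // /eqP kp; exfalso; move: mk mp; rewrite kp; lia.
- rewrite big_ord_recr /= ltnn eqxx -[LHS](subrK (c^-1 *: iter p f y)).
  by rewrite {1}ux sl2_iterZ //; congr (_ + _); apply: eq_bigr => i _; rewrite ltn_ord.
Qed.

End Sl2.

Lemma int_is_bracket (K : fieldType) :
  [pchar K] =i pred0 -> is_bracket (fun m : int => m%:~R : K).
Proof.
move=> c0; split.
- by [].
- by [].
- have h := (pcharf0P K).1 c0.
  by move=> m; case: m => k kn; rewrite ?NegzE ?mulrNz ?oppr_eq0 -pmulrn h.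
- by move=> p m; rewrite -!intrM -intrD; congr (_%:~R); lia.
- by move=> p m; rewrite -!intrM -intrD; congr (_%:~R); lia.
- by move=> p k m; rewrite -!intrM -intrD; congr (_%:~R); lia.
Qed.

Definition qbr (K : fieldType) (t : K) (m : int) : K :=
  (t ^ m - t ^ (- m)) / (t - t^-1).

Lemma qbr_is_bracket (K : fieldType) (t : K) :
  (forall m : int, m != 0 -> t ^ m != 1) -> t != 0 -> is_bracket (qbr t).
Proof.
move=> tn t0.
have ts : t - t^-1 != 0.
  apply/eqP => h; have /eqP[] := tn 2 isT.
  by rewrite -[2]/(1 + 1) expfzDr // expr1z -{2}(subr0 t) -h opprB addrC subrK mulfV.
have ts2 : t * t - 1 != 0.
  by apply: contraNneq ts => h; rewrite -(mulfK t0 (t - _)) mulrBl mulVf // h mul0r.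
have H (x y : int) : t ^ (x + y) = t ^ x * t ^ y by rewrite expfzDr.
split.
- by rewrite /qbr oppr0 subrr mul0r.
- by rewrite /qbr expr1z -invr_expz expr1z mulfV.
- move=> m m0; rewrite mulf_neq0 ?invr_eq0 // subr_eq0.
  have mm : m + m != 0 by lia.
  apply/eqP => h; have /eqP[] := tn _ mm.
  by rewrite H {2}h -H subrr.
- move=> p m; rewrite /qbr !opprD !opprK !H -!invr_expz expr1z.
  have := expfz_neq0 p t0; have := expfz_neq0 m t0.
  move: (t ^ p) (t ^ m) => x y y0 x0.
  by field; rewrite t0 ts2 x0 y0.
- move=> k m; rewrite /qbr !opprD !opprK !H -!invr_expz !expr1z.
  have := expfz_neq0 k t0; have := expfz_neq0 m t0.
  move: (t ^ k) (t ^ m) => x y y0 x0.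
  by field; rewrite t0 ts2 x0 y0.
- move=> p k m; rewrite /qbr !opprD !opprK !H -!invr_expz expr1z.
  have := expfz_neq0 p t0; have := expfz_neq0 m t0; have := expfz_neq0 k t0.
  move: (t ^ p) (t ^ m) (t ^ k) => x y z z0 y0 x0.
  by field; rewrite t0 ts2 x0 y0 z0.
Qed.

(** * Quantum shuffles *)

Definition qshuffle (K : fieldType) (n : nat) (P : 'I_n -> 'I_n -> K) : Type :=
  seq 'I_n -> K.

(* The dual of the free algebra with its quantum shuffle product: left and right
   skew derivations are the restrictions to words with a given first or last
   letter, so an element with vanishing derivatives and constant term is 0. *)
Section Shuffle.
Context (K : fieldType) (n : nat) (P : 'I_n -> 'I_n -> K).
Notation word := (seq 'I_n).

Notation shuf := (qshuffle P).
HB.instance Definition _ := gen_eqMixin shuf.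
HB.instance Definition _ := gen_choiceMixin shuf.

Let sadd (x y : shuf) : shuf := fun w => x w + y w.
Let saddA : associative sadd.
Proof. by move=> x y z; apply/funext => w; rewrite /sadd addrA. Qed.
Let saddC : commutative sadd.
Proof. by move=> x y; apply/funext => w; rewrite /sadd addrC. Qed.
Let sadd0 : left_id (fun=> 0 : K) sadd.
Proof. by move=> x; apply/funext => w; rewrite /sadd add0r. Qed.
Let saddN : left_inverse (fun=> 0 : K) (fun (x : shuf) w => - x w) sadd.
Proof. by move=> x; apply/funext => w; rewrite /sadd addNr. Qed.

HB.instance Definition _ :=
  GRing.isZmodule.Build shuf saddA saddC sadd0 saddN.

Lemma shufD (x y : shuf) w : (x + y) w = x w + y w. Proof. by []. Qed.
Lemma shuf0 w : (0 : shuf) w = 0. Proof. by []. Qed.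

Let sscale (c : K) (x : shuf) : shuf := fun w => c * x w.
Let sscaleA a b x : sscale a (sscale b x) = sscale (a * b) x.
Proof. by apply/funext => w; rewrite /sscale mulrA. Qed.
Let sscale1 : left_id 1 sscale.
Proof. by move=> x; apply/funext => w; rewrite /sscale mul1r. Qed.
Let sscaleDr : right_distributive sscale +%R.
Proof. by move=> c x y; apply/funext => w; rewrite /sscale shufD mulrDr. Qed.
Let sscaleDl x : {morph sscale^~ x : a b / a + b}.
Proof. by move=> a b; apply/funext => w; rewrite /sscale mulrDl. Qed.

HB.instance Definition _ :=
  GRing.Zmodule_isLmodule.Build K shuf sscaleA sscale1 sscaleDr sscaleDl.

Lemma shufZ c (x : shuf) w : (c *: x) w = c * x w. Proof. by []. Qed.

Lemma shuf_sum I (r : seq I) (Q : pred I) (G : I -> shuf) w :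
  (\sum_(i <- r | Q i) G i) w = \sum_(i <- r | Q i) G i w.
Proof.
elim/big_rec2: _ => [|i y1 y2 _ <-]; first exact: shuf0.
by rewrite shufD.
Qed.

Definition lder (i : 'I_n) (x : shuf) : shuf := fun w => x (i :: w).
Definition rder (i : 'I_n) (x : shuf) : shuf := fun w => x (rcons w i).
Definition twist (i : 'I_n) (x : shuf) : shuf :=
  fun w => (\prod_(j <- w) P i j) * x w.

Lemma lder_linear i : linear (lder i). Proof. by []. Qed.
Lemma rder_linear i : linear (rder i). Proof. by []. Qed.
Lemma twist_linear i : linear (twist i).
Proof.
by move=> c x y; apply/funext => w; rewrite /twist !(shufD, shufZ) mulrDr mulrCA.
Qed.
HB.instance Definition _ i :=
  GRing.isLinear.Build K shuf shuf _ (lder i) (lder_linear i).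
HB.instance Definition _ i :=
  GRing.isLinear.Build K shuf shuf _ (rder i) (rder_linear i).
HB.instance Definition _ i :=
  GRing.isLinear.Build K shuf shuf _ (twist i) (twist_linear i).

Lemma lderD i x y : lder i (x + y) = lder i x + lder i y. Proof. by []. Qed.
Lemma lderZ i c x : lder i (c *: x) = c *: lder i x. Proof. by []. Qed.
Lemma rderD i x y : rder i (x + y) = rder i x + rder i y. Proof. by []. Qed.
Lemma rderZ i c x : rder i (c *: x) = c *: rder i x. Proof. by []. Qed.
Lemma twistD i x y : twist i (x + y) = twist i x + twist i y.
Proof. exact: raddfD. Qed.
Lemma twistZ i c x : twist i (c *: x) = c *: twist i x.
Proof. exact: linearZ. Qed.

Lemma lrderC i j x : lder i (rder j x) = rder j (lder i x). Proof. by []. Qed.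

Lemma twistC i j x : twist i (twist j x) = twist j (twist i x).
Proof. by apply/funext => w; rewrite /twist mulrCA. Qed.

Lemma lder_twist i j x : lder i (twist j x) = P j i *: twist j (lder i x).
Proof. by apply/funext => w; rewrite /lder /twist shufZ big_cons mulrA. Qed.

Lemma rder_twist i j x : rder i (twist j x) = P j i *: twist j (rder i x).
Proof.
apply/funext => w; rewrite /rder /twist shufZ -cats1 big_cat big_seq1 /=.
by rewrite mulrA [P j i * _]mulrC.
Qed.

(** The twisted Leibniz rule of the left derivations, read as a recursion on words, determines the
    product. The sum over shuffles with its powers of q never has to be written down. *)
Fixpoint shmulw (x y : shuf) (w : word) : K :=
  if w is i :: w' then shmulw (lder i x) y w' + shmulw (twist i x) (lder i y) w'
  else x [::] * y [::].
Definition shmul (x y : shuf) : shuf := shmulw x y.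

Definition shone : shuf := fun w => (w == [::])%:R.

Let shmul_nil x y : shmul x y [::] = x [::] * y [::]. Proof. by []. Qed.
Let lder_shmul i x y :
  lder i (shmul x y) = shmul (lder i x) y + shmul (twist i x) (lder i y).
Proof. by []. Qed.
Let shmul_cons i w x y :
  shmul x y (i :: w) = shmul (lder i x) y w + shmul (twist i x) (lder i y) w.
Proof. by []. Qed.

Lemma shmulDl x y z : shmul (x + y) z = shmul x z + shmul y z.
Proof.
apply/funext => w; rewrite shufD; elim: w x y z => [|i w IH] x y z.
  by rewrite !shmul_nil mulrDl.
by rewrite !shmul_cons ?(lderD, twistD) !IH addrACA.
Qed.

Lemma shmulDr x y z : shmul x (y + z) = shmul x y + shmul x z.
Proof.
apply/funext => w; rewrite shufD; elim: w x y z => [|i w IH] x y z.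
  by rewrite !shmul_nil mulrDr.
by rewrite !shmul_cons ?(lderD, twistD) !IH addrACA.
Qed.

Lemma shmulZl c x y : c *: shmul x y = shmul (c *: x) y.
Proof.
apply/funext => w; rewrite shufZ; elim: w x y => [|i w IH] x y.
  by rewrite !shmul_nil shufZ mulrA.
by rewrite !shmul_cons ?(lderZ, twistZ) -!IH mulrDr.
Qed.

Lemma shmulZr c x y : c *: shmul x y = shmul x (c *: y).
Proof.
apply/funext => w; rewrite shufZ; elim: w x y => [|i w IH] x y.
  by rewrite !shmul_nil shufZ mulrCA.
by rewrite !shmul_cons ?(lderZ, twistZ) -!IH mulrDr.
Qed.

Lemma twist_shmul i x y : twist i (shmul x y) = shmul (twist i x) (twist i y).
Proof.
apply/funext => w; elim: w x y => [|j w IH] x y.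
  by rewrite /twist !shmul_nil /twist !big_nil !mul1r.
rewrite -[LHS]/(lder j (twist i (shmul x y)) w) -[RHS]/(lder j _ w).
rewrite lder_shmul !lder_twist lder_shmul twistD -shmulZr -shmulZl twistC.
by rewrite !(shufZ, shufD) !IH mulrDr.
Qed.

Lemma shmulA : associative shmul.
Proof.
move=> x y z; apply/funext => w; elim: w x y z => [|i w IH] x y z.
  by rewrite !shmul_nil mulrA.
rewrite !shmul_cons !lder_shmul.
by rewrite shmulDr shmulDl !shufD !IH twist_shmul addrA.
Qed.

Lemma lder_shone i : lder i shone = 0.
Proof. by []. Qed.

Lemma twist_shone i : twist i shone = shone.
Proof.
apply/funext => -[|j w]; rewrite /twist /shone /= ?big_nil ?mul1r //.
by rewrite mulr0.
Qed.

Lemma shmul0l x : shmul 0 x = 0 .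
Proof. by rewrite -(scale0r (0 : shuf)) -shmulZl !scale0r. Qed.
Lemma shmul0r x : shmul x 0 = 0 .
Proof. by rewrite -(scale0r (0 : shuf)) -shmulZr !scale0r. Qed.

Lemma shmul1 : left_id shone shmul.
Proof.
move=> x; apply/funext => w; elim: w x => [|i w IH] x; first by rewrite shmul_nil mul1r.
by rewrite shmul_cons lder_shone twist_shone shmul0l IH add0r.
Qed.

Lemma shmulr1 : right_id shone shmul.
Proof.
move=> x; apply/funext => w; elim: w x => [|i w IH] x; first by rewrite shmul_nil mulr1.
by rewrite shmul_cons lder_shone shmul0r IH addr0.
Qed.

Let sDl : left_distributive shmul +%R.
Proof. by move=> x y z; apply: shmulDl. Qed.
Let sDr : right_distributive shmul +%R.
Proof. by move=> x y z; apply: shmulDr. Qed.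

HB.instance Definition _ :=
  GRing.Zmodule_isPzRing.Build shuf shmulA shmul1 shmulr1 sDl sDr.

Lemma shuf1_neq0 : (1 : shuf) != 0.
Proof.
apply/eqP => h; have : (1 : shuf) [::] = (0 : shuf) [::] by rewrite h.
by move/eqP; rewrite oner_eq0.
Qed.

HB.instance Definition _ := GRing.PzSemiRing_isNonZero.Build shuf shuf1_neq0.

Let sZl (c : K) (x y : shuf) : c *: (x * y) = (c *: x) * y.
Proof. exact: shmulZl. Qed.
Let sZr (c : K) (x y : shuf) : c *: (x * y) = x * (c *: y).
Proof. exact: shmulZr. Qed.
HB.instance Definition _ := GRing.Lmodule_isLalgebra.Build K shuf sZl.
HB.instance Definition _ := GRing.Lalgebra_isAlgebra.Build K shuf sZr.

Lemma shufM_nil (x y : shuf) : (x * y) [::] = x [::] * y [::]. Proof. by []. Qed.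

Lemma lderM i (x y : shuf) : lder i (x * y) = lder i x * y + twist i x * lder i y.
Proof. by []. Qed.

Lemma twistM i (x y : shuf) : twist i (x * y) = twist i x * twist i y.
Proof. exact: twist_shmul. Qed.

Lemma shuf1E w : (1 : shuf) w = (w == [::])%:R. Proof. by []. Qed.
Lemma lder1 i : lder i 1 = 0. Proof. exact: lder_shone. Qed.
Lemma twist1 i : twist i 1 = 1. Proof. exact: twist_shone. Qed.
Lemma rder1 i : rder i 1 = 0.
Proof. by apply/funext => w; rewrite /rder shuf1E; case: w. Qed.

Definition Fsh (i : 'I_n) : shuf := fun w => (w == [:: i])%:R.

Lemma lderF i j : lder i (Fsh j) = (i == j)%:R *: 1.
Proof.
apply/funext => w; rewrite /lder /Fsh shufZ shuf1E eqseq_cons.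
by case: eqP; rewrite ?mul1r ?mul0r.
Qed.

Lemma rderF i j : rder i (Fsh j) = (i == j)%:R *: 1.
Proof.
apply/funext => w; rewrite /rder /Fsh shufZ shuf1E -[[:: j]]/(rcons [::] j).
by rewrite eqseq_rcons andbC; case: eqP; rewrite ?mul1r ?mul0r.
Qed.

Lemma twistF i j : twist i (Fsh j) = P i j *: Fsh j.
Proof.
apply/funext => w; rewrite /twist /Fsh shufZ.
case: eqP => [->|_]; last by rewrite !mulr0.
by rewrite big_seq1.
Qed.

Lemma shuf_eq (x y : shuf) :
  x [::] = y [::] -> (forall i, lder i x = lder i y) -> x = y.
Proof.
move=> h hl; apply/funext => -[|i w] //.
exact: (congr1 (fun z : shuf => z w) (hl i)).
Qed.

Section Sym.
Hypothesis Psym : forall i j, P i j = P j i.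

(** Induction from the other end of the word: [lder j] and [rder i] commute, and the symmetry of [P]
    makes the scalars of the two twists agree. *)
Lemma rderM i (x y : shuf) : rder i (x * y) = rder i x * twist i y + x * rder i y.
Proof.
apply/funext => w; rewrite shufD; elim: w x y => [|j w IH] x y.
  have -> : rder i (x * y) [::] = (lder i x * y) [::] + (twist i x * lder i y) [::] by [].
  by rewrite !shufM_nil /twist !big_nil !mul1r.
have E (z t : shuf) : rder i (z * t) (j :: w)
    = rder i (lder j z * t) w + rder i (twist j z * lder j t) w by [].
have E' (z t : shuf) : (z * t : shuf) (j :: w) = (lder j z * t) w + (twist j z * lder j t) w by [].
rewrite E E' [(x * _) _]E' !IH lder_twist rder_twist Psym -scalerAl -scalerAr.
by rewrite -!lrderC addrACA.
Qed.

Definition shrev (x : shuf) : shuf := fun w => x (rev w).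

Lemma lder_shrev i x : lder i (shrev x) = shrev (rder i x).
Proof. by apply/funext => w; rewrite /lder /shrev /rder rev_cons. Qed.

Lemma rder_shrev i x : rder i (shrev x) = shrev (lder i x).
Proof. by apply/funext => w; rewrite /lder /shrev /rder rev_rcons. Qed.

Lemma shrevK : involutive shrev.
Proof. by move=> x; apply/funext => w; rewrite /shrev revK. Qed.

Lemma shrev_linear : linear shrev. Proof. by []. Qed.
HB.instance Definition _ :=
  GRing.isLinear.Build K shuf shuf _ shrev shrev_linear.

Lemma shrevD x y : shrev (x + y) = shrev x + shrev y. Proof. by []. Qed.

Lemma shrev_twist i x : shrev (twist i x) = twist i (shrev x).
Proof.
apply/funext => w; rewrite /shrev /twist; congr (_ * _).
by apply: perm_big; rewrite perm_rev.
Qed.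

Lemma shrevM (x y : shuf) : shrev (x * y) = shrev y * shrev x.
Proof.
apply/funext => w; elim: w x y => [|i w IH] x y.
  by rewrite /shrev /rev /= !shufM_nil mulrC.
have E (z t : shuf) : (z * t : shuf) (i :: w) = (lder i z * t) w + (twist i z * lder i t) w by [].
rewrite -[LHS]/(lder i (shrev (x * y)) w) lder_shrev rderM shrevD shufD !IH.
by rewrite E !lder_shrev shrev_twist addrC.
Qed.

Lemma shrev1 : shrev 1 = 1.
Proof. by apply/funext => w; rewrite /shrev !shuf1E -!size_eq0 size_rev. Qed.

Lemma shrevF i : shrev (Fsh i) = Fsh i.
Proof.
apply/funext => w; rewrite /shrev /Fsh -[LHS]/((_ == rev [:: i])%:R).
by rewrite (inj_eq (can_inj revK)).
Qed.

End Sym.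
End Shuffle.

(** * Weights, homogeneous elements, and expansions in powers of one generator *)

Section Weights.
Context (n : nat).

Definition weight := {ffun 'I_n -> int}.
HB.instance Definition _ := GRing.Zmodule.on weight.

Definition alpha (i : 'I_n) : weight := [ffun j => (i == j)%:R].
Definition wt (w : seq 'I_n) : weight := \sum_(i <- w) alpha i.
Definition height (mu : weight) : int := \sum_i mu i.

Lemma wt_nil : wt [::] = 0. Proof. exact: big_nil. Qed.
Lemma wt_cons i w : wt (i :: w) = alpha i + wt w. Proof. exact: big_cons. Qed.
Lemma wt_cat u w : wt (u ++ w) = wt u + wt w. Proof. exact: big_cat. Qed.
Lemma wt_rev w : wt (rev w) = wt w.
Proof. by apply: perm_big; rewrite perm_rev. Qed.

Lemma wtE w i : wt w i = (count_mem i w)%:Z.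
Proof.
rewrite /wt sum_ffunE; elim: w => [|j w IH]; first by rewrite big_nil.
by rewrite big_cons IH ffunE /= PoszD; congr (_ + _); case: eqP.
Qed.

Lemma heightD mu nu : height (mu + nu) = height mu + height nu.
Proof. by rewrite -big_split; apply: eq_bigr => i _; rewrite ffunE. Qed.
Lemma heightN mu : height (- mu) = - height mu.
Proof. by rewrite -sumrN; apply: eq_bigr => i _; rewrite ffunE. Qed.
Lemma height_alpha i : height (alpha i) = 1.
Proof.
rewrite /height (bigD1 i) //= big1 => [|j ji]; rewrite ffunE ?eqxx ?addr0 //.
by rewrite eq_sym (negPf ji).
Qed.

Lemma height_wt w : height (wt w) = (size w)%:Z.
Proof.
elim: w => [|i w IH]; last by rewrite wt_cons heightD height_alpha IH.
by rewrite wt_nil /height big1 // => i _; rewrite ffunE.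
Qed.

End Weights.

Section Span.
Context (K : fieldType) (n : nat) (A : algType K) (x : 'I_n -> A).

Definition wmon (w : seq 'I_n) : A := \prod_(i <- w) x i.

Lemma wmon_cons i w : wmon (i :: w) = x i * wmon w. Proof. exact: big_cons. Qed.
Lemma wmon_nil : wmon [::] = 1. Proof. exact: big_nil. Qed.
Lemma wmon_cat u w : wmon (u ++ w) = wmon u * wmon w. Proof. exact: big_cat. Qed.
Lemma wmon_rcons i w : wmon (rcons w i) = wmon w * x i.
Proof. by rewrite -cats1 wmon_cat /wmon big_seq1. Qed.

Definition lincomb (s : seq (K * seq 'I_n)) : A :=
  \sum_(p <- s) p.1 *: wmon p.2.

Lemma lincomb_cat s t : lincomb (s ++ t) = lincomb s + lincomb t.
Proof. exact: big_cat. Qed.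

Lemma lincomb_scale c s :
  lincomb [seq (c * p.1, p.2) | p <- s] = c *: lincomb s.
Proof.
by rewrite /lincomb big_map scaler_sumr; apply: eq_bigr => p _; rewrite scalerA.
Qed.

(** The grading is given by spanning words only: 0 has every weight, and the independence of
    different weights is not built in. In the shuffle algebra it follows from [hom_supported]; in
    [U_q(n^-)] it waits for the injectivity of [Psi]. *)
Definition hom (mu : weight n) (y : A) : Prop :=
  exists2 s, (forall p, p \in s -> wt p.2 = mu) & y = lincomb s.

Lemma hom_ind (mu : weight n) (Q : A -> Prop) : Q 0 ->
  (forall c w y, wt w = mu -> hom mu y -> Q y -> Q (c *: wmon w + y)) ->
  forall y, hom mu y -> Q y.
Proof.
move=> Q0 QS _ [s hs ->]; elim: s hs => [|p s IH] hs; first by rewrite /lincomb big_nil.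
rewrite /lincomb big_cons; apply: QS; first by apply: hs; rewrite mem_head.
  by exists s => // r rs; apply: hs; rewrite in_cons rs orbT.
by apply: IH => r rs; apply: hs; rewrite in_cons rs orbT.
Qed.

Lemma hom_lin_ind (mu : weight n) (Q : A -> Prop) : Q 0 ->
  (forall c y z, Q y -> Q z -> Q (c *: y + z)) ->
  (forall w, wt w = mu -> Q (wmon w)) ->
  forall y, hom mu y -> Q y.
Proof.
move=> Q0 QL Qw; apply: hom_ind => // c w y hw _ Qy.
by apply: QL => //; apply: Qw.
Qed.

Lemma hom0 mu : hom mu 0.
Proof. by exists [::]; rewrite // /lincomb big_nil. Qed.

Lemma homD mu y z : hom mu y -> hom mu z -> hom mu (y + z).
Proof.
move=> [s hs ->] [t ht ->]; exists (s ++ t); last by rewrite lincomb_cat.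
by move=> p; rewrite mem_cat => /orP[/hs|/ht].
Qed.

Lemma homZ mu c y : hom mu y -> hom mu (c *: y).
Proof.
move=> [s hs ->]; exists [seq (c * p.1, p.2) | p <- s]; last by rewrite lincomb_scale.
by move=> p /mapP[r rs ->]; exact: (hs r).
Qed.

Lemma homL mu c y z : hom mu y -> hom mu z -> hom mu (c *: y + z).
Proof. by move=> hy hz; apply: homD => //; apply: homZ. Qed.

Lemma homN mu y : hom mu y -> hom mu (- y).
Proof. by rewrite -scaleN1r; apply: homZ. Qed.

Lemma homB mu y z : hom mu y -> hom mu z -> hom mu (y - z).
Proof. by move=> hy hz; apply: homD => //; apply: homN. Qed.

Lemma hom_sum mu I (r : seq I) (Q : pred I) (G : I -> A) :
  (forall i, Q i -> hom mu (G i)) -> hom mu (\sum_(i <- r | Q i) G i).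
Proof. by move=> h; elim/big_rec: _ => [|i y Pi]; [exact: hom0|apply: homD; apply: h]. Qed.

Lemma hom_mon w : hom (wt w) (wmon w).
Proof.
exists [:: (1, w)]; last by rewrite /lincomb big_seq1 scale1r.
by move=> p; rewrite inE => /eqP ->.
Qed.

Lemma hom1 : hom 0 1.
Proof. by rewrite -wmon_nil -(wt_nil n); apply: hom_mon. Qed.

Lemma hom_gen i : hom (alpha i) (x i).
Proof.
have := hom_mon [:: i]; rewrite /wt /wmon !big_seq1; exact.
Qed.

Lemma homM mu nu y z : hom mu y -> hom nu z -> hom (mu + nu) (y * z).
Proof.
move=> hy hz; elim/hom_ind: y / hy; first by rewrite mul0r; apply: hom0.
move=> c w y hw _ hy; rewrite mulrDl -scalerAl; apply: homL => //.
elim/hom_ind: z / hz {hy}; first by rewrite mulr0; apply: hom0.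
move=> c' w' y' hw' _ hy'; rewrite mulrDr -scalerAr; apply: homL => //.
by rewrite -hw -hw' -wt_cat -wmon_cat; apply: hom_mon.
Qed.

Lemma homX mu y k : hom mu y -> hom (mu *+ k) (y ^+ k).
Proof.
move=> hy; elim: k => [|k IH]; first by rewrite expr0 mulr0n; apply: hom1.
by rewrite exprS mulrS; apply: homM.
Qed.

Lemma hom_neq0 mu y : hom mu y -> y != 0 -> exists w, wt w = mu.
Proof.
move=> [[|p s] hs ->]; first by rewrite /lincomb big_nil eqxx.
by exists p.2; apply: hs; rewrite mem_head.
Qed.

Lemma hom_weight0 y : hom 0 y -> exists c : K, y = c *: 1.
Proof.
elim/hom_lin_ind => [|c y1 y2 [c1 ->] [c2 ->]|w /(congr1 (@height n))].
- by exists 0; rewrite scale0r.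
- by exists (c * c1 + c2); rewrite scalerA scalerDl.
- rewrite height_wt -(wt_nil n) height_wt => /eqP.
  rewrite eqz_nat size_eq0 => /eqP ->; exists 1; by rewrite wmon_nil scale1r.
Qed.

Definition span (y : A) : Prop := exists s, y = lincomb s.

Lemma span_hom mu y : hom mu y -> span y.
Proof. by case=> s _ ->; exists s. Qed.

Lemma span_lin_ind (Q : A -> Prop) : Q 0 ->
  (forall c y z, Q y -> Q z -> Q (c *: y + z)) ->
  (forall w, Q (wmon w)) -> forall y, span y -> Q y.
Proof.
move=> Q0 QL Qw _ [s ->]; elim: s => [|p s IH]; first by rewrite /lincomb big_nil.
by rewrite /lincomb big_cons; apply: QL.
Qed.

Lemma span0 : span 0.
Proof. by exists [::]; rewrite /lincomb big_nil. Qed.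

Lemma spanL c y z : span y -> span z -> span (c *: y + z).
Proof.
move=> [s ->] [u ->]; exists ([seq (c * p.1, p.2) | p <- s] ++ u).
by rewrite lincomb_cat lincomb_scale.
Qed.

Lemma span_mon w : span (wmon w).
Proof. exact: span_hom (hom_mon w). Qed.

Lemma spanM y z : span y -> span z -> span (y * z).
Proof.
move=> hy hz; elim/span_lin_ind: y / hy => [|c y y' h h'|w].
- by rewrite mul0r; apply: span0.
- by rewrite mulrDl -scalerAl; apply: spanL.
elim/span_lin_ind: z / hz => [|c y y' h h'|w'].
- by rewrite mulr0; apply: span0.
- by rewrite mulrDr -scalerAr; apply: spanL.
by rewrite -wmon_cat; apply: span_mon.
Qed.

Lemma span_gen i : span (x i).
Proof. exact: span_hom (hom_gen i). Qed.

End Span.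

(* In the applications [Z] is the kernel of the i-th left derivation. *)
Section Expansion.
Context (K : fieldType) (n : nat) (A : algType K) (x : 'I_n -> A) (i : 'I_n).
Context (ad : A -> A) (c : weight n -> K) (Z : A -> Prop).
Hypothesis ad_linear : linear ad.
Hypothesis ad_hom : forall mu y, hom x mu y -> hom x (mu + alpha i) (ad y).
Hypothesis adE : forall mu y, hom x mu y -> x i * y = ad y + c mu *: (y * x i).
Hypothesis adM : forall mu y z, hom x mu y ->
  ad (y * z) = ad y * z + c mu *: (y * ad z).
Hypothesis Z0 : Z 0.
Hypothesis ZL : forall b y z, Z y -> Z z -> Z (b *: y + z).
Hypothesis ZM : forall mu y z, hom x mu y -> Z y -> Z z -> Z (y * z).
Hypothesis Z1 : Z 1.
Hypothesis Zad : forall mu y, hom x mu y -> Z y -> Z (ad y).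
Hypothesis Zgen : forall j, j != i -> Z (x j).
Hypothesis ad1 : ad 1 = 0.
Hypothesis ad_gen : forall j, j != i -> exists N, iter N ad (x j) = 0.

Let ad0 : ad 0 = 0.
Proof. by have := ad_linear (-1) 0 0; rewrite scaleN1r oppr0 addr0 scaleN1r addNr. Qed.
Let adZ b y : ad (b *: y) = b *: ad y.
Proof. by have := ad_linear b y 0; rewrite ad0 !addr0. Qed.
Let adD y z : ad (y + z) = ad y + ad z.
Proof. by have := ad_linear 1 y z; rewrite !scale1r. Qed.
Let iad0 N : iter N ad 0 = 0. Proof. by elim: N => //= N ->. Qed.
Let iadZ N b y : iter N ad (b *: y) = b *: iter N ad y.
Proof. by elim: N => //= N ->. Qed.
Let iadD N y z : iter N ad (y + z) = iter N ad y + iter N ad z.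
Proof. by elim: N => //= N ->. Qed.

Definition nilcoef (mu : weight n) (y : A) : Prop :=
  [/\ hom x mu y, Z y & exists N, iter N ad y = 0].

Lemma nilcoef0 mu : nilcoef mu 0.
Proof. by split=> //; [exact: hom0|exists 0%N]. Qed.

Lemma nilcoefL mu b y z : nilcoef mu y -> nilcoef mu z -> nilcoef mu (b *: y + z).
Proof.
move=> [hy Zy [N hN]] [hz Zz [N' hN']]; split; [exact: homL|exact: ZL|].
exists (N + N')%N; rewrite iadD iadZ {1}addnC !iterD hN hN' !iad0.
by rewrite scaler0 addr0.
Qed.

(** As for any skew derivation, [ad^(N+N')] of a product is a sum of multiples of [ad^j y * ad^k z]
    with [j + k = N + N'], and each of these has [j >= N] or [k >= N']. *)
Lemma nilcoefM mu nu y z :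
  nilcoef mu y -> nilcoef nu z -> nilcoef (mu + nu) (y * z).
Proof.
move=> [hy Zy [N hN]] [hz Zz [N' hN']]; split; [exact: homM|exact: ZM hy _ _|].
exists (N + N')%N; have [m mN] := ubnP (N + N')%N.
elim: m N N' mu y hy hN z hN' mN {Zy Zz hz} => // m IH [|N] N' mu y hy hN z hN' mN.
  by move: hN => /= ->; rewrite mul0r iad0.
case: N' hN' mN => [|N'] hN' mN.
  by move: hN' => /= ->; rewrite mulr0 iad0.
rewrite addSn iterSr (adM _ hy) iadD iadZ.
have -> : iter (N + N'.+1) ad (ad y * z) = 0.
  by apply: IH (ad_hom hy) _ _ hN' _; rewrite -?iterSr //; lia.
have -> : iter (N + N'.+1) ad (y * ad z) = 0.
  by rewrite addnS -addSn; apply: IH hy hN _ _ _; rewrite -?iterSr //; lia.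
by rewrite scaler0 addr0.
Qed.

Lemma nilcoef_ad mu y : nilcoef mu y -> nilcoef (mu + alpha i) (ad y).
Proof.
move=> [hy Zy [N hN]]; split; [exact: ad_hom|exact: Zad hy Zy|].
by exists N; rewrite -iterSr iterS hN ad0.
Qed.

Lemma nilcoef1 : nilcoef 0 1.
Proof. by split=> //; [exact: hom1|exists 1%N]. Qed.

Lemma nilcoef_gen j : j != i -> nilcoef (alpha j) (x j).
Proof. by move=> ji; split; [exact: hom_gen|exact: Zgen|exact: ad_gen]. Qed.

Definition expansion (mu : weight n) (y : A) : Prop :=
  exists N (ys : nat -> A), (forall k, nilcoef (mu - alpha i *+ k) (ys k)) /\
    y = \sum_(k < N) ys k * x i ^+ k.

Lemma expansion_widen N N' (ys : nat -> A) : (N <= N')%N ->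
  \sum_(k < N) ys k * x i ^+ k
  = \sum_(k < N') (if (k < N)%N then ys k else 0) * x i ^+ k.
Proof.
move=> h; rewrite (big_ord_widen _ (fun k => ys k * x i ^+ k) h) big_mkcond.
by apply: eq_bigr => k _; case: ifP => _; rewrite ?mul0r.
Qed.

Lemma expansionL mu b y z :
  expansion mu y -> expansion mu z -> expansion mu (b *: y + z).
Proof.
move=> [N [ys [hys ->]]] [N' [zs [hzs ->]]].
exists (maxn N N'), (fun k => b *: (if (k < N)%N then ys k else 0)
                              + (if (k < N')%N then zs k else 0)).
split=> [k|].
  by apply: nilcoefL; case: ifP => // _; apply: nilcoef0.
rewrite (expansion_widen ys (leq_maxl N N')) (expansion_widen zs (leq_maxr N N')).
rewrite scaler_sumr -big_split; apply: eq_bigr => k _.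
by rewrite /= mulrDl -scalerAl.
Qed.

Lemma expansion0 mu : expansion mu 0.
Proof.
by exists 0%N, (fun=> 0); split=> [k|]; [exact: nilcoef0|rewrite big_ord0].
Qed.

Lemma expansion_coef mu y : nilcoef mu y -> expansion mu y.
Proof.
move=> hy; exists 1%N, (fun k => if k == 0%N then y else 0).
split=> [k|]; last by rewrite big_ord1 mulr1.
by case: eqP => [->|_]; rewrite ?subr0 //; apply: nilcoef0.
Qed.

Lemma expansion_mulgen mu y : expansion mu y -> expansion (mu + alpha i) (y * x i).
Proof.
move=> [N [ys [hys ->]]]; exists N.+1, (fun k => if k is k'.+1 then ys k' else 0).
split=> [[|k]|]; first exact: nilcoef0.
  by rewrite mulrS opprD addrA addrK.
rewrite big_ord_recl mul0r add0r mulr_suml; apply: eq_bigr => k _.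
by rewrite lift0 exprSr mulrA.
Qed.

Lemma expansion_mull nu z mu y :
  nilcoef nu z -> expansion mu y -> expansion (nu + mu) (z * y).
Proof.
move=> hz [N [ys [hys ->]]]; exists N, (fun k => z * ys k); split=> [k|].
  by rewrite -addrA; apply: nilcoefM.
by rewrite mulr_sumr; apply: eq_bigr => k _; rewrite mulrA.
Qed.

Lemma expansion_genmul mu y : expansion mu y -> expansion (alpha i + mu) (x i * y).
Proof.
move=> [N [ys [hys ->]]]; rewrite mulr_sumr.
elim: N => [|N IH]; first by rewrite big_ord0; apply: expansion0.
rewrite big_ord_recr /= -[\sum_(_ < N) _]scale1r; apply: expansionL => //.
have [hN _ _] := hys N; rewrite mulrA (adE hN) mulrDl -scalerAl.
have pw mu' y' k : expansion mu' y' -> expansion (mu' + alpha i *+ k) (y' * x i ^+ k).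
  move=> h; elim: k => [|k IHk]; first by rewrite mulr1 addr0.
  by rewrite mulrSr addrA exprSr mulrA; apply: expansion_mulgen.
have -> : alpha i + mu = mu - alpha i *+ N + alpha i *+ N + alpha i.
  by rewrite subrK addrC.
rewrite [X in expansion _ X]addrC; apply: expansionL.
  rewrite -mulrA -exprS exprSr mulrA; apply: expansion_mulgen.
  by apply: pw; apply: expansion_coef.
by rewrite addrAC; apply: pw; apply: expansion_coef; apply: nilcoef_ad.
Qed.

(** This is the decomposition of [U_q(n^-)] into the kernel of [l_i] times powers of [F_i]. Left
    multiplication by [x i] preserves such expansions: [adE] moves [x i] to the right of a
    coefficient at the cost of [ad] of it, which is again a coefficient. *)
Lemma hom_expansion mu y : hom x mu y -> expansion mu y.
Proof.
elim/hom_lin_ind => [|b y1 y2|w <-]; [exact: expansion0|exact: expansionL|].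
elim: w => [|j w IH].
  by rewrite wmon_nil wt_nil; apply: expansion_coef; apply: nilcoef1.
rewrite wmon_cons wt_cons; have [->|ji] := eqVneq j i.
  exact: expansion_genmul.
by apply: expansion_mull => //; apply: nilcoef_gen.
Qed.

End Expansion.

(** * The q-datum, the word pairing, and the twisted adjoint actions *)

Definition cpair (n : nat) (a : 'M[int]_n) (i : 'I_n) (mu : weight n) : int :=
  \sum_j a i j * mu j.

Lemma cpairD n (a : 'M[int]_n) i mu nu :
  cpair a i (mu + nu) = cpair a i mu + cpair a i nu.
Proof. by rewrite -big_split; apply: eq_bigr => j _; rewrite ffunE mulrDr. Qed.

Lemma cpairN n (a : 'M[int]_n) i mu : cpair a i (- mu) = - cpair a i mu.
Proof. by rewrite -sumrN; apply: eq_bigr => j _; rewrite ffunE mulrN. Qed.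

Lemma cpair0 n (a : 'M[int]_n) i : cpair a i 0 = 0.
Proof. by apply: big1 => j _; rewrite ffunE mulr0. Qed.

Lemma cpairMn n (a : 'M[int]_n) i mu k : cpair a i (mu *+ k) = cpair a i mu *+ k.
Proof. by elim: k => [|k IH]; rewrite ?mulr0n ?cpair0 // !mulrS cpairD IH. Qed.

Lemma cpair_alpha n (a : 'M[int]_n) i j : cpair a i (alpha j) = a i j.
Proof.
rewrite /cpair (bigD1 j) //= big1 => [|k kj]; rewrite ffunE ?eqxx ?mulr1 ?addr0 //.
by rewrite eq_sym (negPf kj) mulr0.
Qed.

(* [t i] is q_i and [t i ^ a i j] is q^(alpha_i, alpha_j). *)
Record qdatum (K : fieldType) (n : nat) := QDatum {
  qt : 'I_n -> K;
  qa : 'M[int]_n;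
  qt_neq0 : forall i, qt i != 0;
  qt_generic : forall i (m : int), m != 0 -> qt i ^ m != 1;
  qt_sym : forall i j, qt i ^ qa i j = qt j ^ qa j i;
  qa_diag : forall i, qa i i = 2
}.

Definition qP (K : fieldType) (n : nat) (Q : qdatum K n) i j := qt Q i ^ qa Q i j.

Section Nichols.
Context (K : fieldType) (n : nat) (Q : qdatum K n).
Notation t := (qt Q).
Notation a := (qa Q).
Notation qP := (qP Q).
Let t0 := qt_neq0 Q.
Let Psym : forall i j, qP i j = qP j i := qt_sym Q.
Notation sh := (qshuffle qP).
Notation F := (@Fsh K n qP).
Notation hom := (hom F).
Notation H := (cpair a).
Implicit Types (x y z : sh) (mu nu : weight n).

Let tD i (m k : int) : t i ^ (m + k) = t i ^ m * t i ^ k.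
Proof. by rewrite expfzDr ?t0. Qed.

Lemma twist_wt i w : \prod_(j <- w) qP i j = t i ^ H i (wt w).
Proof.
elim: w => [|j w IH]; first by rewrite big_nil wt_nil cpair0.
by rewrite big_cons IH wt_cons cpairD cpair_alpha tD.
Qed.

Lemma twistE i x w : twist i x w = t i ^ H i (wt w) * x w.
Proof. by rewrite /twist twist_wt. Qed.

Lemma twist_mon i w : twist i (wmon F w) = t i ^ H i (wt w) *: wmon F w.
Proof.
elim: w => [|j w IH]; first by rewrite wmon_nil wt_nil cpair0 twist1 scale1r.
rewrite wmon_cons wt_cons twistM IH twistF cpairD cpair_alpha tD.
by rewrite -scalerAl -scalerAr scalerA.
Qed.

Lemma twist_hom i mu x : hom mu x -> twist i x = t i ^ H i mu *: x.
Proof.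
elim/hom_lin_ind => [|c y z hy hz|w <-]; last exact: twist_mon.
  by rewrite linear0 scaler0.
by rewrite twistD twistZ hy hz scalerDr scalerA mulrC -scalerA.
Qed.

Lemma lder_hom i mu x : hom mu x -> hom (mu - alpha i) (lder i x).
Proof.
elim/hom_lin_ind => [|c y z hy hz|w <-]; [exact: hom0|exact: homL|].
elim: w => [|j w IH]; first by rewrite wmon_nil lder1; apply: hom0.
rewrite wmon_cons lderM lderF twistF wt_cons -scalerAl mul1r -scalerAl; apply: homD.
  have [->|_] := eqVneq i j; last by rewrite scale0r; apply: hom0.
  by rewrite scale1r addrAC subrr add0r; apply: hom_mon.
by apply: homZ; rewrite -addrA; apply: homM => //; apply: hom_gen.
Qed.

Lemma rder_hom i mu x : hom mu x -> hom (mu - alpha i) (rder i x).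
Proof.
elim/hom_lin_ind => [|c y z hy hz|w <-]; [exact: hom0|exact: homL|].
elim: w => [|j w IH]; first by rewrite wmon_nil rder1; apply: hom0.
rewrite wmon_cons rderM // rderF twist_mon wt_cons -scalerAl mul1r scalerA.
apply: homD; last by rewrite -addrA; apply: homM => //; apply: hom_gen.
have [->|_] := eqVneq i j; last by rewrite mul0r scale0r; apply: hom0.
by apply: homZ; rewrite addrAC subrr add0r; apply: hom_mon.
Qed.

Lemma shrev_mon w : shrev (wmon F w) = wmon F (rev w).
Proof.
elim: w => [|i w IH]; first by rewrite wmon_nil shrev1.
by rewrite wmon_cons shrevM // shrevF IH rev_cons wmon_rcons.
Qed.

Lemma shrev_hom mu x : hom mu x -> hom mu (shrev x).
Proof.
elim/hom_lin_ind => [|c y z hy hz|w <-]; [exact: hom0|exact: homL|].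
by rewrite shrev_mon -wt_rev; apply: hom_mon.
Qed.

Definition supported mu x : Prop := forall w, wt w != mu -> x w = 0.

Lemma supportedL mu c x y :
  supported mu x -> supported mu y -> supported mu (c *: x + y).
Proof. by move=> hx hy w hw; rewrite shufD shufZ hx ?hy // mulr0 addr0. Qed.

Lemma supported_lder i mu x : supported mu x -> supported (mu - alpha i) (lder i x).
Proof. by move=> hx w hw; apply: hx; rewrite wt_cons addrC eq_sym -subr_eq eq_sym. Qed.

Lemma supported_twist i mu x : supported mu x -> supported mu (twist i x).
Proof. by move=> hx w hw; rewrite twistE hx ?mulr0. Qed.

Lemma supportedM mu nu x y :
  supported mu x -> supported nu y -> supported (mu + nu) (x * y).
Proof.
move=> hx hy w; elim: w x y mu nu hx hy => [|i w IH] x y mu nu hx hy hw.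
  rewrite shufM_nil; have [e|m0] := eqVneq (wt [::]) mu; last by rewrite hx ?mul0r.
  by rewrite hy ?mulr0 //; apply: contraNneq hw => <-; rewrite -e wt_nil addr0.
have hw' : wt w != mu + nu - alpha i by move: hw; rewrite wt_cons addrC eq_sym -subr_eq eq_sym.
rewrite -[LHS]/(lder i (x * y) w) lderM shufD.
rewrite (IH _ _ _ _ (supported_lder (i := i) hx) hy) ?add0r; last by rewrite addrAC.
by rewrite (IH _ _ _ _ (supported_twist i hx) (supported_lder (i := i) hy)) // addrA.
Qed.

Lemma supported1 : supported 0 1.
Proof. by case=> [|i w]; rewrite // wt_nil eqxx. Qed.

Lemma supportedF i : supported (alpha i) (F i).
Proof.
move=> w; rewrite /Fsh; have [->|//] := eqVneq w [:: i].
by rewrite /wt big_seq1 eqxx.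
Qed.

Lemma hom_supported mu x : hom mu x -> supported mu x.
Proof.
elim/hom_lin_ind => [|c y z hy hz|w <-] //; first exact: supportedL.
elim: w => [|i w IH]; first by rewrite wmon_nil wt_nil; apply: supported1.
by rewrite wmon_cons wt_cons; apply: supportedM => //; apply: supportedF.
Qed.

Lemma shom_neq0 mu x : hom mu x -> x != 0 -> exists2 w, wt w = mu & x w != 0.
Proof.
move=> hx x0; apply: contrapT => h; case/eqP: x0; apply/funext => w.
have [hw|hw] := eqVneq (wt w) mu; last by rewrite (hom_supported hx hw).
by apply: contrapT => xw; apply: h; exists w => //; apply/eqP.
Qed.

Lemma shom_lder_eq0 mu x : hom mu x -> mu != 0 ->
  (forall i, lder i x = 0) -> x = 0.
Proof.
move=> hx mu0 hl; apply: shuf_eq => [|i]; last by rewrite hl linear0.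
by rewrite (hom_supported hx) // wt_nil eq_sym.
Qed.

Definition evalw (s : seq (K * seq 'I_n)) x : K := \sum_(p <- s) p.1 * x p.2.

Lemma evalw_linear s c x y : evalw s (c *: x + y) = c * evalw s x + evalw s y.
Proof.
rewrite /evalw mulr_sumr -big_split; apply: eq_bigr => p _.
by rewrite shufD shufZ mulrDr mulrCA.
Qed.

Lemma evalw_lincomb s u :
  evalw s (lincomb F u) = \sum_(p <- s) \sum_(r <- u) p.1 * r.1 * wmon F r.2 p.2.
Proof.
apply: eq_bigr => p _; rewrite /lincomb shuf_sum mulr_sumr; apply: eq_bigr => r _.
by rewrite shufZ mulrA.
Qed.

(** These values are the Gram matrix of the word pairing. Removing both first letters leaves a
    symmetric term for [i = j] and the value of [F_i l_j(F_u)] at [w]. By induction the latter is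
    the evaluation of [l_i(F_w)] on the words of [l_j(F_u)], which is symmetric by induction once
    more. *)
Lemma wmonC_aux m u w : (size u <= m)%N -> wmon F u w = wmon F w u.
Proof.
elim: m u w => [|m IH] u w.
  case: u => // _; rewrite wmon_nil shuf1E; case: w => [|i w]; first by rewrite wmon_nil.
  apply/esym/(hom_supported (hom_mon F (i :: w))).
  by apply: contraTneq isT => /(congr1 (@height n)); rewrite !height_wt.
case: u => [|i u] hu; first exact: IH.
have [hs|hs] := eqVneq (wt (i :: u)) (wt w); last first.
  rewrite (hom_supported (hom_mon F _)) 1?eq_sym //.
  by rewrite (hom_supported (hom_mon F _)).
case: w hs => [|j w] hs; first by have := congr1 (@height n) hs; rewrite !height_wt.
have suw : size u = size w.
  by have := congr1 (@height n) hs; rewrite !height_wt /= => -[].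
have [s hsw es] := lder_hom j (hom_mon F u).
have [v hvw ev] := lder_hom i (hom_mon F w).
have sz (p : K * seq 'I_n) r k : wt p.2 = wt r - alpha k -> (size p.2).+1 = size r.
  move=> e; have := congr1 (@height n) e.
  by rewrite heightD heightN height_alpha !height_wt; lia.
have E b z c : lder b (F c * z) = (b == c)%:R *: z + qP b c *: (F c * lder b z).
  by rewrite lderM lderF twistF -!scalerAl mul1r.
rewrite -[LHS]/(lder j (wmon F (i :: u)) w) -[RHS]/(lder i (wmon F (j :: w)) u).
rewrite !wmon_cons (E j _ i) (E i _ j) !shufD !shufZ.
rewrite eq_sym IH // Psym; congr (_ + _ * _).
have H1 b c (s' : seq (K * seq 'I_n)) v' w' :
    (forall p, p \in s' -> wt p.2 = wt v' - alpha c) -> size v' = size w' ->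
    (size v' <= m)%N -> (F b * lincomb F s') w' = evalw s' (lder b (wmon F w')).
  move=> hs' svw vm; rewrite /lincomb mulr_sumr shuf_sum.
  rewrite /evalw big_seq [RHS]big_seq; apply: eq_bigr => p ps.
  rewrite -scalerAr shufZ -wmon_cons IH //.
  by rewrite /= (sz _ _ _ (hs' _ ps)).
rewrite es (H1 i j s u w hsw) // ev (H1 j i v w u hvw) //; last by rewrite -suw.
rewrite es !evalw_lincomb exchange_big /= big_seq [RHS]big_seq.
apply: eq_bigr => p pv; rewrite big_seq [RHS]big_seq; apply: eq_bigr => r rs.
rewrite [r.1 * _]mulrC IH //.
have := sz _ _ _ (hvw _ pv); rewrite -suw; move: hu => /=; lia.
Qed.

Lemma wmonC u w : wmon F u w = wmon F w u.
Proof. exact: wmonC_aux (leqnn _). Qed.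

Lemma evalwC s u : evalw s (lincomb F u) = evalw u (lincomb F s).
Proof.
rewrite !evalw_lincomb exchange_big /=; apply: eq_bigr => p _.
by apply: eq_bigr => r _; rewrite wmonC [r.1 * _]mulrC.
Qed.

End Nichols.

Section Pairing.
Context (K : fieldType) (n : nat) (Q : qdatum K n).
Notation t := (qt Q).
Notation a := (qa Q).
Notation sh := (qshuffle (qP Q)).
Notation F := (@Fsh K n (qP Q)).
Notation hom := (hom F).
Notation span := (span F).
Notation H := (cpair a).
Implicit Types (x y z : sh) (mu nu : weight n).
Let Psym : forall i j, qP Q i j = qP Q j i := qt_sym Q.

Let t0 := qt_neq0 Q.
Let tD i (m k : int) : t i ^ (m + k) = t i ^ m * t i ^ k.
Proof. by rewrite expfzDr ?t0. Qed.
Let tn0 i (m : int) : t i ^ m != 0.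
Proof. by rewrite expfz_neq0 ?t0. Qed.

Lemma lder_span i x : span x -> span (lder i x).
Proof.
elim/span_lin_ind => [|c y z|w]; [exact: span0|exact: spanL|].
exact: span_hom (lder_hom i (hom_mon _ w)).
Qed.

Lemma rder_span i x : span x -> span (rder i x).
Proof.
elim/span_lin_ind => [|c y z|w]; [exact: span0|exact: spanL|].
exact: span_hom (rder_hom i (hom_mon _ w)).
Qed.

Definition rep x : seq (K * seq 'I_n) :=
  if pselect (span x) is left h then sval (cid h) else [::].

Lemma repP x : span x -> lincomb F (rep x) = x.
Proof. by rewrite /rep; case: pselect => // h _; case: cid. Qed.

(** The representative of [x] is an arbitrary choice. The value at a [y] in the span does not depend
    on it, because [evalwC] moves the evaluation to the words of [y], where [x] enters only as an
    element. *)
Definition pr x y : K := evalw (rep x) y.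

Lemma prC x y : span x -> span y -> pr x y = pr y x.
Proof. by move=> hx hy; rewrite /pr -{1}(repP hy) evalwC repP. Qed.

Lemma pr_lincomb s y : span y -> pr (lincomb F s) y = evalw s y.
Proof.
move=> hy; rewrite prC //; last by exists s.
by rewrite /pr -{2}(repP hy) [RHS]evalwC.
Qed.

Lemma prLr x c y z : pr x (c *: y + z) = c * pr x y + pr x z.
Proof. exact: evalw_linear. Qed.
Lemma pr0r x : pr x 0 = 0.
Proof. by have := prLr x (-1) 0 0; rewrite scaleN1r oppr0 addr0 mulN1r addNr. Qed.
Lemma prZr x c y : pr x (c *: y) = c * pr x y.
Proof. by have := prLr x c y 0; rewrite !addr0 pr0r addr0. Qed.
Lemma prDr x y z : pr x (y + z) = pr x y + pr x z.
Proof. by have := prLr x 1 y z; rewrite !scale1r mul1r. Qed.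
Lemma pr_sumr x I (r : seq I) (G : I -> sh) :
  pr x (\sum_(i <- r) G i) = \sum_(i <- r) pr x (G i).
Proof.
by elim: r => [|i r IH]; rewrite ?big_nil ?pr0r // !big_cons prDr IH.
Qed.

Lemma prLl x y c z : span x -> span y -> span z ->
  pr (c *: x + y) z = c * pr x z + pr y z.
Proof.
move=> hx hy hz; rewrite prC //; last exact: spanL.
by rewrite prLr !(prC hz).
Qed.

Lemma prFl i x y : span x -> span y -> pr (F i * x) y = pr x (lder i y).
Proof.
move=> hx hy; rewrite -(repP hx) pr_lincomb; last exact: lder_span.
have -> : F i * lincomb F (rep x)
    = lincomb F [seq (p.1, i :: p.2) | p <- rep x].
  rewrite /lincomb mulr_sumr big_map; apply: eq_bigr => p _.
  by rewrite -scalerAr wmon_cons.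
by rewrite pr_lincomb // /evalw big_map.
Qed.

Lemma prFr i x y : span x -> span y -> pr (x * F i) y = pr x (rder i y).
Proof.
move=> hx hy; rewrite -(repP hx) pr_lincomb; last exact: rder_span.
have -> : lincomb F (rep x) * F i
    = lincomb F [seq (p.1, rcons p.2 i) | p <- rep x].
  rewrite /lincomb mulr_suml big_map; apply: eq_bigr => p _.
  by rewrite -scalerAl wmon_rcons.
by rewrite pr_lincomb // /evalw big_map.
Qed.

Lemma pr_mon w y : span y -> pr (wmon F w) y = y w.
Proof.
move=> hy; have -> : wmon F w = lincomb F [:: (1, w)].
  by rewrite /lincomb big_seq1 scale1r.
by rewrite pr_lincomb // /evalw big_seq1 mul1r.
Qed.

Definition untwist i x : sh := fun w => (\prod_(j <- w) qP Q i j)^-1 * x w.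

Lemma untwistL i c x y : untwist i (c *: x + y) = c *: untwist i x + untwist i y.
Proof.
by apply/funext => w; rewrite /untwist !(shufD, shufZ) mulrDr mulrCA.
Qed.

Lemma twistK i : cancel (twist i) (untwist i).
Proof. by move=> x; apply/funext => w; rewrite /untwist /twist mulKf // twist_wt. Qed.
Lemma untwistK i : cancel (untwist i) (twist i).
Proof. by move=> x; apply/funext => w; rewrite /untwist /twist mulVKf // twist_wt. Qed.

Lemma untwistM i x y : untwist i (x * y) = untwist i x * untwist i y.
Proof. by apply: (can_inj (twistK i)); rewrite twistM !untwistK. Qed.

Lemma untwist_hom i mu x : hom mu x -> untwist i x = t i ^ (- H i mu) *: x.
Proof.
move=> hx; apply/funext => w; rewrite /untwist shufZ twist_wt invr_expz.
have [->//|hw] := eqVneq (wt w) mu.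
by rewrite (hom_supported hx hw) !mulr0.
Qed.

(* At [s = 0] this is the adjoint action of F_i; the twist by [s] makes it
   preserve the elements killed by the [s + 1]st power of [lder i]. *)
Definition adS (s : nat) i x : sh :=
  F i * x - t i ^ (s%:Z *+ 2) *: (untwist i x * F i).

Lemma adS_linear s i : linear (adS s i).
Proof.
move=> c x y; rewrite /adS untwistL mulrDr mulrDl -scalerAl -scalerAr.
by rewrite scalerBr scalerDr !scalerA mulrC opprD addrACA.
Qed.

Lemma adSE s i mu x : hom mu x ->
  adS s i x = F i * x - t i ^ (s%:Z *+ 2 - H i mu) *: (x * F i).
Proof. by move=> hx; rewrite /adS (untwist_hom i hx) -scalerAl scalerA -tD. Qed.

Lemma adS_hom s i mu x : hom mu x -> hom (mu + alpha i) (adS s i x).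
Proof.
move=> hx; rewrite (adSE s i hx); apply: homB; last first.
  by apply: homZ; apply: homM => //; apply: hom_gen.
by rewrite addrC; apply: homM => //; apply: hom_gen.
Qed.

Lemma lderFl i x : lder i (F i * x) = x + t i ^ 2 *: (F i * lder i x).
Proof.
by rewrite lderM lderF twistF eqxx scale1r mul1r -scalerAl /qP qa_diag.
Qed.

Lemma lderFr i mu x : hom mu x ->
  lder i (x * F i) = lder i x * F i + t i ^ H i mu *: x.
Proof.
by move=> hx; rewrite lderM lderF eqxx scale1r mulr1 (twist_hom _ hx).
Qed.

Lemma rderFr i x : rder i (x * F i) = x + t i ^ 2 *: (rder i x * F i).
Proof.
rewrite rderM // rderF twistF eqxx scale1r mulr1 -scalerAr /qP qa_diag.
by rewrite addrC.
Qed.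

Lemma rderFl i mu x : hom mu x ->
  rder i (F i * x) = F i * rder i x + t i ^ H i mu *: x.
Proof.
by move=> hx; rewrite rderM // rderF eqxx scale1r mul1r (twist_hom _ hx) addrC.
Qed.

(** The q-integer in base [t^2], that is [t^(k-1) [k]_t], as it comes out of the Leibniz rule for
    [F_i^k]. *)
Definition qn i k : K := \sum_(j < k) t i ^ (j%:Z *+ 2).

Lemma qnE i k : (t i ^ 2 - 1) * qn i k = t i ^ (k%:Z *+ 2) - 1.
Proof.
elim: k => [|k IH]; first by rewrite /qn big_ord0 mulr0 subrr.
rewrite /qn big_ord_recr /= mulrDr IH.
have -> : k.+1%:Z *+ 2 = 2 + k%:Z *+ 2 by lia.
by rewrite (tD i 2); ring.
Qed.

Lemma t2_neq1 i : t i ^ 2 - 1 != 0.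
Proof. by rewrite subr_eq0 qt_generic. Qed.

Lemma qn_neq0 i k : (0 < k)%N -> qn i k != 0.
Proof.
move=> k0; apply/eqP => h; have := qnE i k; rewrite h mulr0 => /esym/eqP.
by rewrite subr_eq0; apply/negP/qt_generic; lia.
Qed.

Lemma iter_lderFl i k x : iter k.+1 (lder i) (F i * x) =
  qn i k.+1 *: iter k (lder i) x
  + t i ^ (k.+1%:Z *+ 2) *: (F i * iter k.+1 (lder i) x).
Proof.
elim: k => [|k IH].
  by rewrite /= lderFl /qn big_ord1 scale1r.
rewrite iterS IH lderD !lderZ lderFl.
rewrite scalerDr scalerA -tD addrA -scalerDl; congr (_ *: _ + _ *: _).
  by rewrite [qn i k.+2]/qn big_ord_recr.
by congr (_ ^ _); lia.
Qed.

Lemma iter_lder_hom i k mu x : hom mu x -> hom (mu - alpha i *+ k) (iter k (lder i) x).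
Proof.
move=> hx; elim: k => [|k IH]; first by rewrite subr0.
by rewrite mulrSr opprD addrA; apply: lder_hom.
Qed.

Lemma iter_rder_hom i k mu x : hom mu x -> hom (mu - alpha i *+ k) (iter k (rder i) x).
Proof.
move=> hx; elim: k => [|k IH]; first by rewrite subr0.
by rewrite mulrSr opprD addrA; apply: rder_hom.
Qed.

Lemma cpair_sub_alpha i mu k : H i (mu - alpha i *+ k) = H i mu - k%:Z *+ 2.
Proof. by rewrite cpairD cpairN cpairMn cpair_alpha qa_diag; lia. Qed.

Lemma iter_lderFr i k mu x : hom mu x -> iter k.+1 (lder i) (x * F i) =
  (t i ^ (H i mu - k%:Z *+ 2) * qn i k.+1) *: iter k (lder i) x
  + iter k.+1 (lder i) x * F i.
Proof.
move=> hx; elim: k => [|k IH].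
  by rewrite /= (lderFr i hx) /qn big_ord1 mul0rn subr0 mulr1 addrC.
rewrite iterS IH lderD lderZ (lderFr i (iter_lder_hom i k.+1 hx)).
rewrite addrA addrAC -scalerDl; congr (_ *: _ + _).
rewrite cpair_sub_alpha [qn i k.+2]/qn big_ord_recl mulrDr mulr1 mulr_sumr addrC.
congr (_ + _); rewrite /qn mulr_sumr; apply: eq_bigr => j _; rewrite -!tD.
by congr (_ ^ _); rewrite lift0; lia.
Qed.

(** Under [l_i^(s+1)], both [F_i x] and [x F_i] contribute a multiple of [l_i^s x]; the factor
    [t^(2s)] in [adS] is the one that equalizes the two multiples. *)
Lemma adS_ker s i mu x : hom mu x -> iter s.+1 (lder i) x = 0 ->
  iter s.+1 (lder i) (adS s i x) = 0.
Proof.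
move=> hx hl; rewrite (adSE s i hx) -scaleNr addrC.
have iL k c y z : iter k (lder i) (c *: y + z)
    = c *: iter k (lder i) y + iter k (lder i) z.
  by elim: k => //= k ->; rewrite lderD lderZ.
rewrite iL iter_lderFl (iter_lderFr i s hx) hl mul0r mulr0 scaler0 !addr0.
rewrite scalerA mulrA mulNr -tD.
have -> : s%:Z *+ 2 - H i mu + (H i mu - s%:Z *+ 2) = 0 by lia.
by rewrite mulN1r -scalerDl addNr scale0r.
Qed.

Lemma rder_adS s i mu x : hom mu x -> rder i (adS s i x) =
  adS s i (rder i x) + (t i ^ H i mu - t i ^ (s%:Z *+ 2 - H i mu)) *: x.
Proof.
move=> hx; rewrite (adSE s i hx) (adSE s i (rder_hom i hx)) -scaleNr addrC.
rewrite rderD rderZ rderFr (rderFl i hx) scalerDr scalerA scalerBl.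
have := cpair_sub_alpha i mu 1; rewrite mulr1n => ->.
have -> : - t i ^ (s%:Z *+ 2 - H i mu) * t i ^ 2 = - t i ^ (s%:Z *+ 2 - (H i mu - 1%:Z *+ 2)).
  by rewrite mulNr -tD; congr (- _ ^ _); lia.
by rewrite !scaleNr [LHS](AC (2*2) ((3*2)*(4*1))).
Qed.

Lemma rder_ad_neq i j mu x : j != i -> hom mu x ->
  rder j (adS 0 i x) = adS 0 i (rder j x).
Proof.
move=> ji hx; rewrite (adSE 0 i hx) (adSE 0 i (rder_hom j hx)) -scaleNr addrC.
rewrite rderD rderZ !rderM // !rderF (negPf ji) !scale0r mul0r mulr0 add0r addr0.
rewrite twistF -scalerAr scalerA addrC -scaleNr add0r; congr (_ + _ *: _).
rewrite mulNr; congr (- _); rewrite cpairD cpairN cpair_alpha.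
by rewrite Psym /qP -tD; congr (_ ^ _); lia.
Qed.

Lemma lder_ad_neq i j mu x : j != i -> hom mu x -> lder j x = 0 ->
  lder j (adS 0 i x) = 0.
Proof.
move=> ji hx hl; rewrite (adSE 0 i hx) -scaleNr addrC lderD lderZ !lderM.
by rewrite !lderF (negPf ji) hl !scale0r !mul0r !mulr0 !addr0 scaler0.
Qed.

Lemma lder_ad i mu x : hom mu x -> lder i x = 0 -> lder i (adS 0 i x) = 0.
Proof. exact: (@adS_ker 0). Qed.

Lemma adS0M i mu x y : hom mu x ->
  adS 0 i (x * y) = adS 0 i x * y + t i ^ (- H i mu) *: (x * adS 0 i y).
Proof.
move=> hx; rewrite /adS mul0rn expr0z !scale1r mulrBr mulrBl untwistM (untwist_hom i hx).
rewrite scalerBr -!scalerAl !mulrA addrA; congr (_ - _).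
by rewrite subrK.
Qed.

Lemma adS1 i : adS 0 i 1 = 0.
Proof.
rewrite (adSE 0 i (hom1 F)) cpair0 mulr1 mul1r mul0rn subr0 expr0z scale1r.
exact: subrr.
Qed.

End Pairing.

(** The form in which the quantum Serre relations reach the shuffle algebra; [qgroup_integrable]
    supplies it. *)
Definition ad_integrable (K : fieldType) (n : nat) (Q : qdatum K n) : Prop :=
  forall i j : 'I_n, j != i -> exists N, iter N (@adS K n Q 0 i) (@Fsh K n (qP Q) j) = 0.

(** * Strings along one simple root as sl_2-modules *)

Section Integrable.
Context (K : fieldType) (n : nat) (Q : qdatum K n).
Notation t := (qt Q).
Notation a := (qa Q).
Notation sh := (qshuffle (qP Q)).
Notation F := (@Fsh K n (qP Q)).
Notation hom := (hom F).
Notation H := (cpair a).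
Notation ad := (adS 0).
Implicit Types (x y z : sh) (mu nu : weight n).
Hypothesis Fnil : ad_integrable Q.

Let t0 := qt_neq0 Q.
Let tD i (m k : int) : t i ^ (m + k) = t i ^ m * t i ^ k.
Proof. by rewrite expfzDr ?t0. Qed.
Let tn0 i (m : int) : t i ^ m != 0.
Proof. by rewrite expfz_neq0 ?t0. Qed.

Notation nilc i := (nilcoef F (ad i) (fun x => lder i x = 0)).

Let nilc0 i mu : nilc i mu 0.
Proof. by split=> //; [exact: hom0|exists 0%N]. Qed.

Lemma shuf_expansion i mu x : hom mu x -> exists N (ys : nat -> sh),
  (forall k, nilc i (mu - alpha i *+ k) (ys k)) /\
  x = \sum_(k < N) ys k * F i ^+ k.
Proof.
apply: (@hom_expansion _ _ _ F i (ad i) (fun mu => t i ^ (- H i mu))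
  (fun x => lder i x = 0)).
- exact: adS_linear.
- by move=> ???; apply: adS_hom.
- by move=> nu y hy; rewrite (adSE 0 i hy) mul0rn add0r subrK.
- by move=> nu y z hy; apply: adS0M.
- by [].
- by move=> b y z hy hz; rewrite lderD lderZ hy hz scaler0 addr0.
- by move=> nu y z hy h1 h2; rewrite lderM h1 h2 mul0r mulr0 addr0.
- exact: lder1.
- by move=> nu y hy; apply: lder_ad hy.
- by move=> j ji; rewrite lderF eq_sym (negPf ji) scale0r.
- exact: adS1.
- exact: Fnil.
Qed.

Lemma iter_lderM_ker i k mu y z : hom mu y -> lder i y = 0 ->
  iter k (lder i) (y * z) = t i ^ (H i mu *+ k) *: (y * iter k (lder i) z).
Proof.
move=> hy ly; elim: k => [|k IH]; first by rewrite mulr0n expr0z scale1r.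
rewrite iterS IH lderZ lderM ly mul0r add0r (twist_hom _ hy) -scalerAl scalerA.
by rewrite mulrSr tD.
Qed.

Lemma lderFX i k : lder i (F i ^+ k.+1) = qn Q i k.+1 *: F i ^+ k.
Proof.
elim: k => [|k IH].
  by rewrite expr1 lderF eqxx scale1r /qn big_ord1 expr0z scale1r.
rewrite exprS lderFl IH -scalerAr -exprS scalerA -{1}[F i ^+ _]scale1r -scalerDl.
congr (_ *: _); rewrite /qn mulr_sumr [in RHS]big_ord_recl; congr (_ + _).
by apply: eq_bigr => j _; rewrite -tD; congr (_ ^ _); rewrite lift0; lia.
Qed.

Lemma iter_lderFX i k : exists2 c : K, c != 0 &
  iter k (lder i) (F i ^+ k) = c *: 1.
Proof.
elim: k => [|k [c c0 IH]]; first by exists 1; rewrite ?oner_eq0 ?scale1r.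
have iZ m b y : iter m (lder i) (b *: y) = b *: iter m (lder i) y.
  by elim: m => //= m ->.
exists (qn Q i k.+1 * c); first by rewrite mulf_neq0 // qn_neq0.
by rewrite iterSr lderFX iZ IH scalerA.
Qed.

Lemma iter_lderFX_gt i m k : (k < m)%N -> iter m (lder i) (F i ^+ k) = 0.
Proof.
move=> km; have -> : m = ((m - k.+1) + k.+1)%N by rewrite subnK.
rewrite iterD iterS; have [c _ ->] := iter_lderFX i k.
by rewrite lderZ lder1 scaler0; elim: (m - _)%N => //= j ->.
Qed.

Let iter_lder_sum i m N (G : nat -> sh) :
  iter m (lder i) (\sum_(k < N) G k) = \sum_(k < N) iter m (lder i) (G k).
Proof.
have iD y z : iter m (lder i) (y + z) = iter m (lder i) y + iter m (lder i) z.
  by elim: m => //= m ->.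
elim: N => [|N IH]; last by rewrite !big_ord_recr iD IH.
by rewrite !big_ord0; elim: m {iD} => //= m ->.
Qed.

Lemma expansion_top i mu N (ys : nat -> sh) :
  (forall k, nilc i (mu - alpha i *+ k) (ys k)) ->
  exists2 c : K, c != 0 &
  iter N (lder i) (\sum_(k < N.+1) ys k * F i ^+ k) = c *: ys N.
Proof.
move=> hys; rewrite (iter_lder_sum i N N.+1 (fun k => ys k * F i ^+ k)).
rewrite big_ord_recr big1 /= => [|k _].
  have [hy ly _] := hys N; rewrite (iter_lderM_ker N _ hy ly).
  have [c c0 ->] := iter_lderFX i N; rewrite add0r -scalerAr mulr1 scalerA.
  by exists (t i ^ (H i (mu - alpha i *+ N) *+ N) * c); rewrite // mulf_neq0.
have [hy ly _] := hys k; rewrite (iter_lderM_ker N _ hy ly).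
by rewrite iter_lderFX_gt // mulr0 scaler0.
Qed.

Lemma ker_expansion i s mu x : hom mu x -> iter s.+1 (lder i) x = 0 ->
  exists ys : nat -> sh, (forall k, nilc i (mu - alpha i *+ k) (ys k)) /\
  x = \sum_(k < s.+1) ys k * F i ^+ k.
Proof.
move=> hx hl; have [N [ys [hys ex]]] := shuf_expansion i hx.
elim: N ys hys ex => [|N IH] ys hys ex.
  exists (fun=> 0); split=> [k|]; last by rewrite ex big_ord0 big1 // => k _; rewrite mul0r.
  exact: nilc0.
have [Ns|sN] := leqP N.+1 s.+1.
  exists (fun k => if (k < N.+1)%N then ys k else 0); split=> [k|].
    by case: ifP => // _; apply: nilc0.
  by rewrite ex (expansion_widen _ _ ys Ns).
apply: (IH ys) => //; have [c c0] := expansion_top N hys; rewrite -ex.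
have -> : N = ((N - s.+1) + s.+1)%N by rewrite subnK.
rewrite iterD hl; have -> : iter (N - s.+1) (lder i) (0 : sh) = 0.
  by elim: (N - _)%N => //= j ->.
rewrite subnK // => /esym/eqP; rewrite scaler_eq0 (negPf c0) /= => /eqP yN.
by rewrite ex big_ord_recr /= yN mul0r addr0.
Qed.

Lemma adS_iterL s i m c x y :
  iter m (adS s i) (c *: x + y) = c *: iter m (adS s i) x + iter m (adS s i) y.
Proof. by elim: m => //= m ->; rewrite adS_linear. Qed.

Lemma adS_iter0 s i m : iter m (adS s i) (0 : sh) = 0.
Proof.
have h := adS_linear s i (-1) (0 : sh) 0; elim: m => //= m ->.
by move: h; rewrite scaleN1r oppr0 addr0 => ->; rewrite scaleN1r addNr.
Qed.

Lemma adS_mulFX s i mu y k : hom mu y ->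
  adS s i (y * F i ^+ k) = ad i y * F i ^+ k
    + (t i ^ (- H i mu) - t i ^ ((s%:Z - k%:Z) *+ 2 - H i mu)) *: (y * F i ^+ k.+1).
Proof.
move=> hy; have hyk : hom (mu + alpha i *+ k) (y * F i ^+ k).
  by apply: homM => //; apply: homX; apply: hom_gen.
rewrite (adSE s i hyk) (adSE 0 i hy) -!mulrA -exprSr mul0rn add0r.
have -> : s%:Z *+ 2 - H i (mu + alpha i *+ k) = (s%:Z - k%:Z) *+ 2 - H i mu.
  by rewrite cpairD cpairMn cpair_alpha qa_diag; lia.
by rewrite mulrBl -scalerAl -[y * F i * _]mulrA -exprS scalerBl addrA subrK mulrA.
Qed.

(** Applied to [y F_i^k] with [l_i y = 0], the operator either applies [ad i] to [y] or raises [k].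
    The coefficient of the second term vanishes at [k = s], so both can happen only boundedly
    often. *)
Lemma adS_nil s i mu x : hom mu x -> iter s.+1 (lder i) x = 0 ->
  exists N, iter N (adS s i) x = 0.
Proof.
move=> hx /(ker_expansion hx)[ys [hys ->]].
have key N j k nu y : hom nu y -> iter N (ad i) y = 0 -> (k + j)%N = s ->
    iter (N + j) (adS s i) (y * F i ^+ k) = 0.
  move=> + + ekj; have [m mN] := ubnP (N + j)%N.
  elim: m N j k nu y ekj mN => // m IH [|N] j k nu y ekj mN hy hN.
    by move: hN => /= ->; rewrite mul0r adS_iter0.
  rewrite addSn iterSr (adS_mulFX _ _ _ hy) addrC adS_iterL.
  have -> : iter (N + j) (adS s i) (ad i y * F i ^+ k) = 0.
    by apply: IH (adS_hom 0 i hy) _; rewrite -?iterSr //; lia.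
  rewrite addr0; case: j ekj mN => [|j] ekj mN.
    by rewrite -ekj addn0 subrr mul0rn add0r subrr scale0r.
  have -> : iter (N + j.+1) (adS s i) (y * F i ^+ k.+1) = 0.
    by rewrite addnS -addSn; apply: IH hy hN; lia.
  by rewrite scaler0.
suff h N' : (N' <= s.+1)%N ->
    exists N, iter N (adS s i) (\sum_(k < N') ys k * F i ^+ k) = 0 by exact: h.
elim: N' => [|N' IH] hN'; first by exists 0%N; rewrite big_ord0.
have [N1 h1] := IH (ltnW hN'); have [hy _ [N2 h2]] := hys N'.
exists (N1 + (N2 + (s - N')))%N; rewrite big_ord_recr /= -[\sum_(_ < _) _]scale1r.
rewrite adS_iterL {1}addnC iterD h1 adS_iter0 scaler0 add0r iterD.
by rewrite (key _ _ _ _ _ hy h2) ?subnKC ?adS_iter0.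
Qed.

(** Confining the weights to one [alpha i]-string makes [mu] a function of [m], so that each of
    these sets is closed under sums. The shift of the sl_2-weight by [s] reflects the twist in
    [adS s i]. *)
Definition stringM (s : nat) i mu0 (m : int) x : Prop :=
  exists mu, [/\ m = s%:Z - H i mu, exists k : int, mu = mu0 + alpha i *~ k,
                 hom mu x & iter s.+1 (lder i) x = 0].

(** On weight [mu], with [H = H i mu], the commutator of [rder i] and [adS s i] is [t^H - t^(2s-H)],
    that is [- t^s (t - t^-1) [s-H]]. The scalar normalizes it to [[s-H]]. *)
Definition eop (s : nat) i x : sh :=
  (- t i ^ (- s%:Z) / (t i - (t i)^-1)) *: rder i x.

Let iter_lderL i k c x y :
  iter k (lder i) (c *: x + y) = c *: iter k (lder i) x + iter k (lder i) y.
Proof. by elim: k => //= k ->. Qed.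

Lemma tV_neq0 i : t i - (t i)^-1 != 0.
Proof.
apply/eqP => h; have /eqP[] := t2_neq1 Q i.
rewrite -[X in _ ^ X]/(1 + 1) tD expr1z -[X in _ * X](subrK (t i)^-1) h add0r.
by rewrite mulfV ?subrr.
Qed.

Section StringModule.
Context (s : nat) (i : 'I_n) (mu0 : weight n).
Notation M := (stringM s i mu0).
Notation e := (eop s i).
Notation f := (adS s i).

Let cpair_alphaz k : H i (mu0 + alpha i *~ k) = H i mu0 + k *+ 2.
Proof.
rewrite cpairD; congr (_ + _); case: k => k.
  by rewrite -pmulrn cpairMn cpair_alpha qa_diag; lia.
by rewrite NegzE mulrNz -pmulrn cpairN cpairMn cpair_alpha qa_diag; lia.
Qed.

Lemma stringML m c x y : M m x -> M m y -> M m (c *: x + y).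
Proof.
move=> [mu [em [k ek] hx lx]] [nu [en [l el] hy ly]].
have kl : k = l.
  by move: em en; rewrite ek el !cpair_alphaz; lia.
rewrite el -kl -ek in hy; exists mu; split=> //; first by exists k.
  exact: homL.
by rewrite iter_lderL lx ly scaler0 addr0.
Qed.

Lemma eop_linear : linear e.
Proof. by move=> c x y; rewrite /eop rderD rderZ scalerDr !scalerA mulrC. Qed.

Lemma string_eM m x : M m x -> M (m + 2) (e x).
Proof.
move=> [mu [-> [k ->] hx lx]]; exists (mu0 + alpha i *~ (k - 1)).
have E : mu0 + alpha i *~ (k - 1) = mu0 + alpha i *~ k - alpha i.
  by rewrite mulrzBr mulr1z addrA.
split; [|by exists (k - 1)| |].
- by rewrite !cpair_alphaz; lia.
- by rewrite E; apply: homZ; apply: rder_hom.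
have -> : e x = (- t i ^ (- s%:Z) / (t i - (t i)^-1)) *: rder i x + 0 by rewrite addr0.
rewrite iter_lderL; have -> : iter s.+1 (lder i) (rder i x) = rder i (iter s.+1 (lder i) x).
  by elim: (s.+1) => //= j ->.
rewrite lx (_ : rder i (0 : sh) = 0) // scaler0 add0r.
by elim: (s.+1) => //= j ->.
Qed.

Lemma string_fM m x : M m x -> M (m - 2) (f x).
Proof.
move=> [mu [-> [k ->] hx lx]]; exists (mu0 + alpha i *~ (k + 1)).
have E : mu0 + alpha i *~ (k + 1) = mu0 + alpha i *~ k + alpha i.
  by rewrite mulrzDr mulr1z addrA.
split; [|by exists (k + 1)| |].
- by rewrite !cpair_alphaz; lia.
- by rewrite E; apply: adS_hom.
exact: adS_ker hx lx.
Qed.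

Lemma string_ef m x : M m x -> e (f x) = f (e x) + qbr (t i) m *: x.
Proof.
move=> [mu [-> _ hx _]]; rewrite /eop (rder_adS _ _ hx) scalerDr scalerA.
have -> : f ((- t i ^ (- s%:Z) / (t i - (t i)^-1)) *: rder i x)
    = (- t i ^ (- s%:Z) / (t i - (t i)^-1)) *: f (rder i x).
  have := adS_linear s i (- t i ^ (- s%:Z) / (t i - (t i)^-1)) (rder i x) 0.
  by have /= -> := adS_iter0 s i 1; rewrite !addr0.
congr (_ + _ *: _); rewrite /qbr mulrAC; congr (_ / _).
rewrite mulNr mulrBr -!tD opprB; congr (_ ^ _ - _ ^ _); lia.
Qed.

Lemma string_fnil m x : M m x -> exists N, iter N f x = 0.
Proof. by move=> [mu [_ _ hx lx]]; apply: adS_nil hx lx. Qed.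

Let brP := qbr_is_bracket (qt_generic Q i) (t0 i).

Definition string_inj := sl2_inj brP stringML eop_linear (adS_linear s i)
  string_eM string_fM string_ef string_fnil.
Definition string_lowest := sl2_lowest brP stringML eop_linear (adS_linear s i)
  string_eM string_fM string_ef string_fnil.
Definition string_decomp := sl2_hw_decomp brP stringML eop_linear (adS_linear s i)
  string_eM string_fM string_ef string_fnil.

Lemma iter_eop k : exists2 c, c != 0 & forall x, iter k e x = c *: iter k (rder i) x.
Proof.
elim: k => [|k [c c0 IH]]; first by exists 1 => [|x]; rewrite ?oner_eq0 ?scale1r.
exists ((- t i ^ (- s%:Z) / (t i - (t i)^-1)) * c).
  by rewrite !mulf_neq0 ?oppr_eq0 ?invr_eq0 ?tV_neq0.
by move=> x; rewrite iterS IH /eop rderZ scalerA.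
Qed.

End StringModule.

Lemma hom_stringM s i mu x : hom mu x -> iter s.+1 (lder i) x = 0 ->
  stringM s i mu (s%:Z - H i mu) x.
Proof. by move=> hx lx; exists mu; split=> //; exists 0; rewrite mulr0z addr0. Qed.

(** On the kernel of [l_i^(s+1)] the operators [eop s i] and [adS s i] form an sl_2-pair with
    [adS s i] locally nilpotent, and [x] has sl_2-weight [s - H i mu]. This is [sl2_inj] for that
    pair. *)
Lemma string_bound i s u mu x : hom mu x ->
  iter s.+1 (lder i) x = 0 -> iter u.+1 (rder i) x = 0 ->
  (s + u)%N%:Z < H i mu -> x = 0.
Proof.
move=> hx lx rx hmu; have [c _ hc] := iter_eop s i u.+1.
apply: (string_inj (hom_stringM hx lx) (p := u)); last by lia.
by rewrite hc rx scaler0.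
Qed.

(** At the boundary of [string_bound], [x] is a lowest weight vector, and [adS s i x = 0] is the
    claimed commutation relation. *)
Lemma string_commute i s u mu x : hom mu x ->
  iter s.+1 (lder i) x = 0 -> iter u.+1 (rder i) x = 0 ->
  H i mu = (s + u)%N%:Z -> F i * x = t i ^ (s%:Z - u%:Z) *: (x * F i).
Proof.
move=> hx lx rx hmu; have [c _ hc] := iter_eop s i u.+1.
have h : adS s i x = 0.
  apply: (string_lowest (hom_stringM hx lx) (p := u)); last by lia.
  by rewrite hc rx scaler0.
apply/eqP; rewrite -subr_eq0 -[X in _ == X]h (adSE s i hx); apply/eqP.
by congr (_ - _ ^ _ *: _); lia.
Qed.

End Integrable.

(** * Positivity *)

(* [pos] plays the role of the positive cone of an ordered field: for C(q) it
   consists of the fractions whose leading coefficient is a positive real. *)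
Record positive_cone (K : fieldType) (pos : K -> Prop) (cj : K -> K) : Prop := {
  pos_neq0 : forall c, pos c -> c != 0;
  pos1 : pos 1;
  posD : forall b c, pos b -> pos c -> pos (b + c);
  posM : forall b c, pos b -> pos c -> pos (b * c);
  posV : forall c, pos c -> pos c^-1;
  cj0 : cj 0 = 0;
  cj1 : cj 1 = 1;
  cjD : forall b c, cj (b + c) = cj b + cj c;
  cjM : forall b c, cj (b * c) = cj b * cj c;
  pos_cj : forall c, c != 0 -> pos (c * cj c)
}.

(** In finite type [pd_def] expresses definiteness of the invariant form, because [(nu, nu)] is the
    sum of the [d_i * nu i * H i nu]. *)
Record positive_datum (K : fieldType) (n : nat) (Q : qdatum K n)
    (pos : K -> Prop) (cj : K -> K) : Prop := {
  pd_cone : positive_cone pos cj;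
  pos_tX : forall i (m : int), pos (qt Q i ^ m);
  pos_tX1 : forall i (m : int), 0 < m -> pos (qt Q i ^ m - 1);
  cj_tX : forall i (m : int), cj (qt Q i ^ m) = qt Q i ^ m;
  pd_integrable : ad_integrable Q;
  pd_def : forall nu : weight n,
    (forall i, nu i * cpair (qa Q) i nu <= 0) -> nu = 0
}.

Section Positive.
Context (K : fieldType) (n : nat) (Q : qdatum K n).
Notation t := (qt Q).
Notation a := (qa Q).
Notation sh := (qshuffle (qP Q)).
Notation F := (@Fsh K n (qP Q)).
Notation hom := (hom F).
Notation H := (cpair a).
Notation ad := (adS 0).
Implicit Types (x y z : sh) (mu nu : weight n).
Context (pos : K -> Prop) (cj : K -> K).
Hypothesis PD : positive_datum Q pos cj.
Let PC := pd_cone PD.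

Let t0 := qt_neq0 Q.
Let tD i (m k : int) : t i ^ (m + k) = t i ^ m * t i ^ k.
Proof. by rewrite expfzDr ?t0. Qed.

Lemma hom_coord_ge0 mu x i : hom mu x -> x != 0 -> 0 <= mu i.
Proof. by move=> hx /(hom_neq0 hx)[w <-]; rewrite wtE. Qed.

Lemma hom_height_ge0 mu x : hom mu x -> x != 0 -> 0 <= height mu.
Proof. by move=> hx /(hom_neq0 hx)[w <-]; rewrite height_wt. Qed.

Lemma iter_der_eq0 (g : sh -> sh) i mu x N :
  (forall k, hom (mu - alpha i *+ k) (iter k g x)) -> mu i < N%:Z ->
  iter N g x = 0.
Proof.
move=> hg hN; apply/eqP; apply: contraT => h.
have := hom_coord_ge0 i (hg N) h; rewrite !ffunE ffunMnE ffunE eqxx.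
by rewrite -[true%:R *+ N]/(N%:R) natz leNgt subr_lt0 hN.
Qed.

Lemma iter_der_depth (g : sh -> sh) i mu x :
  (forall k, hom (mu - alpha i *+ k) (iter k g x)) -> x != 0 ->
  exists k, iter k g x != 0 /\ iter k.+1 g x = 0.
Proof.
move=> hg x0; have h : iter (`|mu i|%N.+1) g x = 0.
  by apply: iter_der_eq0 hg _; lia.
elim: (`|mu i|%N.+1) h => [|N IH] h; first by case/eqP: x0.
by have [/IH //|hN] := eqVneq (iter N g x) 0; exists N.
Qed.

(** Only the terms with exactly [k] derivatives on [x] and [m] on [y] survive. Their coefficients
    are powers of [t], so their sum, essentially a q-binomial coefficient, is positive and hence not
    zero. *)
Lemma iter_lderM_top i nu k m mu x y : hom mu x -> hom nu y ->
  iter k.+1 (lder i) x = 0 -> iter m.+1 (lder i) y = 0 ->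
  exists2 c, pos c & iter (k + m) (lder i) (x * y)
    = c *: (iter k (lder i) x * iter m (lder i) y).
Proof.
have iL j (c : K) (u v : sh) : iter j (lder i) (c *: u + v)
    = c *: iter j (lder i) u + iter j (lder i) v by elim: j => //= j ->.
have i0 j : iter j (lder i) (0 : sh) = 0 by elim: j => //= j ->.
have iZ j (c : K) (u : sh) : iter j (lder i) (c *: u) = c *: iter j (lder i) u.
  by have := iL j c u 0; rewrite !i0 !addr0.
have [N hN] := ubnP (k + m)%N; elim: N k m mu nu x y hN => // N IH k m mu nu x y hN hx hy.
have sr j (u : sh) : iter j.+1 (lder i) u = iter j (lder i) (lder i u) by rewrite iterSr.
case: k hN => [|k] hN lx; case: m hN => [|m] hN ly.
- by exists 1; rewrite ?scale1r //; apply: pos1 PC.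
- rewrite add0n !sr lderM [lder i x]lx mul0r add0r (twist_hom _ hx) -scalerAl iZ.
  rewrite sr in ly.
  have [c pc hc] := IH 0%N m _ _ x (lder i y) hN hx (lder_hom i hy) lx ly.
  exists (t i ^ H i mu * c); last by rewrite -scalerA -hc.
  by apply: (posM PC) _ pc; apply: (pos_tX PD).
- rewrite addn0 !sr lderM [lder i y]ly mulr0 addr0; rewrite sr in lx.
  rewrite addn0 in hN; have hN' : (k + 0 < N)%N by rewrite addn0.
  have [c pc hc] := IH k 0%N _ _ (lder i x) y hN' (lder_hom i hx) hy lx ly.
  by exists c => //; rewrite -hc addn0.
rewrite addSn sr lderM (twist_hom _ hx) -scalerAl addrC iL.
have lx' := lx; have ly' := ly; rewrite sr in lx'; rewrite sr in ly'.
have h1 : (k + m.+1 < N)%N by [].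
have [c pc hc] := IH k m.+1 _ _ (lder i x) y h1 (lder_hom i hx) hy lx' ly.
have h2 : (k.+1 + m < N)%N by rewrite addSnnS.
have [c' pc' hc'] := IH k.+1 m _ _ x (lder i y) h2 hx (lder_hom i hy) lx ly'.
exists (t i ^ H i mu * c' + c).
  by apply: (posD PC) _ pc; apply: (posM PC) _ pc'; apply: (pos_tX PD).
by rewrite hc addnS -addSn hc' -!sr scalerA -scalerDl.
Qed.

(** Some [lder i] does not kill [x]. Applying it to [x y] as often as possible gives a nonzero
    multiple of the product of the top derivatives, whose total height is smaller. *)
Lemma hom_mul_neq0 mu nu x y : hom mu x -> hom nu y -> x != 0 -> y != 0 ->
  x * y != 0.
Proof.
move=> hx hy; have [N] := ubnP (`|height mu| + `|height nu|)%N.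
elim: N mu nu x y hx hy => // N IH mu nu x y hx hy hN x0 y0.
have [m0|m0] := eqVneq mu 0.
  rewrite m0 in hx; have [c ec] := hom_weight0 hx; rewrite ec -scalerAl mul1r.
  rewrite scaler_eq0 negb_or y0 andbT; apply: contraNneq x0 => c0.
  by rewrite ec c0 scale0r.
have [i li] : exists i, lder i x != 0.
  apply: contrapT => h; case/eqP: x0; apply: shom_lder_eq0 hx m0 _ => i.
  by apply: contrapT => /eqP hi; apply: h; exists i.
have hlx k : hom (mu - alpha i *+ k) (iter k (lder i) x) by apply: iter_lder_hom.
have hly k : hom (nu - alpha i *+ k) (iter k (lder i) y) by apply: iter_lder_hom.
have [k [kx lx]] := iter_der_depth hlx x0.
have [m [my ly]] := iter_der_depth hly y0.
have [c pc hc] := iter_lderM_top hx hy lx ly.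
case: k kx lx hc => [|k] kx lx hc; first by rewrite [lder i x]lx eqxx in li.
suff : iter k.+1 (lder i) x * iter m (lder i) y != 0.
  apply: contraNneq => xy; have : iter (k.+1 + m) (lder i) (x * y) = 0.
    by rewrite xy; elim: (_ + _)%N => //= j ->.
  by rewrite hc => /eqP; rewrite scaler_eq0 (negPf (pos_neq0 PC pc)).
apply: (IH _ _ _ _ (hlx k.+1) (hly m)) => //.
have hm (la : weight n) j : height (la - alpha i *+ j) = height la - j%:Z.
  rewrite heightD heightN; congr (_ - _); elim: j => [|j IHj].
    by rewrite /height big1 // => l _; rewrite ffunE.
  by rewrite mulrS heightD IHj height_alpha; lia.
have := hom_height_ge0 (hlx k.+1) kx; have := hom_height_ge0 (hly m) my.
by move: hN; rewrite !hm; lia.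
Qed.

Lemma hom_exp_neq0 mu x k : hom mu x -> x != 0 -> x ^+ k != 0.
Proof.
move=> hx x0; elim: k => [|k IH]; first by rewrite expr0 oner_eq0.
by rewrite exprS; apply: hom_mul_neq0 hx (homX k hx) x0 IH.
Qed.

Lemma cjN c : cj (- c) = - cj c.
Proof. by apply/eqP; rewrite -addr_eq0 -(cjD PC) addNr (cj0 PC). Qed.

Definition shcj x : sh := fun w => cj (x w).

Lemma shcjD x y : shcj (x + y) = shcj x + shcj y.
Proof. by apply/funext => w; rewrite /shcj shufD (cjD PC). Qed.
Lemma shcjZ c x : shcj (c *: x) = cj c *: shcj x.
Proof. by apply/funext => w; rewrite /shcj shufZ (cjM PC). Qed.
Lemma shcj0 : shcj 0 = 0.
Proof. by apply/funext => w; rewrite /shcj shuf0 (cj0 PC). Qed.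
Lemma lder_shcj i x : lder i (shcj x) = shcj (lder i x). Proof. by []. Qed.
Lemma rder_shcj i x : rder i (shcj x) = shcj (rder i x). Proof. by []. Qed.
Lemma shcj1 : shcj 1 = 1.
Proof.
apply/funext => w; rewrite /shcj !shuf1E; case: eqP => _.
  exact: cj1 PC.
exact: cj0 PC.
Qed.
Lemma shcj_twist i x : shcj (twist i x) = twist i (shcj x).
Proof.
by apply/funext => w; rewrite twistE /shcj twistE (cjM PC) (cj_tX PD).
Qed.
Lemma shcjM x y : shcj (x * y) = shcj x * shcj y.
Proof.
apply/funext => w; elim: w x y => [|i w IH] x y; first exact: cjM PC _ _.
rewrite -[LHS]/(shcj (lder i (x * y)) w) -[RHS]/(lder i _ w) !lderM.
by rewrite shcjD !shufD !IH shcj_twist.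
Qed.
Lemma shcjF i : shcj (F i) = F i.
Proof.
apply/funext => w; rewrite /shcj /Fsh; case: (w == _).
  exact: cj1 PC.
exact: cj0 PC.
Qed.
Lemma shcj_mon w : shcj (wmon F w) = wmon F w.
Proof.
elim: w => [|i w IH]; first by rewrite wmon_nil shcj1.
by rewrite wmon_cons shcjM shcjF IH.
Qed.
Lemma shcj_hom mu x : hom mu x -> hom mu (shcj x).
Proof.
elim/hom_lin_ind => [|c y z hy hz|w <-].
- by rewrite shcj0; apply: hom0.
- by rewrite shcjD shcjZ; apply: homL.
by rewrite shcj_mon; apply: hom_mon.
Qed.
Lemma shcjX x k : shcj (x ^+ k) = shcj x ^+ k.
Proof. by elim: k => [|k IH]; rewrite ?expr0 ?shcj1 // !exprS shcjM IH. Qed.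

Lemma shcj_ad i mu x : hom mu x -> shcj (ad i x) = ad i (shcj x).
Proof.
move=> hx; rewrite (adSE 0 i hx) (adSE 0 i (shcj_hom hx)) -!scaleNr.
rewrite shcjD shcjZ !shcjM !shcjF; congr (_ + _ *: _).
by rewrite cjN (cj_tX PD).
Qed.

Lemma qbr_pos i (m : int) : 0 < m -> pos (qbr (t i) m).
Proof.
move=> m0; rewrite /qbr.
have -> : t i ^ m - t i ^ (- m) = t i ^ (- m) * (t i ^ (m *+ 2) - 1).
  by rewrite mulrBr mulr1 -tD; congr (_ ^ _ - _); lia.
have -> : t i - (t i)^-1 = t i ^ (- 1) * (t i ^ (1 *+ 2) - 1).
  rewrite mulrBr mulr1 -tD exprN1; congr (_ - _).
apply: posM PC _ _ _ _; last apply: posV PC _ _; apply: posM PC _ _ _ _;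
  by [apply: pos_tX PD _ _|apply: pos_tX1 PD _ _ _; lia].
Qed.

Lemma tV_pos i : pos (t i - (t i)^-1).
Proof.
have -> : t i - (t i)^-1 = t i ^ (- 1) * (t i ^ (1 *+ 2) - 1).
  rewrite mulrBr mulr1 -tD exprN1; congr (_ - _).
by apply: posM PC _ _ _ _; [apply: pos_tX PD _ _|apply: pos_tX1 PD _ _ _].
Qed.

Lemma qn_pos i k : pos (qn Q i k.+1).
Proof.
elim: k => [|k IH]; first by rewrite /qn big_ord1; apply: pos_tX PD _ _.
by rewrite /qn big_ord_recr; apply: posD PC _ _ IH _; apply: pos_tX PD _ _.
Qed.

End Positive.

Section Positive.
Context (K : fieldType) (n : nat) (Q : qdatum K n).
Notation t := (qt Q).
Notation a := (qa Q).
Notation sh := (qshuffle (qP Q)).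
Notation F := (@Fsh K n (qP Q)).
Notation hom := (hom F).
Notation span := (span F).
Notation H := (cpair a).
Notation ad := (adS 0).
Implicit Types (x y z : sh) (mu nu : weight n).
Context (pos : K -> Prop) (cj : K -> K).
Hypothesis PD : positive_datum Q pos cj.
Let PC := pd_cone PD.

Let t0 := qt_neq0 Q.
Let tn0 i (m : int) : t i ^ m != 0.
Proof. by rewrite expfz_neq0 ?t0. Qed.

Lemma span_FX i k x : span x -> span (F i ^+ k * x).
Proof.
move=> hx; apply: spanM => //; elim: k => [|k IH].
  by rewrite expr0 -(wmon_nil F); apply: span_mon.
by rewrite exprS; apply: spanM IH; apply: span_gen.
Qed.

Lemma lderFXl i k y : lder i y = 0 ->
  lder i (F i ^+ k.+1 * y) = qn Q i k.+1 *: (F i ^+ k * y).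
Proof. by move=> ly; rewrite lderM ly mulr0 addr0 lderFX -scalerAl. Qed.

Lemma iter_lderFXl i k y : lder i y = 0 ->
  exists2 c, c != 0 & iter k (lder i) (F i ^+ k * y) = c *: y.
Proof.
move=> ly; elim: k => [|k [c c0 IH]].
  by exists 1; rewrite ?oner_eq0 // mul1r scale1r.
exists (qn Q i k.+1 * c); first by rewrite mulf_neq0 // qn_neq0.
rewrite iterSr (lderFXl _ ly) -scalerA -IH.
have iZ j (b : K) (u : sh) : iter j (lder i) (b *: u) = b *: iter j (lder i) u.
  by elim: j => //= j ->.
exact: iZ.
Qed.

Lemma left_expansion i N mu x : hom mu x -> iter N (lder i) x = 0 ->
  exists xs : nat -> sh,
  [/\ forall k, hom (mu - alpha i *+ k) (xs k), forall k, lder i (xs k) = 0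
    & x = \sum_(k < N) F i ^+ k * xs k].
Proof.
elim: N x => [|N IH] x hx lx.
  exists (fun=> 0); split=> // [k|]; first exact: hom0.
  by rewrite big_ord0.
pose y := iter N (lder i) x; have ly : lder i y = 0 by [].
have hy : hom (mu - alpha i *+ N) y by apply: iter_lder_hom.
have [c c0 hc] := iter_lderFXl N ly.
have hFy : hom mu (F i ^+ N * y).
  have := homM (homX N (hom_gen F i)) hy.
  by rewrite addrC subrK.
have hz : hom mu (x - c^-1 *: (F i ^+ N * y)) by apply: homB => //; apply: homZ.
have iL j (b : K) (u v : sh) : iter j (lder i) (b *: u + v)
    = b *: iter j (lder i) u + iter j (lder i) v by elim: j => //= j ->.
have lz : iter N (lder i) (x - c^-1 *: (F i ^+ N * y)) = 0.
  by rewrite -scaleNr addrC iL hc scaleNr scalerA mulVf // scale1r addNr.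
have [xs [h1 h2 h3]] := IH _ hz lz.
exists (fun k => if (k < N)%N then xs k else if k == N then c^-1 *: y else 0).
split=> [k|k|].
- case: ifP => _ //; case: eqP => [->|_]; last exact: hom0.
  exact: homZ.
- case: ifP => _ //; case: eqP => [_|_] //.
  by rewrite lderZ ly scaler0.
rewrite big_ord_recr /= ltnn eqxx -scalerAr -[LHS](subrK (c^-1 *: (F i ^+ N * y))).
by rewrite {1}h3; congr (_ + _); apply: eq_bigr => k _; rewrite ltn_ord.
Qed.

(** Moving one [F_i] across the pairing turns it into [lder i], which takes [F_i^j y] to [qn j]
    times [F_i^(j-1) y] when [l_i y = 0]. Unequal exponents therefore end in a derivative of [x] or
    [y]. *)
Lemma pr_FX i k j x y : span x -> span y -> lder i x = 0 -> lder i y = 0 ->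
  (k != j -> pr (F i ^+ k * x) (F i ^+ j * y) = 0) /\
  (exists2 c, pos c & pr (F i ^+ k * x) (F i ^+ k * y) = c * pr x y).
Proof.
move=> hx hy lx ly; split.
  elim: k j => [|k IH] [|j] //= kj.
  - rewrite mul1r prC //; last exact: span_FX.
    by rewrite exprS -mulrA prFl ?lx ?pr0r //; apply: span_FX.
  - by rewrite mul1r exprS -mulrA prFl ?ly ?pr0r //; apply: span_FX.
  rewrite exprS -mulrA prFl; try exact: span_FX.
  by rewrite (lderFXl _ ly) prZr IH ?mulr0.
elim: k => [|k [c pc IH]]; first by exists 1; rewrite ?mul1r //; apply: pos1 PC.
exists (qn Q i k.+1 * c); first by apply: (posM PC) => //; apply: qn_pos PD _ _.
rewrite [in X in pr X _]exprS -mulrA prFl; try exact: span_FX.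
by rewrite (lderFXl _ ly) prZr IH mulrA.
Qed.

(** The term [F_i y] of [ad(F_i) y] pairs with [l_i x = 0], so on this kernel the adjoint of
    [ad(F_i)] is a multiple of [r_i]. *)
Lemma pr_ad i mu x y : hom mu y -> span x -> lder i x = 0 ->
  pr (ad i y) x = - t i ^ (- H i mu) * pr y (rder i x).
Proof.
move=> hy hx lx; have sy := span_hom hy; have sF := span_gen F i.
rewrite (adSE 0 i hy) mul0rn add0r addrC -scaleNr prLl //; try exact: spanM.
by rewrite prFl // lx pr0r addr0 prFr.
Qed.

Definition herm x : K := pr x (shcj cj x).

Let ad_iter_hom i k mu x : hom mu x -> hom (mu + alpha i *+ k) (iter k (ad i) x).
Proof.
move=> hx; elim: k => [|k IH]; first by rewrite addr0.
by rewrite mulrSr addrA; apply: adS_hom.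
Qed.

Let lder_iter_ad i k mu x : hom mu x -> lder i x = 0 -> lder i (iter k (ad i) x) = 0.
Proof.
move=> hx lx; elim: k => //= k IH.
exact: lder_ad (ad_iter_hom i k hx) IH.
Qed.

Lemma rder_iter_ad i k mu x : hom mu x -> lder i x = 0 -> rder i x = 0 ->
  rder i (iter k.+1 (ad i) x) = (- (t i - (t i)^-1)
     * (qbr (t i) k.+1%:Z * qbr (t i) (- H i mu - k%:Z))) *: iter k (ad i) x.
Proof.
move=> hx lx rx; have hM := hom_stringM hx (lx : iter 1 (lder i) x = 0).
have br := qbr_is_bracket (qt_generic Q i) (t0 i).
have := sl2_efiter br (@adS_linear _ _ Q 0%N i) (@string_fM _ _ Q 0%N i mu)
  (@string_ef _ _ Q 0%N i mu) k hM.
have -> : eop 0 i x = 0 by rewrite /eop rx scaler0.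
rewrite (adS_iter0 Q 0 i k.+1) add0r [0%:Z - _]add0r => h.
rewrite -scalerA -h /eop scalerA oppr0 expr0z mulrA mulrN1 opprK.
by rewrite mulfV ?scale1r // tV_neq0.
Qed.

Lemma pr_iter_ad_lt i k j mu nu x y : hom mu x -> hom nu y ->
  lder i x = 0 -> lder i y = 0 -> rder i y = 0 -> (j < k)%N ->
  pr (iter k (ad i) x) (iter j (ad i) y) = 0.
Proof.
move=> hx hy lx ly ry; elim: j k => [|j IH] [|k] // jk.
  rewrite iterS (pr_ad (ad_iter_hom i k hx) (span_hom hy)) //.
  by rewrite ry pr0r mulr0.
rewrite iterS (pr_ad (ad_iter_hom i k hx)).
- by rewrite (rder_iter_ad _ hy) // prZr IH // !mulr0.
- exact: span_hom (ad_iter_hom i j.+1 hy).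
exact: lder_iter_ad hy ly.
Qed.

(** Here [y] is a highest weight vector of sl_2-weight [- H i nu]; the bound on [k] keeps all the
    q-integers [[- H i nu - j]] with [j < k] positive. *)
Lemma pr_iter_ad i k mu nu x y : hom mu x -> hom nu y ->
  lder i x = 0 -> lder i y = 0 -> rder i y = 0 -> k%:Z <= - H i nu ->
  exists2 c, pos c & pr (iter k (ad i) x) (iter k (ad i) y) = c * pr x y.
Proof.
move=> hx hy lx ly ry; elim: k => [|k IH] kn.
  by exists 1; rewrite ?mul1r //; apply: pos1 PC.
have [|c pc hc] := IH; first by lia.
exists (t i ^ (- H i (mu + alpha i *+ k)) * ((t i - (t i)^-1)
     * (qbr (t i) k.+1%:Z * qbr (t i) (- H i nu - k%:Z))) * c).
  apply: (posM PC) => //; apply: (posM PC); first exact: pos_tX PD _ _.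
  apply: (posM PC); first exact: tV_pos PD _.
  by apply: (posM PC); apply: (qbr_pos PD); lia.
rewrite iterS (pr_ad (ad_iter_hom i k hx)).
- by rewrite (rder_iter_ad _ hy) // prZr hc; ring.
- exact: span_hom (ad_iter_hom i k.+1 hy).
exact: lder_iter_ad hy ly.
Qed.

Lemma herm_orth_pos mu N (v : nat -> sh) :
  (forall k, hom mu (v k)) ->
  (forall k j, k != j -> pr (v k) (shcj cj (v j)) = 0) ->
  (forall k, v k != 0 -> pos (herm (v k))) ->
  \sum_(k < N) v k != 0 -> pos (herm (\sum_(k < N) v k)).
Proof.
move=> hv ov pv.
have hs m : hom mu (\sum_(k < m) v k) by apply: hom_sum.
have sc x : hom mu x -> span (shcj cj x) by move=> h; apply: span_hom (shcj_hom PD h).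
elim: N => [|N IH]; first by rewrite big_ord0 eqxx.
rewrite big_ord_recr /=.
have o1 m : (m <= N)%N -> pr (v N) (shcj cj (\sum_(k < m) v k)) = 0.
  elim: m => [|m IHm] mN; first by rewrite big_ord0 (shcj0 PD) pr0r.
  by rewrite big_ord_recr /= (shcjD PD) prDr IHm ?(ltnW mN) // add0r ov // gtn_eqF.
have o2 m : (m <= N)%N -> pr (\sum_(k < m) v k) (shcj cj (v N)) = 0.
  elim: m => [|m IHm] mN.
    rewrite big_ord0 prC; [by rewrite pr0r|exact: span0|exact: sc].
  rewrite big_ord_recr /= -[\sum_(_ < m) _]scale1r prLl.
  - by rewrite IHm ?(ltnW mN) // mulr0 add0r ov // ltn_eqF.
  - exact: span_hom (hs m).
  - exact: span_hom (hv m).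
  exact: sc.
have -> : herm (\sum_(k < N) v k + v N) = herm (\sum_(k < N) v k) + herm (v N).
  have s1 := span_hom (hs N); have s2 := span_hom (hv N).
  have s3 := sc _ (hs N); have s4 := sc _ (hv N).
  rewrite /herm (shcjD PD) prDr -{1 3}[\sum_(_ < N) _]scale1r.
  by rewrite !prLl // !mul1r o1 // o2 // add0r addr0.
have [s0|s0] := eqVneq (\sum_(k < N) v k) 0.
  by rewrite s0 add0r => /pv; rewrite /herm (shcj0 PD) pr0r add0r.
have [v0|v0] := eqVneq (v N) 0 => _; last by apply: (posD PC); [apply: IH|apply: pv].
by rewrite v0 /herm (shcj0 PD) pr0r addr0; apply: IH.
Qed.

Lemma weight_pos mu x : hom mu x -> x != 0 -> mu != 0 -> exists i, 0 < H i mu.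
Proof.
move=> hx x0 m0; apply: contrapT => h; case/eqP: m0; apply: pd_def PD _ _ => i.
apply: mulr_ge0_le0; first exact: hom_coord_ge0 hx x0.
by rewrite leNgt; apply/negP => hi; apply: h; exists i.
Qed.

Lemma height_sub mu i k : height (mu - alpha i *+ k) = height mu - k%:Z.
Proof.
rewrite heightD heightN; congr (_ - _); elim: k => [|k IH].
  by rewrite /height big1 // => l _; rewrite ffunE.
by rewrite mulrS heightD IH height_alpha; lia.
Qed.

(* Induction on the height: if (mu, alpha_i) > 0 then [x] is an orthogonal sum of
   elements F_i^k x_k, and x_0 is a sum of elements ad(F_i)^k u_k with k > 0, so
   that only smaller weights occur. *)
Theorem herm_pos mu x : hom mu x -> x != 0 -> pos (herm x).
Proof.
move=> hx x0; have [N] := ubnP `|height mu|%N.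
elim: N mu x hx x0 => // N IH mu x hx x0 hN.
have [m0|m0] := eqVneq mu 0.
  rewrite m0 in hx; have [c ec] := hom_weight0 hx.
  have c0 : c != 0 by apply: contraNneq x0 => c0; rewrite ec c0 scale0r.
  have s1 : span (1 : sh) by apply: span_hom (hom1 F).
  rewrite /herm ec (shcjZ PD) (shcj1 PD) prZr.
  rewrite -[c *: 1]addr0 prLl //; last exact: span0.
  have -> : pr (1 : sh) 1 = 1.
    by rewrite -{1}(wmon_nil F) pr_mon // shuf1E.
  have -> : pr (0 : sh) 1 = 0 by rewrite prC // ?pr0r //; apply: span0.
  by rewrite addr0 mulr1 mulrC; apply: pos_cj PC _ c0.
have [i hi] := weight_pos hx x0 m0.
have low k y : (0 < k)%N -> hom (mu - alpha i *+ k) y -> y != 0 -> pos (herm y).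
  move=> k0 hy y0; apply: (IH _ _ hy y0).
  have := hom_height_ge0 hy y0; have := hom_height_ge0 hx x0.
  by move: hN; rewrite height_sub; lia.
have ker0 y : hom mu y -> lder i y = 0 -> y != 0 -> pos (herm y).
  move=> hy ly; have hM := hom_stringM hy (ly : iter 1 (lder i) y = 0).
  have [p ry] : exists p, iter p (rder i) y = 0.
    exists (`|mu i|%N.+1); apply: iter_der_eq0 (fun k => iter_rder_hom i k hy) _; lia.
  have [c _ hc] := iter_eop Q 0 i p.
  have ey : iter p (eop 0 i) y = 0 by rewrite hc ry scaler0.
  have [u [uM ue un ->]] := string_decomp (pd_integrable PD) hM ey.
  have hu k : [/\ hom (mu - alpha i *+ k) (u k), lder i (u k) = 0 & rder i (u k) = 0].
    have [nu [em [z enu] hz lz]] := uM k; split=> //.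
      have -> : mu - alpha i *+ k = nu => //.
      move: em; rewrite enu cpairD; have -> : H i (alpha i *~ z) = z *+ 2.
        case: z {enu} => z; first by rewrite -pmulrn cpairMn cpair_alpha qa_diag; lia.
        by rewrite NegzE mulrNz -pmulrn cpairN cpairMn cpair_alpha qa_diag; lia.
      move=> em; have -> : z = - k%:Z by lia.
      by rewrite mulrNz -pmulrn.
    have /eqP := ue k; rewrite /eop scaler_eq0 !mulf_eq0 invr_eq0 oppr_eq0.
    by rewrite (negPf (tV_neq0 Q i)) (negPf (tn0 _ _)) /= => /eqP.
  have hv k : hom mu (iter k (ad i) (u k)).
    by have [hk _ _] := hu k; have := ad_iter_hom i k hk; rewrite subrK.
  have hc' k : [/\ hom (mu - alpha i *+ k) (shcj cj (u k)), lder i (shcj cj (u k)) = 0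
               & rder i (shcj cj (u k)) = 0].
    have [hk lk rk] := hu k; split; first exact: (shcj_hom PD hk).
      by rewrite lder_shcj lk (shcj0 PD).
    by rewrite rder_shcj rk (shcj0 PD).
  have cjad m nu z : hom nu z ->
      shcj cj (iter m (ad i) z) = iter m (ad i) (shcj cj z).
    move=> hz; elim: m => //= m <-.
    exact: (shcj_ad PD i (ad_iter_hom i m hz)).
  apply: (@herm_orth_pos mu p (fun k => iter k (ad i) (u k))) => // [k j kj|k vk].
    have [hk lk rk] := hu k; have [hj lj rj] := hc' j.
    have [hj0 _ _] := hu j; rewrite (cjad j _ _ hj0).
    have [jk|jk|jk] := ltngtP j k; last by rewrite jk eqxx in kj.
      exact: (pr_iter_ad_lt hk hj lk lj rj jk).
    rewrite prC; [exact: (pr_iter_ad_lt hj hk lj lk rk jk)|exact: span_hom (hv k)|].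
    exact: span_hom (ad_iter_hom i j hj).
  have [hk lk rk] := hu k; have [hj lj rj] := hc' k.
  have uk : u k != 0.
    by apply: contraNneq vk => ->; rewrite adS_iter0.
  (* The highest weight vector [u k] is zero unless [k >= H i mu]. As [H i mu > 0], this gives
     [k > 0], so that induction applies to [u k], and it is also the bound that [pr_iter_ad] asks
     for. *)
  have kH : 0 <= 0 - H i mu + k%:Z.
    by rewrite leNgt; apply: contra uk => /un ->.
  rewrite /herm (cjad k _ _ hk).
  have [|c' pc' ->] := pr_iter_ad (k := k) hk hj lk lj rj.
    by rewrite cpair_sub_alpha; lia.
  apply: (posM PC) => //; apply: low hk uk; lia.
have [p lx] : exists p, iter p (lder i) x = 0.
  exists (`|mu i|%N.+1); apply: iter_der_eq0 (fun k => iter_lder_hom i k hx) _; lia.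
have [xs [hxs lxs ex]] := left_expansion hx lx; move: x0; rewrite ex.
have hv k : hom mu (F i ^+ k * xs k).
  by have := homM (homX k (hom_gen F i)) (hxs k); rewrite addrC subrK.
have cjF k y : shcj cj (F i ^+ k * y) = F i ^+ k * shcj cj y.
  by rewrite (shcjM PD) (shcjX PD) (shcjF PD).
have lc k : lder i (shcj cj (xs k)) = 0 by rewrite lder_shcj lxs (shcj0 PD).
have s1 k : span (xs k) by apply: span_hom (hxs k).
have s2 k : span (shcj cj (xs k)) by apply: span_hom (shcj_hom PD (hxs k)).
apply: (@herm_orth_pos mu p (fun k => F i ^+ k * xs k)) => // [k j kj|k vk].
  by rewrite cjF (pr_FX k j (s1 k) (s2 j) (lxs k) (lc j)).1.
case: k vk => [|k] vk.
  by apply: ker0 => //; rewrite expr0 mul1r.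
have xk : xs k.+1 != 0 by apply: contraNneq vk => ->; rewrite mulr0.
have [_ [c pc hc]] := pr_FX k.+1 k.+1 (s1 k.+1) (s2 k.+1) (lxs k.+1) (lc k.+1).
by rewrite /herm cjF hc; apply: (posM PC) => //; apply: low (hxs k.+1) xk.
Qed.

End Positive.

(** * Weights in commutative parabolic type *)

(* The combinatorial content of "commutative parabolic type": [Pcl] is the set
   of the roots in which alpha_i0 has coefficient 1. *)
Record commutative_datum (K : fieldType) (n : nat) (Q : qdatum K n) (i0 : 'I_n)
    (Pcl : weight n -> Prop) : Prop := {
  cd_alpha : Pcl (alpha i0);
  cd_string : forall i mu (p : nat), i != i0 -> Pcl mu ->
    cpair (qa Q) i mu <= - p%:Z -> Pcl (mu + alpha i *+ p);
  cd_ge0 : forall mu, Pcl mu -> 0 <= cpair (qa Q) i0 mu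
}.

Section Positive.
Context (K : fieldType) (n : nat) (Q : qdatum K n).
Notation t := (qt Q).
Notation a := (qa Q).
Notation sh := (qshuffle (qP Q)).
Notation F := (@Fsh K n (qP Q)).
Notation hom := (hom F).
Notation span := (span F).
Notation H := (cpair a).
Notation ad := (adS 0).
Implicit Types (x y z : sh) (mu nu : weight n).
Context (pos : K -> Prop) (cj : K -> K).
Hypothesis PD : positive_datum Q pos cj.

Context (i0 : 'I_n) (Pcl : weight n -> Prop).
Hypothesis CD : commutative_datum Q i0 Pcl.

Let ad0 i : ad i (0 : sh) = 0.
Proof. exact: (adS_iter0 Q 0 i 1). Qed.

(** The image of the degree one part of [U_q(n_I^-)], generated from its highest weight vector
    [F i0] by the [ad(F_j)] with [j <> i0]. *)
Inductive V1 : weight n -> sh -> Prop :=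
| V1_0 mu : V1 mu 0
| V1_gen : V1 (alpha i0) (F i0)
| V1_ad j mu x : j != i0 -> V1 mu x -> V1 (mu + alpha j) (ad j x)
| V1_lin mu c x y : V1 mu x -> V1 mu y -> V1 mu (c *: x + y).

Lemma V1_hom mu x : V1 mu x -> hom mu x.
Proof.
elim=> [nu||j nu y _ _ hy|nu c y z _ hy _ hz]; first exact: hom0.
- exact: hom_gen.
- exact: adS_hom.
exact: homL.
Qed.

Lemma V1_lder i mu x : i != i0 -> V1 mu x -> lder i x = 0.
Proof.
move=> ii; elim=> [nu||j nu y ji hy IH|nu c y z _ hy _ hz] //.
- by rewrite lderF (negPf ii) scale0r.
- have [ij|ij] := eqVneq i j; last exact: lder_ad_neq ij (V1_hom hy) IH.
  by rewrite -ij in ji *; apply: lder_ad (V1_hom hy) IH.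
by rewrite lderD lderZ hy hz scaler0 addr0.
Qed.

Lemma V1_rder i mu x : i != i0 -> V1 mu x -> V1 (mu - alpha i) (rder i x).
Proof.
move=> ii; elim=> [nu||j nu y ji hy IH|nu c y z _ hy _ hz].
- exact: V1_0.
- by rewrite rderF (negPf ii) scale0r; apply: V1_0.
- have [ij|ij] := eqVneq i j.
    rewrite -ij (rder_adS 0 i (V1_hom hy)) addrK addrC; apply: V1_lin => //.
    by rewrite -[nu](subrK (alpha i)); apply: V1_ad.
  by rewrite (rder_ad_neq ij (V1_hom hy)) addrAC; apply: V1_ad.
exact: V1_lin.
Qed.

Lemma V1_iter_rder i k mu x : i != i0 -> V1 mu x ->
  V1 (mu - alpha i *+ k) (iter k (rder i) x).
Proof.
move=> ii hx; elim: k => [|k IH]; first by rewrite subr0.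
by rewrite mulrSr opprD addrA; apply: V1_rder.
Qed.

Lemma V1_last mu x : V1 mu x -> x != 0 -> mu = alpha i0 \/
  exists j y, [/\ j != i0, V1 (mu - alpha j) y & ad j y != 0].
Proof.
elim=> [nu||j nu y ji hy IH|nu c y z _ hy _ hz].
- by rewrite eqxx.
- by left.
- by move=> h; right; exists j, y; rewrite addrK.
have [->|y0] := eqVneq y 0; last by move=> _; apply: hy.
by rewrite scaler0 add0r; apply: hz.
Qed.

(** Going down from [mu] along [alpha j], let [p] be a step after which the string breaks off. By
    [string_bound], [H j mu <= p], so [H j] is at most [- p] at the lower end. That end is in [Pcl]
    by induction, and [cd_string] climbs back to [mu]. *)
Lemma V1_Pcl mu x : V1 mu x -> x != 0 -> Pcl mu.
Proof.
move=> hx x0; have [N] := ubnP `|height mu|%N.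
elim: N mu x hx x0 => // N IH mu x hx x0 hN.
have [->|[j [y [ji hy yn0]]]] := V1_last hx x0; first exact: cd_alpha CD.
pose S p := exists2 z, V1 (mu - alpha j *+ p) z & z != 0.
have S1 : S 1%N.
  exists y; first by rewrite mulr1n.
  by apply: contraNneq yn0 => ->; rewrite ad0.
have Sb p : S p -> p%:Z <= mu j.
  move=> [z hz z0]; have := hom_coord_ge0 j (V1_hom hz) z0.
  by rewrite !ffunE ffunMnE ffunE eqxx -[true%:R *+ p]/(p%:R) natz subr_ge0.
have [p [p1 Sp Sn]] : exists p, [/\ (0 < p)%N, S p & ~ S p.+1].
  apply: contrapT => h; have hS p : S p.+1.
    elim: p => [|p IHp] //; apply: contrapT => hn.
    by apply: h; exists p.+1.
  by have := Sb _ (hS `|mu j|%N); lia.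
have hmu : V1 mu (ad j y) by rewrite -[mu](subrK (alpha j)); apply: V1_ad.
have [z hz z0] := Sp.
have Pz : Pcl (mu - alpha j *+ p).
  apply: (IH _ _ hz z0); have := hom_height_ge0 (V1_hom hz) z0.
  have := hom_height_ge0 (V1_hom hx) x0; move: hN; rewrite height_sub; lia.
have hb : H j mu <= p%:Z.
  rewrite leNgt; apply: contra yn0 => hp; apply/eqP.
  apply: (string_bound (pd_integrable PD) (s := 0) (u := p) (V1_hom hmu)) => //.
    exact: (V1_lder ji hmu).
    apply: contrapT => h; apply: Sn; exists (iter p.+1 (rder j) (ad j y)).
      exact: V1_iter_rder.
    exact/eqP.
  by rewrite add0n.
rewrite -[mu](subrK (alpha j *+ p)); apply: (cd_string CD ji Pz).
by rewrite cpair_sub_alpha; lia.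
Qed.

Inductive Nil : weight n -> sh -> Prop :=
| Nil_0 mu : Nil mu 0
| Nil_1 : Nil 0 1
| Nil_mul mu nu x y : V1 mu x -> Nil nu y -> Nil (mu + nu) (x * y)
| Nil_lin mu c x y : Nil mu x -> Nil mu y -> Nil mu (c *: x + y).

Lemma Nil_hom mu x : Nil mu x -> hom mu x.
Proof.
elim=> [nu||nu la y z hy _ hz|nu c y z _ hy _ hz].
- exact: hom0.
- exact: hom1.
- exact: homM (V1_hom hy) hz.
exact: homL.
Qed.

Lemma Nil_ad j mu x : j != i0 -> Nil mu x -> Nil (mu + alpha j) (ad j x).
Proof.
move=> ji; elim=> [nu||nu la y z hy hz IH|nu c y z _ hy _ hz].
- by rewrite ad0; apply: Nil_0.
- by rewrite adS1; apply: Nil_0.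
- rewrite (adS0M _ _ (V1_hom hy)) [X in Nil _ X]addrC; apply: Nil_lin.
    by rewrite -addrA; apply: Nil_mul.
  by rewrite addrAC; apply: Nil_mul => //; apply: V1_ad.
by rewrite adS_linear; apply: Nil_lin.
Qed.

Lemma Nil_ge0 mu x : Nil mu x -> x != 0 -> 0 <= H i0 mu.
Proof.
elim=> [nu||nu la y z hy hz IH|nu c y z _ hy _ hz].
- by rewrite eqxx.
- by rewrite cpair0.
- have [->|y0] := eqVneq y 0; first by rewrite mul0r eqxx.
  have [->|z0] := eqVneq z 0; first by rewrite mulr0 eqxx.
  by move=> _; rewrite cpairD addr_ge0 ?IH //; apply: cd_ge0 CD _ (V1_Pcl hy y0).
have [->|y0] := eqVneq y 0; last by move=> _; apply: hy.
by rewrite scaler0 add0r; apply: hz.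
Qed.

(** The subalgebra generated by [V1] is a complement in spirit to the left ideals of the [F_i],
    [i <> i0]: such an [F_j] moves to the right past an element of [Nil], and what remains is [ad j]
    of it, again in [Nil]. *)
Lemma Nil_decomp mu x : hom mu x -> exists y (zs : 'I_n -> sh),
  [/\ Nil mu y, forall i, hom (mu - alpha i) (zs i)
    & x = y + \sum_(i | i != i0) zs i * F i].
Proof.
elim/hom_lin_ind => [|c y z [y1 [zs1 [h1 k1 ->]]] [y2 [zs2 [h2 k2 ->]]]|w <-].
- exists 0, (fun=> 0); split=> [|i|]; [exact: Nil_0|exact: hom0|].
  by rewrite big1 ?addr0 // => i _; rewrite mul0r.
- exists (c *: y1 + y2), (fun i => c *: zs1 i + zs2 i); split=> [|i|].
  + exact: Nil_lin.
  + exact: homL.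
  rewrite scalerDr addrACA scaler_sumr -big_split; congr (_ + _).
  by apply: eq_bigr => i _; rewrite mulrDl scalerAl.
elim: w => [|j w [y [zs [hy hzs ew]]]].
  rewrite wmon_nil wt_nil; exists 1, (fun=> 0); split=> [|i|].
  - exact: Nil_1.
  - exact: hom0.
  by rewrite big1 ?addr0 // => i _; rewrite mul0r.
rewrite wmon_cons ew mulrDr mulr_sumr wt_cons; have [->|ji] := eqVneq j i0.
  exists (F i0 * y), (fun i => F i0 * zs i); split=> [|i|].
  - by apply: Nil_mul => //; apply: V1_gen.
  - by rewrite -addrA; apply: homM => //; apply: hom_gen.
  by congr (_ + _); apply: eq_bigr => i _; rewrite mulrA.
exists (ad j y), (fun i => F j * zs i + (i == j)%:R *: (t j ^ (- H j (wt w)) *: y)).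
split=> [|i|].
- by rewrite addrC; apply: Nil_ad.
- apply: homD; first by rewrite -addrA; apply: homM => //; apply: hom_gen.
  have [->|_] := eqVneq i j; last by rewrite scale0r; apply: hom0.
  by rewrite scale1r addrAC subrr add0r; apply: homZ; apply: Nil_hom.
have -> : F j * y = ad j y + t j ^ (- H j (wt w)) *: (y * F j).
  by rewrite (adSE 0 j (Nil_hom hy)) mul0rn add0r subrK.
rewrite -addrA; congr (_ + _).
under [RHS]eq_bigr do rewrite mulrDl -mulrA; rewrite big_split addrC; congr (_ + _).
rewrite (bigD1 j) //= eqxx scale1r scalerAl big1 ?addr0 // => i /andP[_ ij].
by rewrite (negPf ij) scale0r mul0r.
Qed.

(* [y] is orthogonal to the left ideals generated by the F_i, i <> i0, so it
   pairs nontrivially with the subalgebra generated by [V1], and its weight is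
   one of this subalgebra. *)
Lemma rder_ker_ge0 mu y : hom mu y -> (forall i, i != i0 -> rder i y = 0) ->
  y != 0 -> 0 <= H i0 mu.
Proof.
move=> hy ry y0; have [w hw yw] := shom_neq0 hy y0; have sy := span_hom hy.
have [z [zs [hz hzs ez]]] := Nil_decomp (hom_mon F w); rewrite hw in hz hzs.
apply: (Nil_ge0 hz); apply: contraNneq yw => z0.
rewrite -pr_mon // ez z0 add0r; apply/eqP; rewrite prC //; last first.
  elim/big_rec: _ => [|i u ii hu]; first exact: span0.
  rewrite -[X in X + _]scale1r; apply: spanL => //.
  by apply: spanM; [apply: span_hom (hzs i)|apply: span_gen].
rewrite -big_filter pr_sumr big_seq big1 // => i.
rewrite mem_filter => /andP[ii _].
have s1 : span (zs i) by apply: span_hom (hzs i).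
rewrite prC //; last by apply: spanM => //; apply: span_gen.
by rewrite prFr // ry // pr0r.
Qed.

Lemma lder_ker_ge0 mu y : hom mu y -> (forall i, i != i0 -> lder i y = 0) ->
  y != 0 -> 0 <= H i0 mu.
Proof.
move=> hy ly y0; apply: (@rder_ker_ge0 mu (shrev y)); first exact: shrev_hom.
  by move=> i ii; rewrite rder_shrev ly.
apply: contraNneq y0 => y0; rewrite -(shrevK y) y0; exact/eqP.
Qed.

End Positive.

(** * Centrality and uniqueness of the elements of Z_s *)

Section Positive.
Context (K : fieldType) (n : nat) (Q : qdatum K n).
Notation t := (qt Q).
Notation a := (qa Q).
Notation sh := (qshuffle (qP Q)).
Notation F := (@Fsh K n (qP Q)).
Notation hom := (hom F).
Notation span := (span F).
Notation H := (cpair a).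
Implicit Types (x y z : sh) (mu nu : weight n).
Context (pos : K -> Prop) (cj : K -> K).
Hypothesis PD : positive_datum Q pos cj.

Context (i0 : 'I_n) (Pcl : weight n -> Prop).
Hypothesis CD : commutative_datum Q i0 Pcl.
Context (c0 : weight n).
Hypothesis c0E : forall i, H i c0 = (i == i0)%:Z *+ 2.

(** By [c0E], [c0] is [2 varpi_i0] in the coordinates of the simple roots. *)
Definition Zs (s : nat) z : Prop :=
  hom (c0 *+ s) z /\ forall i, i != i0 -> lder i z = 0 /\ rder i z = 0.

Lemma Zs_hom s z : Zs s z -> hom (c0 *+ s) z. Proof. by case. Qed.

Lemma ZsM s s' y z : Zs s y -> Zs s' z -> Zs (s + s') (y * z).
Proof.
move=> [hy ky] [hz kz]; split=> [|i ii]; first by rewrite mulrnDr; apply: homM.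
have [ly ry] := ky i ii; have [lz rz] := kz i ii.
rewrite lderM rderM; last exact: qt_sym.
by rewrite ly ry lz rz !mul0r !mulr0 addr0.
Qed.

Lemma Zs1 : Zs 0 1.
Proof.
split=> [|i _]; first exact: hom1.
by rewrite lder1 rder1.
Qed.

Lemma ZsX z k : Zs 1 z -> Zs k (z ^+ k).
Proof.
move=> hz; elim: k => [|k IH]; first exact: Zs1.
by rewrite exprS -add1n; apply: ZsM.
Qed.

Lemma Zs_shrev s z : Zs s z -> Zs s (shrev z).
Proof.
move=> [hz kz]; split=> [|i ii]; first exact: shrev_hom.
by have [lz rz] := kz i ii; rewrite lder_shrev rder_shrev lz rz.
Qed.

Lemma Zs_shcj s z : Zs s z -> Zs s (shcj cj z).
Proof.
move=> [hz kz]; split=> [|i ii]; first exact: (shcj_hom PD hz).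
by have [lz rz] := kz i ii; rewrite lder_shcj rder_shcj lz rz (shcj0 PD).
Qed.

Let cpair_c0 i s : H i (c0 *+ s) = (i == i0)%:Z * (s%:Z *+ 2).
Proof. by rewrite cpairMn c0E; case: eqP => _; lia. Qed.

(** Left and right derivations commute, so [l_i0^(s+1) z] is still killed by the [r_i], [i <> i0].
    Its weight has the value [2s - 2(s+1) < 0] under [H i0], which [rder_ker_ge0] forbids; the other
    side is symmetric. *)
Lemma Zs_depth s z : Zs s z ->
  iter s.+1 (lder i0) z = 0 /\ iter s.+1 (rder i0) z = 0.
Proof.
move=> [hz kz].
have neg : H i0 (c0 *+ s - alpha i0 *+ s.+1) < 0.
  by rewrite cpair_sub_alpha cpair_c0 eqxx; lia.
split; apply: contrapT => /eqP nz.
  have := rder_ker_ge0 PD CD (iter_lder_hom i0 s.+1 hz) _ nz.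
  rewrite leNgt neg => h; apply/notF/h => i ii.
  have [_ rz] := kz i ii; elim: (s.+1) => [|m IH] //.
  by rewrite iterS -lrderC IH.
have := lder_ker_ge0 PD CD (iter_rder_hom i0 s.+1 hz) _ nz.
rewrite leNgt neg => h; apply/notF/h => i ii.
have [lz _] := kz i ii; elim: (s.+1) => [|m IH] //.
by rewrite iterS lrderC IH.
Qed.

(** The weight of [z] has the value [s + s] under [H i0] and [0 + 0] under the other [H i]. Both are
    the boundary case of [string_commute] with equal depths on the two sides, hence with scalar
    1. *)
Lemma Zs_commF s z i : Zs s z -> F i * z = z * F i.
Proof.
move=> hz; have [ls rs] := Zs_depth hz; have [hh kz] := hz.
have [->|ii] := eqVneq i i0.
  rewrite (string_commute (pd_integrable PD) hh ls rs); last first.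
    by rewrite cpair_c0 eqxx; lia.
  by rewrite subrr expr0z scale1r.
have [lz rz] := kz i ii.
rewrite (string_commute (pd_integrable PD) (s := 0) (u := 0) hh lz rz).
  by rewrite subrr expr0z scale1r.
by rewrite cpair_c0 (negPf ii) mul0r.
Qed.

Lemma Zs_comm s z x : Zs s z -> span x -> x * z = z * x.
Proof.
move=> hz; elim/span_lin_ind => [|b y y' h h'|w].
- by rewrite mul0r mulr0.
- by rewrite mulrDl mulrDr -scalerAl -scalerAr h h'.
elim: w => [|i w IH]; first by rewrite wmon_nil mul1r mulr1.
by rewrite wmon_cons -mulrA IH !mulrA (Zs_commF _ hz).
Qed.

Lemma hom_mulIr mu nu x y z : hom mu x -> hom mu y -> hom nu z -> z != 0 ->
  x * z = y * z -> x = y.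
Proof.
move=> hx hy hz z0 e; apply/eqP; rewrite -subr_eq0; apply/eqP.
apply: contrapT => /eqP d0; have := hom_mul_neq0 PD (homB hx hy) hz d0 z0.
by rewrite mulrBl e subrr eqxx.
Qed.

(** Apply [l_i0] to [z u = u z] and collect, using centrality: the difference of the two sides of
    the claim is multiplied by [t^(2s) - 1], which is not zero for [s > 0]. *)
Lemma Zs_lderM s z u : (0 < s)%N -> Zs s z -> Zs s u ->
  lder i0 z * u = lder i0 u * z.
Proof.
move=> s0 hz hu; have [hhz _] := hz; have [hhu _] := hu.
have sl y : Zs s y -> span (lder i0 y) by move=> [hy _]; apply: span_hom (lder_hom i0 hy).
have := congr1 (@lder _ _ _ i0) (Zs_comm hu (span_hom hhz)).
rewrite !lderM (twist_hom _ hhz) (twist_hom _ hhu) -!scalerAl.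
rewrite -(Zs_comm hz (sl u hu)) -(Zs_comm hu (sl z hz)) cpair_c0 eqxx mul1r.
move=> e; have {e} : (t i0 ^ (s%:Z *+ 2) - 1) *: (lder i0 u * z - lder i0 z * u) = 0.
  move/eqP: e; rewrite -subr_eq0 => /eqP <-.
  rewrite scalerBl scale1r !scalerBr opprB opprD.
  by rewrite [LHS](AC (2*2) ((3*1)*(4*2))).
have s2 : s%:Z *+ 2 != 0 by lia.
move/eqP; rewrite scaler_eq0 subr_eq0 (negPf (qt_generic Q i0 s2)) /=.
by rewrite subr_eq0 eq_sym => /eqP.
Qed.

(* A relation [x z = x' u] descends along every left derivative of [x], down to
   weight 0, where it says that [z] and [u] are proportional. *)
Lemma Zs_uniq s z u : Zs s z -> Zs s u -> u != 0 -> exists k, z = k *: u.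
Proof.
move=> hz hu u0; have [hhz kz] := hz; have [hhu ku] := hu.
have [s0|s_gt0] := posnP s.
  rewrite s0 mulr0n in hhz hhu.
  have [a1 ez] := hom_weight0 hhz; have [b1 eu] := hom_weight0 hhu.
  have b10 : b1 != 0 by apply: contraNneq u0 => b0; rewrite eu b0 scale0r.
  by exists (a1 / b1); rewrite ez eu scalerA divfK.
suff desc N nu x x' : (`|height nu| < N)%N -> hom nu x -> hom nu x' -> x != 0 ->
    x * z = x' * u -> exists k, z = k *: u.
  apply: (desc _ _ u z (ltnSn _) hhu hhz u0).
  exact/esym/(Zs_comm hu (span_hom hhz)).
elim: N nu x x' => // N IH nu x x' hN hx hx' x0 e.
have [nu0|nu0] := eqVneq nu 0.
  rewrite nu0 in hx hx'.
  have [a1 ex] := hom_weight0 hx; have [b1 ex'] := hom_weight0 hx'.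
  have a0 : a1 != 0 by apply: contraNneq x0 => a0; rewrite ex a0 scale0r.
  exists (a1^-1 * b1); apply: (scalerI a0); rewrite !scalerA mulVKf //.
  by move: e; rewrite ex ex' -!scalerAl !mul1r.
have [j lj] : exists j, lder j x != 0.
  apply: contrapT => h; case/eqP: x0; apply: shom_lder_eq0 hx nu0 _ => i.
  by apply: contrapT => /eqP hi; apply: h; exists i.
have hlx := lder_hom j hx; have hlx' := lder_hom j hx'.
apply: (IH (nu - alpha j) (lder j x) (lder j x')) => //.
  have := hom_height_ge0 hlx lj; move: hN.
  by rewrite heightD heightN height_alpha; lia.
have := congr1 (@lder _ _ _ j) e; rewrite !lderM.
have [ji|ji] := eqVneq j i0; last first.
  have [-> _] := kz j ji; have [-> _] := ku j ji.
  by rewrite !mulr0 !addr0.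
rewrite (twist_hom _ hx) (twist_hom _ hx') -!scalerAl {hlx hlx' lj}ji.
have hlz := lder_hom i0 hhz; have hlu := lder_hom i0 hhu.
(* After multiplication by [u] the two sides agree by [Zs_lderM], centrality and [x z = x' u]; then
   [u] is cancelled. *)
suff -> : x * lder i0 z = x' * lder i0 u by move/addIr.
apply: (hom_mulIr (homM hx hlz) (homM hx' hlu) hhu u0).
rewrite -!mulrA (Zs_lderM s_gt0 hz hu) (Zs_comm hz (span_hom hlu)) mulrA e.
by rewrite -mulrA (Zs_comm hu (span_hom hlu)).
Qed.

End Positive.

(** * Families polynomial in q_i0^k, and the scalars in the shuffle algebra *)

Definition polyfam (K : fieldType) (n : nat) (Q : qdatum K n) (mu : weight n)
    (Y : K -> qshuffle (qP Q)) : Prop :=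
  exists2 s : seq ({poly K} * qshuffle (qP Q)),
    (forall p, p \in s -> hom (@Fsh K n (qP Q)) mu p.2)
    & forall b, Y b = \sum_(p <- s) p.1.[b] *: p.2.

Section Positive.
Context (K : fieldType) (n : nat) (Q : qdatum K n).
Notation t := (qt Q).
Notation a := (qa Q).
Notation sh := (qshuffle (qP Q)).
Notation F := (@Fsh K n (qP Q)).
Notation hom := (hom F).
Notation span := (span F).
Notation H := (cpair a).
Implicit Types (x y z : sh) (mu nu : weight n).
Context (pos : K -> Prop) (cj : K -> K).
Hypothesis PD : positive_datum Q pos cj.
Let PC := pd_cone PD.

Let t0 := qt_neq0 Q.
Let tD i (m k : int) : t i ^ (m + k) = t i ^ m * t i ^ k.
Proof. by rewrite expfzDr ?t0. Qed.

Lemma polyfam_cst mu x : hom mu x -> polyfam mu (fun=> x).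
Proof.
move=> hx; exists [:: (1, x)] => [p|b]; first by rewrite inE => /eqP ->.
by rewrite big_seq1 hornerC scale1r.
Qed.

Lemma polyfamD mu (Y Z : K -> sh) : polyfam mu Y -> polyfam mu Z ->
  polyfam mu (fun b => Y b + Z b).
Proof.
move=> [s hs eY] [s' hs' eZ]; exists (s ++ s') => [p|b].
  by rewrite mem_cat => /orP[/hs|/hs'].
by rewrite eY eZ big_cat.
Qed.

Lemma polyfam_scale mu (p : {poly K}) (Y : K -> sh) : polyfam mu Y ->
  polyfam mu (fun b => p.[b] *: Y b).
Proof.
move=> [s hs eY]; exists [seq (p * r.1, r.2) | r <- s] => [r /mapP[r' rs ->]|b].
  exact: (hs r').
rewrite eY big_map scaler_sumr; apply: eq_bigr => r _.
by rewrite hornerM scalerA.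
Qed.

Lemma polyfam_map mu nu (L : sh -> sh) (Y : K -> sh) : linear L ->
  (forall x, hom mu x -> hom nu (L x)) -> polyfam mu Y ->
  polyfam nu (fun b => L (Y b)).
Proof.
move=> lL hL [s hs eY]; exists [seq (r.1, L r.2) | r <- s] => [r /mapP[r' rs ->]|b].
  by apply: hL; apply: (hs r').
have L0 : L 0 = 0.
  by have := lL (-1) 0 0; rewrite scaleN1r oppr0 addr0 scaleN1r addNr.
rewrite eY big_map; elim: {hs eY} s => [|r s IH]; first by rewrite !big_nil.
by rewrite !big_cons lL IH.
Qed.

Lemma polyfam_hom mu (Y : K -> sh) b : polyfam mu Y -> hom mu (Y b).
Proof.
move=> [s hs ->]; rewrite big_seq; apply: hom_sum => p ps.
by apply: homZ; apply: hs.
Qed.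

Lemma polyfam_eval mu (Y : K -> sh) w : polyfam mu Y ->
  exists p : {poly K}, forall b, Y b w = p.[b].
Proof.
move=> [s _ eY]; exists (\sum_(r <- s) r.2 w *: r.1) => b.
rewrite eY shuf_sum horner_sum; apply: eq_bigr => r _.
by rewrite shufZ hornerZ mulrC.
Qed.

Definition rcut (w : seq 'I_n) x : sh := fun u => x (u ++ w).

Lemma rcut_cons i w x : rcut (i :: w) x = rder i (rcut w x).
Proof. by apply/funext => u; rewrite /rcut /rder cat_rcons. Qed.

Lemma rcut_hom mu w x : hom mu x -> hom (mu - wt w) (rcut w x).
Proof.
move=> hx; elim: w => [|i w IH].
  rewrite wt_nil subr0; have -> : rcut [::] x = x.
    by apply/funext => u; rewrite /rcut cats0.
  exact: hx.
by rewrite rcut_cons wt_cons opprD addrA addrAC; apply: rder_hom.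
Qed.

Context (i0 : 'I_n) (Pcl : weight n -> Prop).
Hypothesis CD : commutative_datum Q i0 Pcl.
Context (c0 : weight n).
Hypothesis c0E : forall i, H i c0 = (i == i0)%:Z *+ 2.
Context (phi : sh).
Hypothesis phiZ : Zs i0 c0 1 phi.
Hypothesis phi0 : phi != 0.

Let phiX k := ZsX k phiZ.
Let phiXh k := Zs_hom (phiX k).
Let phi_comm k x : span x -> x * phi ^+ k = phi ^+ k * x.
Proof. by move=> hx; rewrite (Zs_comm PD CD c0E (phiX k) hx). Qed.
Let phi_comm1 x : span x -> x * phi = phi * x.
Proof. by move=> hx; rewrite -[phi]expr1 phi_comm. Qed.
Let gder := rder i0 phi.
Let gh : hom (c0 - alpha i0) gder.
Proof. by have [h _] := phiZ; apply: rder_hom. Qed.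
Let cpair_c0 s : H i0 (c0 *+ s) = s%:Z *+ 2.
Proof. by rewrite cpairMn c0E eqxx; lia. Qed.

Let rder_phiX i k : i != i0 -> rder i (phi ^+ k) = 0.
Proof. by move=> ii; have [_ h] := phiX k; have [] := h i ii. Qed.

(** The extra factor [phi] replaces the power [phi^(k-1)]. This keeps the formula uniform down to
    [k = 0], and besides [phi^k] only [qn k] depends on [k], which is affine in [t^(2k)]. *)
Lemma phi_rderX k : phi * rder i0 (phi ^+ k) = qn Q i0 k *: (gder * phi ^+ k).
Proof.
elim: k => [|k IH].
  by rewrite expr0 rder1 mulr0 /qn big_ord0 scale0r.
rewrite exprS rderM; last exact: qt_sym.
rewrite (twist_hom _ (phiXh k)) cpair_c0 mulrDr -scalerAr IH -/gder -!scalerAr.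
rewrite !mulrA -(phi_comm1 (span_hom gh)) -scalerDl addrC.
by rewrite /qn big_ord_recr.
Qed.

Let sphi k : span (phi ^+ k). Proof. exact: span_hom (phiXh k). Qed.

(** Each letter costs one factor [phi]. For [i <> i0] the derivation kills all powers of [phi]. For
    [i0] the Leibniz rule brings in [k] only through [qn k] and through the twist of
    [rcut w (phi ^+ k)], both polynomial in [t^k]. *)
Lemma polyfam_word w : exists2 Y : K -> sh,
  polyfam (c0 *+ size w - wt w) Y &
  forall k, phi ^+ size w * rcut w (phi ^+ k) = phi ^+ k * Y (t i0 ^ k%:Z).
Proof.
elim: w => [|i w [Y hY eY]].
  exists (fun=> 1); first by rewrite wt_nil subr0 mulr0n; apply/polyfam_cst/hom1.
  by move=> k; rewrite mul1r mulr1; apply/funext => u; rewrite /rcut cats0.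
set N := size w in hY eY *; set mu := c0 *+ N - wt w in hY.
have wE : c0 *+ size (i :: w) - wt (i :: w) = c0 + mu - alpha i.
  by rewrite mulrS wt_cons /mu opprD [- _ - _]addrC !addrA.
have rY : polyfam (c0 + mu - alpha i) (fun b => phi * rder i (Y b)).
  apply: (polyfam_map (mu := mu) (L := fun x => phi * rder i x)) hY.
    by move=> b x y; rewrite rderD rderZ mulrDr scalerAr.
  move=> x hx; rewrite -addrA; apply: homM (rder_hom i hx).
  by have [h _] := phiZ.
have [ii|ii] := eqVneq i i0; last first.
  exists (fun b => phi * rder i (Y b)) => [|k]; first by rewrite wE.
  rewrite rcut_cons exprS -mulrA.
  have -> : phi ^+ N * rder i (rcut w (phi ^+ k)) = rder i (phi ^+ N * rcut w (phi ^+ k)).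
    by rewrite [RHS]rderM ?rder_phiX ?mul0r ?add0r //; apply: qt_sym.
  rewrite eY rderM ?rder_phiX ?mul0r ?add0r //; last exact: qt_sym.
  by rewrite mulrA -exprS exprSr mulrA.
rewrite ii in wE rY *.
pose m1 := H i0 mu; pose m2 := - H i0 (wt w).
(* [p1] is [qn k * t^m1] with [X] for [t^k], by [qnE]. [p2] removes the derivative that falls on the
   auxiliary [phi^N]; its [X^2] is the [t^(2k)] of the twist. *)
pose p1 : {poly K} := ((t i0 ^ 2 - 1)^-1 * t i0 ^ m1) *: ('X ^+ 2 - 1).
pose p2 : {poly K} := - (qn Q i0 N * t i0 ^ m2) *: 'X ^+ 2.
have gY : polyfam (c0 + mu - alpha i0) (fun b => gder * Y b).
  apply: (polyfam_map (mu := mu) (L := fun x => gder * x)) hY.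
    by move=> b x y; rewrite mulrDr scalerAr.
  by move=> x hx; rewrite addrAC; apply: homM.
exists (fun b => phi * rder i0 (Y b) + (p1 + p2).[b] *: (gder * Y b)) => [|k].
  by rewrite wE; apply: polyfamD => //; apply: polyfam_scale.
set b := t i0 ^ k%:Z; have hYb := polyfam_hom b hY.
have tb : t i0 ^ (k%:Z *+ 2) = b ^+ 2 by rewrite expr2 -tD.
rewrite rcut_cons; set x := rcut w (phi ^+ k).
have hx : hom (c0 *+ k - wt w) x by apply: rcut_hom.
have eYk : phi ^+ N * x = phi ^+ k * Y b := eY k.
have e1 : phi ^+ N.+1 * rder i0 x
    = phi * rder i0 (phi ^+ N * x) - phi * rder i0 (phi ^+ N) * twist i0 x.
  rewrite rderM; last exact: qt_sym.
  by rewrite mulrDr mulrA addrAC subrr add0r exprS mulrA.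
have e2 : phi * rder i0 (phi ^+ k * Y b)
    = phi ^+ k * ((qn Q i0 k * t i0 ^ m1) *: (gder * Y b) + phi * rder i0 (Y b)).
  rewrite rderM; last exact: qt_sym.
  rewrite (twist_hom _ hYb) mulrDr mulrA phi_rderX -scalerAl -scalerAr scalerA.
  rewrite mulrDr -scalerAr !mulrA -exprS -exprSr; congr (_ *: _ + _).
  by rewrite -mulrA -/b mulrA (phi_comm k (span_hom gh)).
have e3 : phi * rder i0 (phi ^+ N) * twist i0 x
    = (qn Q i0 N * t i0 ^ m2 * b ^+ 2) *: (phi ^+ k * (gder * Y b)).
  rewrite phi_rderX (twist_hom _ hx) -scalerAl -scalerAr scalerA -[gder * _ * x]mulrA eYk.
  rewrite mulrA (phi_comm k (span_hom gh)) mulrA; congr (_ *: _).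
  by rewrite cpairD cpairN cpair_c0 tD tb -/m2 mulrA mulrAC.
rewrite /= e1 eYk e2 e3 [_ *: (phi ^+ k * _)]scalerAr -mulrBr; congr (_ * _).
rewrite addrAC -scalerBl addrC; congr (_ + _ *: _).
have -> : qn Q i0 k = (t i0 ^ 2 - 1)^-1 * (b ^+ 2 - 1).
  by rewrite -tb -qnE mulKf // t2_neq1.
rewrite hornerD /p1 /p2 !hornerZ hornerD hornerN !hornerXn hornerC; ring.
Qed.

Let psi := shrev phi.
Let psiZ : Zs i0 c0 1 psi. Proof. exact: Zs_shrev phiZ. Qed.

Lemma psi_list : exists2 s, (forall p, p \in s -> wt p.2 = c0) & psi = lincomb F s.
Proof. by have [s hs e] := Zs_hom psiZ; exists s. Qed.

(* The adjoint, for [pr], of the right multiplication by [psi]. *)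
Definition adjpsi x : sh := fun u => pr (wmon F u * psi) x.

Lemma adjpsiE s x : psi = lincomb F s -> span x ->
  adjpsi x = \sum_(p <- s) p.1 *: rcut p.2 x.
Proof.
move=> es hx; apply/funext => u; rewrite /adjpsi es shuf_sum.
have -> : wmon F u * lincomb F s = lincomb F [seq (p.1, u ++ p.2) | p <- s].
  rewrite /lincomb mulr_sumr big_map; apply: eq_bigr => p _.
  by rewrite -scalerAr wmon_cat.
by rewrite pr_lincomb // /evalw big_map.
Qed.

Lemma pr_psi x y : span x -> span y -> pr (x * psi) y = pr x (adjpsi y).
Proof.
move=> [s ->] hy; have [r hr er] := psi_list.
have e : lincomb F s * psi
    = lincomb F (flatten [seq [seq (p.1 * p'.1, p.2 ++ p'.2) | p' <- r] | p <- s]).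
  rewrite er /lincomb mulr_suml big_flatten big_map; apply: eq_bigr => p _.
  rewrite big_map mulr_sumr; apply: eq_bigr => p' _.
  by rewrite -scalerAl -scalerAr scalerA wmon_cat.
have sa : span (adjpsi y).
  rewrite (adjpsiE er hy); elim: {hr er e} r => [|p r IH].
    by rewrite big_nil; apply: span0.
  rewrite big_cons; apply: spanL => //; elim: (p.2) => [|i w IHw].
    by have -> : rcut [::] y = y by apply/funext => u; rewrite /rcut cats0.
  by rewrite rcut_cons; apply: rder_span.
rewrite e !pr_lincomb // /evalw big_flatten big_map; apply: eq_bigr => p _.
rewrite big_map (adjpsiE er hy) shuf_sum mulr_sumr; apply: eq_bigr => p' _.
by rewrite shufZ mulrA.
Qed.

(** The derivations are adjoint to left and right multiplication by [F i]. Right multiplication by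
    [psi] commutes with the former by associativity and with the latter because [psi] is central. *)
Lemma adjpsi_Zs s : Zs i0 c0 s (adjpsi (phi ^+ s.+1)).
Proof.
have [r hr er] := psi_list; have sx := sphi s.+1.
split=> [|i ii]; first rewrite (adjpsiE er sx) big_seq.
  apply: hom_sum => p pr; apply: homZ; have := rcut_hom p.2 (phiXh s.+1).
  by rewrite (hr _ pr) mulrSr addrK.
have [lx rx] : lder i (phi ^+ s.+1) = 0 /\ rder i (phi ^+ s.+1) = 0.
  by have [_ h] := phiX s.+1; apply: h.
have spsi : span psi by apply: span_hom (Zs_hom psiZ).
split; apply/funext => u.
  rewrite /lder /adjpsi wmon_cons -mulrA prFl //; last by apply: spanM => //; apply: span_mon.
  by rewrite lx pr0r.
rewrite /rder /adjpsi wmon_rcons -mulrA (Zs_comm PD CD c0E psiZ (span_gen F i)).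
rewrite mulrA prFr //; last by apply: spanM => //; apply: span_mon.
by rewrite rx pr0r.
Qed.

Lemma polyfam_adjpsi : exists L, exists2 Y : K -> sh, polyfam (c0 *+ L) Y &
  forall k, phi ^+ L.+1 * adjpsi (phi ^+ k) = phi ^+ k * Y (t i0 ^ k%:Z).
Proof.
have [r hr er] := psi_list.
(* All words of [psi] have length [height c0], so one power of [phi] serves them all. The length is
   not 0, since [H i0 c0 = 2]. *)
have [L hL] : exists L : nat, height c0 = L.+1%:Z.
  have [h _] := phiZ; rewrite mulr1n in h.
  have := hom_height_ge0 h phi0; case e: (height c0) => [[|L]|] // _; last by exists L.
  have [w hw] := hom_neq0 h phi0.
  move: e; rewrite -hw height_wt => -[] /eqP; rewrite size_eq0 => /eqP ew.
  by have := c0E i0; rewrite -hw ew wt_nil cpair0 eqxx.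
exists L; suff [Y hY eY] : exists2 Y : K -> sh, polyfam (c0 *+ L) Y &
    forall k, phi ^+ L.+1 * (\sum_(p <- r) p.1 *: rcut p.2 (phi ^+ k))
      = phi ^+ k * Y (t i0 ^ k%:Z).
  by exists Y => // k; rewrite (adjpsiE er (sphi k)) eY.
elim: {er} r hr => [|p r IH] hr.
  exists (fun=> 0) => [|k]; first by exists [::] => // b; rewrite big_nil.
  by rewrite big_nil !mulr0.
have [Y hY eY] : exists2 Y : K -> sh, polyfam (c0 *+ L) Y &
    forall k, phi ^+ L.+1 * (\sum_(p <- r) p.1 *: rcut p.2 (phi ^+ k))
      = phi ^+ k * Y (t i0 ^ k%:Z).
  by apply: IH => p' p'r; apply: hr; rewrite in_cons p'r orbT.
have hp : wt p.2 = c0 by apply: hr; rewrite mem_head.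
have sz : size p.2 = L.+1.
  by have := hL; rewrite -hp height_wt => -[].
have [Y' hY' eY'] := polyfam_word p.2.
rewrite sz hp mulrSr addrK in hY' eY'.
exists (fun b => p.1%:P.[b] *: Y' b + Y b) => [|k].
  by apply: polyfamD => //; apply: polyfam_scale.
by rewrite big_cons mulrDr eY -scalerAr eY' hornerC scalerAr -mulrDr.
Qed.

(** By [Zs_uniq], [phi] is a multiple of [psi] and the conjugate of [phi] is a multiple of [phi]. So
    if this pairing vanished, the hermitian norm of [phi^s] would vanish too. *)
Lemma pr_powers_neq0 s : pr (psi ^+ s) (phi ^+ s) != 0.
Proof.
have psi0 : psi != 0.
  by apply: contraNneq phi0 => h; rewrite -(shrevK phi) -/psi h.
have [k1 e1] := Zs_uniq PD CD c0E phiZ psiZ psi0.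
have [k2 e2] := Zs_uniq PD CD c0E (Zs_shcj PD phiZ) phiZ phi0.
have xs0 : phi ^+ s != 0 by apply: (hom_exp_neq0 PD _ (Zs_hom phiZ) phi0).
have := pos_neq0 PC (herm_pos PD (phiXh s) xs0).
rewrite /herm (shcjX PD) e2 exprZn prZr; apply: contraNneq => h.
have sps : span (psi ^+ s) by apply: span_hom (Zs_hom (ZsX s psiZ)).
rewrite {1}e1 exprZn -[k1 ^+ s *: _]addr0 prLl //; last exact: span0.
by rewrite h mulr0 add0r prC ?pr0r ?mulr0 //; apply: span0.
Qed.

(** By uniqueness [adjpsi] takes [phi^(s+1)] to some [b phi^s]. Comparing with [polyfam_adjpsi] and
    cancelling [phi^(s+1)] gives [b phi^L = Y (t^(s+1))], from which [b] is read off at a word in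
    the support of [phi^L]. *)
Theorem shuffle_bfunction : exists p : {poly K}, forall s : nat,
  pr (psi ^+ s.+1) (phi ^+ s.+1)
  = p.[t i0 ^+ s] * pr (psi ^+ s) (phi ^+ s).
Proof.
have [L [Y hY eY]] := polyfam_adjpsi.
have [u hu] : exists u, (phi ^+ L) u != 0.
  have h : phi ^+ L != 0 by apply: (hom_exp_neq0 PD _ (Zs_hom phiZ) phi0).
  by have [u _ hu] := shom_neq0 (phiXh L) h; exists u.
have [p hp] := polyfam_eval u hY.
(* The substitution of [t i0 *: 'X] accounts for the exponent [s + 1] at which [Y] is evaluated. *)
exists (((phi ^+ L) u)^-1 *: (p \Po (t i0 *: 'X))) => s.
have [b eb] : exists b, adjpsi (phi ^+ s.+1) = b *: phi ^+ s.
  apply: (Zs_uniq PD CD c0E (adjpsi_Zs s) (phiX s)).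
  exact: (hom_exp_neq0 PD _ (Zs_hom phiZ) phi0).
rewrite exprSr pr_psi //; last by apply: span_hom (Zs_hom (ZsX s psiZ)).
rewrite eb prZr; congr (_ * _).
have e : b *: phi ^+ L = Y (t i0 ^ s.+1%:Z).
  apply: (hom_mulIr PD (z := phi ^+ s.+1) (homZ b (phiXh L)) (polyfam_hom _ hY) (phiXh s.+1)).
    exact: (hom_exp_neq0 PD _ (Zs_hom phiZ) phi0).
  rewrite phi_comm; last exact: span_hom (homZ b (phiXh L)).
  rewrite phi_comm; last exact: span_hom (polyfam_hom _ hY).
  rewrite -eY eb -!scalerAr -!exprD; congr (_ *: _ ^+ _); lia.
have := congr1 (fun x : sh => x u) e; rewrite shufZ hp => e'.
rewrite hornerZ horner_comp hornerZ hornerX -exprS -[t i0 ^+ s.+1]/(t i0 ^ s.+1%:Z).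
by rewrite -e' mulrC mulfK.
Qed.

End Positive.

(** * The quantized enveloping algebra *)

Section TensorTheory.
Context (K : fieldType) (A B : algType K).

Lemma quotpi_rel (C : algType K) (S : C -> Prop) x : S x -> quotpi S x = 0.
Proof.
move=> h; have -> : 0 = quotpi S 0 by rewrite /quotpi raddf0.
by apply/quotpi_eq; rewrite subr0; apply: ideal_genS.
Qed.

Lemma tensZl c (a : A) (b : B) : tens (c *: a) b = c *: tens a b.
Proof.
by rewrite /tens -quotpiZ; apply/quotpi_eq; apply/ideal_genS/tens_relZl.
Qed.
Lemma tensM (a a' : A) (b b' : B) : tens a b * tens a' b' = tens (a * a') (b * b').
Proof.
by rewrite /tens -quotpiM; apply/quotpi_eq; apply/ideal_genS/tens_relM.
Qed.
Lemma tens11 : tens (1 : A) (1 : B) = 1.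
Proof.
by rewrite /tens -quotpi1; apply/quotpi_eq; apply/ideal_genS/tens_rel1.
Qed.

End TensorTheory.

Section Relations.
Context (K : fieldType) (q : K) (n : nat) (a : 'M[int]_n) (d : 'I_n -> nat).
Notation U := (Uq q a d).
Notation E := (uE q a d).
Notation F := (uF q a d).
Notation KK := (uK q a d).
Notation KV := (uKV q a d).
Notation t := (qi q d).
Notation pi := (quotpi (@uq_rel K q n a d)).

Let piM x y : pi (x * y) = (pi x : U) * pi y. Proof. exact: quotpiM. Qed.
Let piB x y : pi (x - y) = (pi x : U) - pi y. Proof. exact: quotpiB. Qed.
Let piZ c x : pi (c *: x) = c *: (pi x : U). Proof. exact: quotpiZ. Qed.
Let pi_sum I (r : seq I) (G : I -> freealg K (uq_gen n)) :
  pi (\sum_(i <- r) G i) = \sum_(i <- r) (pi (G i) : U).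
Proof.
elim: r => [|i r IH]; first by rewrite !big_nil /quotpi raddf0.
by rewrite !big_cons -IH; apply: quotpiD.
Qed.
Let piX x k : pi (x ^+ k) = (pi x : U) ^+ k.
Proof. by elim: k => [|k IH]; rewrite ?expr0 // !exprS piM IH. Qed.

Let pi_eq x y : uq_rel q a d (x - y) -> pi x = pi y :> U.
Proof. by move=> h; apply/quotpi_eq/ideal_genS. Qed.

Let piM2 x y z : pi (x * y * z) = (pi x : U) * pi y * pi z.
Proof. exact (etrans (piM _ _) (congr1 (fun u : U => u * pi z) (piM _ _))). Qed.

Lemma uq_KKV i : KK i * KV i = 1 :> U.
Proof. exact (etrans (esym (piM _ _)) (pi_eq (uq_relKV _ _ _ i))). Qed.
Lemma uq_KVK i : KV i * KK i = 1 :> U.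
Proof. exact (etrans (esym (piM _ _)) (pi_eq (uq_relVK _ _ _ i))). Qed.
Lemma uq_KE i j : KK i * E j * KV i = t i ^ a i j *: E j :> U.
Proof.
exact (etrans (esym (piM2 _ _ _)) (etrans (pi_eq (uq_relKE _ _ _ i j)) (piZ _ _))).
Qed.
Lemma uq_KF i j : KK i * F j * KV i = t i ^ (- a i j) *: F j :> U.
Proof.
exact (etrans (esym (piM2 _ _ _)) (etrans (pi_eq (uq_relKF _ _ _ i j)) (piZ _ _))).
Qed.
Lemma uq_EF i j : E i * F j - F j * E i
  = ((i == j)%:R / (t i - (t i)^-1)) *: (KK i - KV i) :> U.
Proof.
have e1 : pi (fE K i * fF K j - fF K j * fE K i) = E i * F j - F j * E i :> U.
  exact (etrans (piB _ _) (congr2 (fun u v : U => u - v) (piM _ _) (piM _ _))).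
have e2 c : pi (c *: (fK K i - fKV K i)) = c *: (KK i - KV i) :> U.
  exact (etrans (piZ _ _) (congr1 (fun u : U => c *: u) (piB _ _))).
exact (etrans (esym e1) (etrans (pi_eq (uq_relEF _ _ _ i j)) (e2 _))).
Qed.

Lemma uq_serreF i j : i != j ->
  \sum_(k < (`|1 - a i j|%N).+1) (-1) ^+ k *:
    (divpow (t i) (F i) (`|1 - a i j|%N - k) * F j * divpow (t i) (F i) k) = 0 :> U.
Proof.
move=> ij.
have pd (x : freealg K (uq_gen n)) m : pi (divpow (t i) x m) = divpow (t i) (pi x : U) m.
  exact (etrans (piZ _ _) (congr1 (fun u : U => _ *: u) (piX _ _))).
have e (k : nat) : pi ((-1) ^+ k *: (divpow (t i) (fF K i) (`|1 - a i j|%N - k)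
      * fF K j * divpow (t i) (fF K i) k))
    = (-1) ^+ k *: (divpow (t i) (F i) (`|1 - a i j|%N - k) * F j
      * divpow (t i) (F i) k) :> U.
  apply: etrans (piZ _ _) (congr1 (fun u : U => _ *: u) _).
  apply: etrans (piM2 _ _ _) _.
  exact (congr2 (fun u v : U => u * F j * v) (pd _ _) (pd _ _)).
exact (etrans (eq_bigr _ (fun (k : 'I_(`|1 - a i j|%N).+1) _ => esym (e (nat_of_ord k))))
  (etrans (esym (pi_sum _ _)) (quotpi_rel (uq_relFF _ _ _ ij)))).
Qed.

End Relations.

Inductive gsub (K : fieldType) (A : algType K) (S : A -> Prop) : A -> Prop :=
| gsubS x : S x -> gsub S x
| gsub1 : gsub S 1
| gsubD x y : gsub S x -> gsub S y -> gsub S (x + y)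
| gsubZ c x : gsub S x -> gsub S (c *: x)
| gsubM x y : gsub S x -> gsub S y -> gsub S (x * y).

(* An algebra with the relations of U_q(g) between its generators; working with
   it instead of the quotient of a free algebra keeps conversion cheap. *)
Record qgroup (K : fieldType) (n : nat) (Q : qdatum K n) := QGroup {
  gA :> algType K;
  gE : 'I_n -> gA;
  gF : 'I_n -> gA;
  gK : 'I_n -> gA;
  gV : 'I_n -> gA;
  gKV : forall i, gK i * gV i = 1;
  gVK : forall i, gV i * gK i = 1;
  gKE : forall i j, gK i * gE j * gV i = qt Q i ^ qa Q i j *: gE j;
  gKF : forall i j, gK i * gF j * gV i = qt Q i ^ (- qa Q i j) *: gF j;
  gEF : forall i j, gE i * gF j - gF j * gE i
    = ((i == j)%:R / (qt Q i - (qt Q i)^-1)) *: (gK i - gV i);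
  gserre : forall i j, i != j ->
    \sum_(k < (`|1 - qa Q i j|%N).+1) (-1) ^+ k *:
      (divpow (qt Q i) (gF i) (`|1 - qa Q i j|%N - k) * gF j
       * divpow (qt Q i) (gF i) k) = 0
}.

Section QGroup.
Context (K : fieldType) (n : nat) (Q : qdatum K n) (G : qgroup Q).
Notation t := (qt Q).
Notation a := (qa Q).
Notation H := (cpair a).
Notation E := (gE G).
Notation F := (gF G).
Notation KK := (gK G).
Notation KV := (gV G).
Implicit Types (x y z : G).

Definition bminus : G -> Prop :=
  gsub (fun x => exists i, [\/ x = F i, x = KK i | x = KV i]).
Definition bplus : G -> Prop :=
  gsub (fun x => exists i, [\/ x = E i, x = KK i | x = KV i]).

Let t0 := qt_neq0 Q.
Let tD i (m k : int) : t i ^ (m + k) = t i ^ m * t i ^ k.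
Proof. by rewrite expfzDr ?t0. Qed.
Let tn0 i (m : int) : t i ^ m != 0.
Proof. by rewrite expfz_neq0 ?t0. Qed.

Lemma bminusF i : bminus (F i). Proof. by apply: gsubS; exists i; constructor. Qed.
Lemma bminusK i : bminus (KK i). Proof. by apply: gsubS; exists i; constructor. Qed.
Lemma bplusE i : bplus (E i). Proof. by apply: gsubS; exists i; constructor. Qed.
Lemma bplusK i : bplus (KK i). Proof. by apply: gsubS; exists i; constructor. Qed.
Lemma bplusV i : bplus (KV i). Proof. by apply: gsubS; exists i; constructor. Qed.

Lemma gsub0 S : gsub S (0 : G).
Proof. by rewrite -(scale0r (1 : G)); apply/gsubZ/gsub1. Qed.

Lemma gsub_span S (x : 'I_n -> G) y : (forall i, gsub S (x i)) -> span x y -> gsub S y.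
Proof.
move=> hx; elim/span_lin_ind => [|c u v hu hv|w]; first exact: gsub0.
  by apply: gsubD => //; apply: gsubZ.
elim: w => [|i w IH]; first by rewrite wmon_nil; apply: gsub1.
by rewrite wmon_cons; apply: gsubM.
Qed.

Lemma span_bminus y : span F y -> bminus y.
Proof. exact: gsub_span bminusF. Qed.
Lemma mon_bplus w : bplus (wmon E w).
Proof. exact: gsub_span bplusE (span_mon E w). Qed.

Lemma KE_comm i j : KK i * E j = t i ^ a i j *: (E j * KK i).
Proof. by rewrite scalerAl -gKE -[RHS]mulrA gVK mulr1. Qed.
Lemma KF_comm i j : KK i * F j = t i ^ (- a i j) *: (F j * KK i).
Proof. by rewrite scalerAl -gKF -[RHS]mulrA gVK mulr1. Qed.
Lemma FK_comm i j : F j * KK i = t i ^ a i j *: (KK i * F j).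
Proof. by rewrite KF_comm scalerA -tD subrr expr0z scale1r. Qed.
Lemma EV_comm i j : E j * KV i = t i ^ a i j *: (KV i * E j).
Proof.
rewrite -[E j * KV i]mul1r -(gVK G i) -!mulrA [KK i * (E j * _)]mulrA gKE.
by rewrite -scalerAr.
Qed.
Lemma VF_comm i j : KV i * F j = t i ^ a i j *: (F j * KV i).
Proof.
rewrite -[KV i * F j]mulr1 -(gKV G i) !mulrA -[KV i * F j * _]mulrA FK_comm.
by rewrite -scalerAr -scalerAl !mulrA gVK mul1r.
Qed.

Lemma VF_hom i mu y : hom F mu y -> KV i * y = t i ^ H i mu *: (y * KV i).
Proof.
elim/hom_lin_ind => [|c u v hu hv|w <-]; first by rewrite mulr0 mul0r scaler0.
  by rewrite mulrDr mulrDl -!(scalerAl, scalerAr) hu hv scalerDr !scalerA mulrC.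
elim: w => [|j w IH].
  by rewrite wmon_nil wt_nil cpair0 expr0z scale1r mulr1 mul1r.
rewrite wmon_cons wt_cons mulrA VF_comm -scalerAl -[F j * KV i * wmon F w]mulrA IH.
by rewrite -scalerAr scalerA cpairD cpair_alpha tD mulrA.
Qed.

Lemma KF_hom i mu y : hom F mu y -> KK i * y * KV i = t i ^ (- H i mu) *: y.
Proof.
move=> hy; have e : y = t i ^ H i mu *: (KK i * y * KV i).
  by rewrite -mulrA scalerAr -(VF_hom i hy) mulrA gKV mul1r.
by rewrite [in RHS]e scalerA -tD addNr expr0z scale1r.
Qed.

Lemma EV_mon i w : wmon E w * KV i = t i ^ H i (wt w) *: (KV i * wmon E w).
Proof.
elim: w => [|j w IH].
  by rewrite wmon_nil wt_nil cpair0 expr0z scale1r mulr1 mul1r.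
rewrite wmon_cons wt_cons -mulrA IH -scalerAr [E j * (_ * _)]mulrA EV_comm.
by rewrite -scalerAl scalerA cpairD cpair_alpha tD mulrC [in RHS]mulrA.
Qed.

End QGroup.

Arguments bminus {K n Q G} _.
Arguments bplus {K n Q G} _.
Arguments bminusF {K n Q G} i.
Arguments bminusK {K n Q G} i.
Arguments bplusE {K n Q G} i.
Arguments bplusK {K n Q G} i.
Arguments bplusV {K n Q G} i.
Arguments gsub0 {K n Q G} S.
Arguments mon_bplus {K n Q G} w.

(** * The adjoint action and the Serre relations *)

Section Adjoint.
Context (K : fieldType) (n : nat) (Q : qdatum K n) (G : qgroup Q).
Notation t := (qt Q).
Notation a := (qa Q).
Notation H := (cpair a).
Notation E := (gE G).
Notation F := (gF G).
Notation KK := (gK G).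
Notation KV := (gV G).
Implicit Types (x y z : G) (mu nu : weight n).

Let t0 := qt_neq0 Q.
Let tD i (m k : int) : t i ^ (m + k) = t i ^ m * t i ^ k.
Proof. by rewrite expfzDr ?t0. Qed.

(** [adU i] and [adE i] are [ad(F_i)] and [ad(E_i)] with the coproduct and the antipode written
    out. *)
Definition adU i x : G := F i * x - KK i * x * KV i * F i.
Definition adE i x : G := (E i * x - x * E i) * KK i.

Lemma adU_linear i : linear (adU i).
Proof.
move=> c x y; rewrite /adU mulrDr -scalerAr.
rewrite [KK i * (c *: x + y)]mulrDr -scalerAr !mulrDl -!scalerAl.
by rewrite opprD scalerBr addrACA.
Qed.

Lemma adE_linear i : linear (adE i).
Proof.
move=> c x y; rewrite /adE mulrDr -scalerAr [(c *: x + y) * E i]mulrDl -scalerAl.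
by rewrite opprD addrACA -scalerBr mulrDl -scalerAl.
Qed.

Lemma adU_KV i m x : KK i * x * KV i = t i ^ m *: x ->
  adU i x = F i * x - t i ^ m *: (x * F i).
Proof. by move=> h; rewrite scalerAl -h. Qed.

Lemma adU_homE i mu x : hom F mu x -> adU i x = F i * x - t i ^ (- H i mu) *: (x * F i).
Proof. by move/(KF_hom i); apply: adU_KV. Qed.

Lemma adU_hom i mu x : hom F mu x -> hom F (mu + alpha i) (adU i x).
Proof.
move=> hx; rewrite (adU_homE i hx); apply: homB; last first.
  by apply: homZ; apply: homM => //; apply: hom_gen.
by rewrite addrC; apply: homM => //; apply: hom_gen.
Qed.

Lemma adUM i mu x y : hom F mu x ->
  adU i (x * y) = adU i x * y + t i ^ (- H i mu) *: (x * adU i y).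
Proof.
move=> hx; rewrite (adU_homE i hx) /adU.
have -> : KK i * (x * y) * KV i = t i ^ (- H i mu) *: (x * (KK i * y * KV i)).
  rewrite scalerAl -(KF_hom i hx) -!mulrA; congr (_ * (_ * _)).
  by rewrite !mulrA gVK mul1r.
rewrite -scalerAl mulrBl -scalerAl mulrBr scalerBr !mulrA addrA; congr (_ - _).
by rewrite subrK.
Qed.

Lemma adU1 i : adU i 1 = 0.
Proof. by rewrite /adU !mulr1 gKV mul1r subrr. Qed.

Lemma KV_weight i m x : KK i * x * KV i = t i ^ m *: x ->
  KK i * x = t i ^ m *: (x * KK i) /\ KV i * x = t i ^ (- m) *: (x * KV i).
Proof.
move=> h; have h1 : KK i * x = t i ^ m *: (x * KK i).
  by rewrite scalerAl -h -[RHS]mulrA gVK mulr1.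
split=> //; have e : x = t i ^ (- m) *: (KK i * x * KV i).
  by rewrite h scalerA -tD addNr expr0z scale1r.
by rewrite [in LHS]e -scalerAr !mulrA gVK mul1r.
Qed.

Lemma conjKM i x y : KK i * (x * y) * KV i = (KK i * x * KV i) * (KK i * y * KV i).
Proof. by rewrite -!mulrA; do 2!congr (_ * _); rewrite !mulrA gVK mul1r. Qed.

Lemma adU_weight i m x : KK i * x * KV i = t i ^ m *: x ->
  KK i * adU i x * KV i = t i ^ (m - 2) *: adU i x.
Proof.
move=> h; have hF : KK i * F i * KV i = t i ^ (-2) *: F i by rewrite gKF qa_diag.
rewrite (adU_KV h) mulrBr mulrBl -scalerAr -[t i ^ m *: _ * _]scalerAl !conjKM h hF.
by rewrite -!scalerAl -!scalerAr scalerBr !scalerA -!tD; congr (_ ^ _ *: _ - _ ^ _ *: _); lia.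
Qed.

Lemma adE_adU i m x : KK i * x * KV i = t i ^ m *: x ->
  adE i (adU i x) = adU i (adE i x) + qbr (t i) m *: x.
Proof.
move=> h; have [h1 h2] := KV_weight h.
have hE : KK i * adE i x * KV i = t i ^ (m + 2) *: adE i x.
  have e1 : KK i * E i = t i ^ 2 *: (E i * KK i) by rewrite KE_comm qa_diag.
  have e2 : KK i * (E i * x - x * E i) = t i ^ (m + 2) *: ((E i * x - x * E i) * KK i).
    rewrite mulrBr mulrBl scalerBr !mulrA e1 h1 -!scalerAl.
    rewrite -[E i * KK i * x]mulrA h1 -[x * KK i * E i]mulrA e1.
    by rewrite -!scalerAr !scalerA -!tD !mulrA [2 + m]addrC.
  by rewrite /adE mulrA e2 -!scalerAl -mulrA gKV mulr1.
have KFi : KK i * F i = t i ^ (-2) *: (F i * KK i) by rewrite KF_comm qa_diag.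
rewrite (adU_KV hE) (adU_KV h) /adE.
have -> : (E i * x - x * E i) * KK i * F i = t i ^ (-2) *: ((E i * x - x * E i) * F i * KK i).
  by rewrite -mulrA KFi -scalerAr mulrA.
rewrite scalerA -tD addrK.
have c0 := tV_neq0 Q i.
have K1 : KK i * x * KK i = t i ^ m *: (x * KK i * KK i) by rewrite h1 -scalerAl.
have V1 : KV i * x * KK i = t i ^ (- m) *: x.
  by rewrite h2 -scalerAl -mulrA gVK mulr1.
have D : (E i * F i - F i * E i) * x * KK i
    - t i ^ m *: (x * (E i * F i - F i * E i) * KK i) = qbr (t i) m *: x.
  rewrite gEF eqxx mul1r /qbr; set c := (t i - (t i)^-1)^-1.
  have -> : (c *: (KK i - KV i)) * x * KK i = c *: ((KK i - KV i) * x * KK i).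
    by rewrite -!scalerAl.
  have -> : x * (c *: (KK i - KV i)) * KK i = c *: (x * (KK i - KV i) * KK i).
    by rewrite -scalerAr -scalerAl.
  rewrite scalerA [t i ^ m * c]mulrC -scalerA -scalerBr mulrC -scalerA; congr (_ *: _).
  rewrite mulrBl [(KK i * x - _) * _]mulrBl K1 V1 mulrBr [(x * KK i - _) * _]mulrBl.
  rewrite -[x * KV i * KK i]mulrA gVK mulr1 scalerBr scalerBl opprB.
  by rewrite [LHS](AC (2*2) (3*2*(4*1))) /= addNr addr0.
rewrite -D !(mulrBr, mulrBl, mulrA) -!(scalerAr, scalerAl) !(mulrA, scalerBr, opprB, addrA).
rewrite [RHS](ACl (5*4*7*2*(1*6)*(3*8))).
by rewrite /= !subrr !addr0.
Qed.

(** With [m = a_ij], the coefficient of [F_i^(N-k) F_j F_i^k] in [ad(F_i)^N F_j]; [m + 2 N'] is the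
    value of [h_i] on the weight after [N'] steps. *)
Fixpoint serre_coef i (m : int) (N k : nat) : K :=
  if N is N'.+1 then serre_coef i m N' k -
    t i ^ (- (m + N'%:Z *+ 2)) * (if k is k'.+1 then serre_coef i m N' k' else 0)
  else (k == 0)%:R.

Lemma serre_coef_gt i m N k : (N < k)%N -> serre_coef i m N k = 0.
Proof.
elim: N k => [|N IH] [|k] //= h.
by rewrite !IH ?mulr0 ?subrr //; lia.
Qed.

Lemma qnum_neq0 i m : (0 < m)%N -> qnum (t i) m != 0.
Proof.
move=> m0; rewrite /qnum mulf_neq0 ?invr_eq0 ?tV_neq0 // subr_eq0.
apply: contra_neq (qt_generic Q i (m := m%:Z *+ 2) _) => [e|]; last by lia.
by rewrite mulr2n tD -!exprnP [X in X * _]e mulVf // expf_neq0.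
Qed.

Lemma qfactS i m : qfact (t i) m.+1 = qfact (t i) m * qnum (t i) m.+1.
Proof. by rewrite /qfact big_nat_recr. Qed.

Lemma qfact_neq0 i m : qfact (t i) m != 0.
Proof.
elim: m => [|m IH]; first by rewrite /qfact big_geq ?oner_eq0.
by rewrite qfactS mulf_neq0 // qnum_neq0.
Qed.

(** A q-binomial coefficient times [(-1)^k t^(-k(N-1+m))], by the q-Pascal rule. At [N = 1 - m] the
    power of [t] is trivial and the coefficients are those of the Serre relation, so [ad(F_i)^N F_j]
    is a multiple of it. *)
Lemma serre_coefE i m N k : (k <= N)%N ->
  serre_coef i m N k * (qfact (t i) (N - k) * qfact (t i) k) =
  (-1) ^+ k * t i ^ (- (k%:Z * (N%:Z - 1 + m))) * qfact (t i) N.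
Proof.
elim: N k => [|N IH] k kN.
  by move: kN; rewrite leqn0 => /eqP ->; rewrite /qfact !big_geq // mul0r oppr0 expr0z expr0 !mulr1.
have first : serre_coef i m N k * (qfact (t i) (N.+1 - k) * qfact (t i) k) =
    (-1) ^+ k * t i ^ (- (k%:Z * (N%:Z - 1 + m))) * qfact (t i) N * qnum (t i) (N.+1 - k).
  have [kN'|kN'] := leqP k N; last first.
    have -> : k = N.+1 by lia.
    by rewrite serre_coef_gt // mul0r subnn /qnum !expr0 invr1 subrr !mul0r mulr0.
  by rewrite -IH // subSn // qfactS; ring.
rewrite [serre_coef i m N.+1 k]/= mulrBl first qfactS.
case: k kN {first} => [|k] kN.
  by rewrite !(mulr0, mul0r) subr0 subn0 [RHS]mulrA.
rewrite subSS qfactS.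
have -> : t i ^ (- (m + N%:Z *+ 2)) * serre_coef i m N k *
   (qfact (t i) (N - k) * (qfact (t i) k * qnum (t i) k.+1))
   = t i ^ (- (m + N%:Z *+ 2)) * qnum (t i) k.+1 *
     (serre_coef i m N k * (qfact (t i) (N - k) * qfact (t i) k)) by ring.
rewrite IH //; have [l eN] : exists l, N = (k + l)%N by exists (N - k)%N; lia.
set e := - (k.+1%:Z * (N.+1%:Z - 1 + m)).
have -> : - (k.+1%:Z * (N%:Z - 1 + m)) = e + k.+1%:Z by rewrite /e; lia.
have e2 : - (m + N%:Z *+ 2) + - (k%:Z * (N%:Z - 1 + m)) = e - l%:Z by rewrite /e eN; lia.
have -> : t i ^ (- (m + N%:Z *+ 2)) * qnum (t i) k.+1 *
    ((-1) ^+ k * t i ^ (- (k%:Z * (N%:Z - 1 + m))) * qfact (t i) N)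
  = t i ^ (- (m + N%:Z *+ 2)) * t i ^ (- (k%:Z * (N%:Z - 1 + m)))
    * ((-1) ^+ k * qnum (t i) k.+1 * qfact (t i) N) by ring.
rewrite -tD e2 !tD -invr_expz -!exprnP /qnum.
have -> : (N - k = l)%N by lia.
have -> : N.+1 = (k.+1 + l)%N by lia.
rewrite exprD exprS; set A := t i ^+ k.+1; set B := t i ^+ l; set C := t i ^ e.
have A0 : A != 0 by rewrite expf_neq0.
have B0 : B != 0 by rewrite expf_neq0.
have := tV_neq0 Q i; set d := t i - _ => d0.
field.
by rewrite A0 B0 d0.
Qed.

Lemma iter_adU i j N :
  hom F (alpha j + alpha i *+ N) (iter N (adU i) (F j)) /\
  iter N (adU i) (F j) = \sum_(k < N.+1) serre_coef i (a i j) N k *: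
    (F i ^+ (N - k) * F j * F i ^+ k).
Proof.
elim: N => [|N [IH1 IH2]].
  rewrite addr0 big_ord1 /= scale1r mulr1 mul1r; split=> //; exact: hom_gen.
split; first by rewrite mulrSr addrA iterS; apply: adU_hom.
rewrite iterS (adU_homE i IH1) IH2 cpairD cpairMn !cpair_alpha qa_diag.
have -> : F i * (\sum_(k < N.+1) serre_coef i (a i j) N k *: (F i ^+ (N - k) * F j * F i ^+ k))
  = \sum_(k < N.+2) serre_coef i (a i j) N k *: (F i ^+ (N.+1 - k) * F j * F i ^+ k).
  rewrite [RHS]big_ord_recr /= serre_coef_gt // scale0r addr0 mulr_sumr.
  apply: eq_bigr => k _; rewrite -scalerAr !mulrA -exprS subSn //.
  by rewrite -ltnS.
rewrite mulr_suml [X in _ - _ *: X](_ : _ = \sum_(k < N.+2)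
   (if k : nat is k'.+1 then serre_coef i (a i j) N k' else 0) *:
     (F i ^+ (N.+1 - k) * F j * F i ^+ k)).
  rewrite scaler_sumr -sumrB; apply: eq_bigr => k _.
  by rewrite scalerA -scalerBl; congr ((_ - _ ^ (- (_ + _)) * _) *: _); lia.
rewrite [RHS]big_ord_recl scale0r add0r; apply: eq_bigr => k _.
by rewrite lift0 subSS -scalerAl -[_ * _ * F i ^+ k * F i]mulrA -exprSr.
Qed.

Lemma adU_serre i j : i != j -> a i j <= 0 ->
  iter `|1 - a i j| (adU i) (F j) = 0.
Proof.
move=> ij aij; have [_ ->] := iter_adU i j `|1 - a i j|.
have e0 : qfact (t i) `|1 - a i j| *: (\sum_(k < `|1 - a i j|.+1) (-1) ^+ k *:
  (divpow (t i) (F i) (`|1 - a i j| - k) * F j * divpow (t i) (F i) k)) = 0.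
  by rewrite gserre // scaler0.
rewrite -[RHS]e0 scaler_sumr; apply: eq_bigr => k _.
have kN : (k <= `|1 - a i j|)%N by rewrite -ltnS.
rewrite /divpow -!scalerAl -!scalerAr !scalerA; congr (_ *: _).
have := serre_coefE i (a i j) kN.
have -> : `|1 - a i j|%N%:Z - 1 + a i j = 0 by lia.
rewrite mulr0 oppr0 expr0z mulr1.
have := qfact_neq0 i k; have := qfact_neq0 i (`|1 - a i j| - k) => f1 f2 h.
apply: (mulIf (mulf_neq0 f1 f2)); rewrite h.
set X := qfact _ (_ - _); set Y := qfact _ k; field.
by rewrite f1 f2.
Qed.

End Adjoint.

(** * Triviality of the radical of the pairing *)

Section Injectivity.
Context (K : fieldType) (n : nat) (Q : qdatum K n) (G : qgroup Q).
Notation t := (qt Q).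
Notation a := (qa Q).
Notation H := (cpair a).
Notation E := (gE G).
Notation F := (gF G).
Notation KK := (gK G).
Notation KV := (gV G).
Notation sh := (qshuffle (qP Q)).
Notation Fs := (@Fsh K n (qP Q)).
Implicit Types (x y z : G) (mu nu : weight n).

Let t0 := qt_neq0 Q.
Let tD i (m k : int) : t i ^ (m + k) = t i ^ m * t i ^ k.
Proof. by rewrite expfzDr ?t0. Qed.
Let tn0 i (m : int) : t i ^ m != 0.
Proof. by rewrite expfz_neq0 ?t0. Qed.
Let Psym : forall i j, qP Q i j = qP Q j i := qt_sym Q.

Context (Psi : G -> sh).
Hypothesis PsiL : forall c y z, span F y -> span F z ->
  Psi (c *: y + z) = c *: Psi y + Psi z.
Hypothesis PsiM : forall y z, span F y -> span F z -> Psi (y * z) = Psi y * Psi z.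
Hypothesis Psi1 : Psi 1 = 1.
Hypothesis PsiF : forall i, Psi (F i) = Fs i.
Hypothesis PsiK2 : forall l r i c, span F l -> span F r ->
  c *: (l * (KK i * KK i)) = r -> Psi r = 0.
Hypothesis a_le0 : forall i j, i != j -> a i j <= 0.
Hypothesis a_def : forall nu : weight n,
  (forall i, nu i * H i nu <= 0) -> nu = 0.

Let Psi0 : Psi 0 = 0.
Proof.
have := PsiL (-1) (span0 F) (span0 F).
by rewrite scaleN1r oppr0 addr0 scaleN1r addNr.
Qed.

Let PsiZ c y : span F y -> Psi (c *: y) = c *: Psi y.
Proof. by move=> hy; have := PsiL c hy (span0 F); rewrite Psi0 !addr0. Qed.

Lemma Psi_wmon w : Psi (wmon F w) = wmon Fs w.
Proof.
elim: w => [|i w IH]; first by rewrite !wmon_nil Psi1.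
by rewrite !wmon_cons PsiM ?IH ?PsiF //; [apply: span_gen|apply: span_mon].
Qed.

Lemma Psi_homog mu y : hom F mu y -> hom Fs mu (Psi y).
Proof.
move=> hy; suff [] : span F y /\ hom Fs mu (Psi y) by [].
elim/hom_lin_ind: y / hy => [|c u v [hu eu] [hv ev]|w <-].
- by rewrite Psi0; split; [exact: span0|exact: hom0].
- by rewrite PsiL //; split; [exact: spanL|exact: homL].
by rewrite Psi_wmon; split; [exact: span_mon|exact: hom_mon].
Qed.

(** Without a triangular decomposition, [l] and [r] are not known to be determined by [y]. Their
    existence with the right images under [Psi] is enough, and it follows letter by letter. *)
Lemma commutator_der i mu y : hom F mu y -> exists l r,
  [/\ hom F (mu - alpha i) l, hom F (mu - alpha i) r,
      Psi l = lder i (Psi y), Psi r = rder i (Psi y) &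
      E i * y - y * E i = (t i - (t i)^-1)^-1 *: (KK i * l - r * KV i)].
Proof.
move=> hy; suff [] : span F y /\ exists l r,
  [/\ hom F (mu - alpha i) l, hom F (mu - alpha i) r,
      Psi l = lder i (Psi y), Psi r = rder i (Psi y) &
      E i * y - y * E i = (t i - (t i)^-1)^-1 *: (KK i * l - r * KV i)] by [].
elim/hom_lin_ind: y / hy => [|c u v [hu [l1 [r1 [hl1 hr1 el1 er1 e1]]]]
    [hv [l2 [r2 [hl2 hr2 el2 er2 e2]]]]|w <-].
- split; [exact: span0|exists 0, 0].
  by rewrite Psi0 !linear0 !(mulr0, mul0r) !subrr scaler0; split=> //; apply: hom0.
- split; [exact: spanL|exists (c *: l1 + l2), (c *: r1 + r2)]; split.
  + exact: homL.
  + exact: homL.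
  + by rewrite !PsiL ?el1 ?el2 ?linearP //; apply: span_hom; eassumption.
  + by rewrite !PsiL ?er1 ?er2 ?linearP //; apply: span_hom; eassumption.
  have -> : E i * (c *: u + v) - (c *: u + v) * E i
     = c *: (E i * u - u * E i) + (E i * v - v * E i).
    by rewrite mulrDr mulrDl -scalerAr -scalerAl opprD scalerBr addrACA.
  rewrite e1 e2 scalerA [c * _]mulrC -scalerA -scalerDr; congr (_ *: _).
  by rewrite mulrDr mulrDl -scalerAr -scalerAl opprD scalerBr addrACA.
split; first exact: span_mon.
elim: w => [|j w [l [r [hl hr el er e]]]].
  exists 0, 0; rewrite wmon_nil Psi1 Psi0 lder1 rder1 !(mulr0, mul0r, mulr1, mul1r).
  by rewrite !subrr scaler0; split=> //; apply: hom0.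
pose w0 := wmon F w; have hw : hom F (wt w) w0 := hom_mon F w.
have hj : hom F (alpha j) (F j) := hom_gen F j.
have wE : alpha j + (wt w - alpha i) = alpha j + wt w - alpha i by rewrite addrA.
exists ((i == j)%:R *: w0 + t i ^ a i j *: (F j * l)),
       (((i == j)%:R * t i ^ H i (wt w)) *: w0 + F j * r).
have hjl : hom F (alpha j + wt w - alpha i) (F j * l) by rewrite -wE; apply: homM.
have hjr : hom F (alpha j + wt w - alpha i) (F j * r) by rewrite -wE; apply: homM.
have hw0 c : i == j -> hom F (alpha j + wt w - alpha i) (c *: w0).
  by move=> /eqP ->; rewrite addrAC subrr add0r; apply: homZ.
have sl := span_hom hl; have sr := span_hom hr.
have sw := span_mon F w; have sj := span_gen F j.
have ew : Psi (wmon F (j :: w)) = Fs j * Psi w0 by rewrite wmon_cons PsiM // PsiF.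
rewrite wt_cons ew; split.
- apply: homD; last exact: homZ.
  by case: eqP => [/eqP ij|_]; [apply: hw0|rewrite scale0r; apply: hom0].
- apply: homD => //; case: eqP => [/eqP ij|_]; first exact: hw0.
  by rewrite mul0r scale0r; apply: hom0.
- rewrite lderM lderF twistF PsiL //; last first.
    by rewrite -[_ *: _]addr0; apply: spanL; [apply: spanM|apply: span0].
  by rewrite PsiZ ?PsiM ?PsiF ?el -?scalerAl ?mul1r //; apply: spanM.
- rewrite rderM // rderF PsiL //; last exact: spanM.
  rewrite PsiM // PsiF er (twist_hom i (Psi_homog hw)) -scalerAl mul1r scalerA.
  by [].
rewrite wmon_cons -/w0 mulrA -[F j * w0 * E i]mulrA.
have -> : w0 * E i = E i * w0 - (t i - (t i)^-1)^-1 *: (KK i * l - r * KV i).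
  by rewrite -e opprB addrC subrK.
have -> : E i * F j = F j * E i + ((i == j)%:R / (t i - (t i)^-1)) *: (KK i - KV i).
  by rewrite -gEF addrC subrK.
rewrite mulrDl mulrBr opprB addrC -scalerAr -scalerAl mulrA addrA addrAC.
set c := (t i - (t i)^-1)^-1; set b := (i == j)%:R.
rewrite addrAC subrK [b * c]mulrC -[(c * b) *: _]scalerA -scalerDr; congr (_ *: _).
rewrite mulrBr mulrA FK_comm mulrBl scalerBr (VF_hom i hw) mulrDr mulrDl.
rewrite -!scalerAl -!scalerAr scalerA !mulrA opprD.
by rewrite [RHS](AC (2*2) (2*4*(1*3))).
Qed.

Let nonneg mu y : hom F mu y -> y != 0 -> 0 <= height mu /\ forall i, 0 <= mu i.
Proof.
move=> hy y0; have [w <-] := hom_neq0 hy y0.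
by rewrite height_wt; split=> // i; rewrite wtE.
Qed.

Lemma Psi_adU i mu y : hom F mu y -> Psi (adU i y) = adS 0 i (Psi y).
Proof.
move=> hy; have sy := span_hom hy; have si := span_gen F i.
rewrite (adU_homE i hy) (adSE 0 i (Psi_homog hy)) mul0rn add0r addrC -scaleNr.
rewrite PsiL; [|exact: spanM|exact: spanM].
by rewrite !PsiM // PsiF addrC -scaleNr.
Qed.

Lemma Psi_iter_adU i mu y k : hom F mu y -> Psi (iter k (adU i) y) = iter k (adS 0 i) (Psi y).
Proof.
elim: k mu y => [//|k IH] mu y hy.
by rewrite !iterSr (IH _ _ (adU_hom i hy)) (Psi_adU i hy).
Qed.

Lemma qgroup_integrable : ad_integrable Q.
Proof.
move=> i j ji; exists `|1 - a i j|%N; have hj := hom_gen F j.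
rewrite -PsiF -(Psi_iter_adU i _ hj) adU_serre ?Psi0 // 1?eq_sym //.
by apply: a_le0; rewrite eq_sym.
Qed.

Lemma uminus_expansion i mu y : hom F mu y -> exists N (ys : nat -> G),
  (forall k, nilcoef F (adU i) (fun x => span F x /\ lder i (Psi x) = 0)
     (mu - alpha i *+ k) (ys k)) /\
  y = \sum_(k < N) ys k * F i ^+ k.
Proof.
apply: (@hom_expansion _ _ _ F i (adU i) (fun mu => t i ^ (- H i mu))
  (fun x => span F x /\ lder i (Psi x) = 0)).
- exact: adU_linear.
- by move=> ???; apply: adU_hom.
- by move=> nu z hz; rewrite (adU_homE i hz) subrK.
- by move=> nu z z' hz; apply: adUM.
- by rewrite Psi0 linear0; split=> //; apply: span0.
- move=> b z z' [s1 h1] [s2 h2]; split; first exact: spanL.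
  by rewrite PsiL // lderD lderZ h1 h2 scaler0 addr0.
- move=> nu z z' _ [s1 h1] [s2 h2]; split; first exact: spanM.
  by rewrite PsiM // lderM h1 h2 mul0r mulr0 addr0.
- by rewrite Psi1 lder1; split=> //; rewrite -(wmon_nil F); apply: span_mon.
- move=> nu z hz [s1 h1]; split; first exact: span_hom (adU_hom i hz).
  by rewrite (Psi_adU i hz); apply: lder_ad (Psi_homog hz) h1.
- move=> j ji; split; first exact: span_gen.
  by rewrite PsiF lderF eq_sym (negPf ji) scale0r.
- exact: adU1.
move=> j ji; exists `|1 - a i j|%N; apply: adU_serre; first by rewrite eq_sym.
by apply: a_le0; rewrite eq_sym.
Qed.

Lemma Psi_sum I (r : seq I) (f : I -> G) : (forall k, span F (f k)) ->
  Psi (\sum_(k <- r) f k) = \sum_(k <- r) Psi (f k).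
Proof.
move=> hf; suff [] : span F (\sum_(k <- r) f k) /\
  Psi (\sum_(k <- r) f k) = \sum_(k <- r) Psi (f k) by [].
elim: r => [|k r [IH1 IH2]]; first by rewrite !big_nil; split=> //; apply: span0.
rewrite !big_cons -[f k]scale1r; split; first exact: spanL.
by rewrite PsiL // !scale1r IH2.
Qed.

(** [y] is a highest weight vector of weight [- H i mu] for the adjoint sl_2. At the last nonzero
    iterate, the [N']th, the relation forces [[N'+1][- H i mu - N'] = 0], so this weight is
    [N' >= 0]. *)
Lemma commuting_weight i mu y N : hom F mu y -> y != 0 ->
  E i * y = y * E i -> iter N (adU i) y = 0 -> H i mu <= 0.
Proof.
move=> hy y0 ey hN.
have [N' hN' nN'] : exists2 N', iter N'.+1 (adU i) y = 0 & iter N' (adU i) y != 0.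
  elim: N hN => [/= h|N IH h]; first by rewrite h eqxx in y0.
  by have [/IH//|h'] := eqVneq (iter N (adU i) y) 0; exists N.
have eL := @adE_linear _ _ _ G i; have fL := @adU_linear _ _ _ G i.
have brP := qbr_is_bracket (qt_generic Q i) (t0 i).
have := sl2_efiter brP fL (@adU_weight _ _ _ G i) (@adE_adU _ _ _ G i) N' (KF_hom i hy).
have -> : adE i y = 0 by rewrite /adE ey subrr mul0r.
have adU0 : adU i (0 : G) = 0.
  by have := fL (-1) 0 0; rewrite scaleN1r oppr0 addr0 scaleN1r addNr.
have -> : iter N'.+1 (adU i) 0 = (0 : G) by elim: (N'.+1) => //= k ->.
rewrite hN' /adE mulr0 mul0r subrr mul0r add0r => /esym/eqP.
rewrite scaler_eq0 (negPf nN') orbF mulf_eq0 => /orP[] /eqP h.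
  by have /eqP[] := br_neq0 brP (m := N'.+1%:Z) isT.
have [] := eqVneq (- H i mu - N'%:Z) 0; first by lia.
by move=> /(br_neq0 brP)/eqP.
Qed.

Lemma height_alphaMn (i : 'I_n) k : height (alpha i *+ k) = k%:Z.
Proof.
elim: k => [|k IH]; last by rewrite mulrS heightD IH height_alpha; lia.
by rewrite mulr0n -(wt_nil n) height_wt.
Qed.

Lemma shuf_expansion_uniq i mu N (zs : nat -> sh) :
  (forall k, nilcoef Fs (adS 0 i) (fun x : sh => lder i x = 0) (mu - alpha i *+ k) (zs k)) ->
  \sum_(k < N) zs k * Fs i ^+ k = 0 -> forall k, (k < N)%N -> zs k = 0.
Proof.
move=> hz; elim: N => [//|N IH] h k; rewrite ltnS leq_eqVlt.
have zN : zs N = 0.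
  have [c c0] := expansion_top N hz; rewrite h.
  have -> : iter N (lder i) 0 = (0 : sh) by elim: N {IH h} => //= N ->; rewrite linear0.
  by move/esym/eqP; rewrite scaler_eq0 (negPf c0) => /eqP.
move=> /orP[/eqP ->//|]; apply: IH.
by move: h; rewrite big_ord_recr /= zN mul0r addr0.
Qed.

(** For [y] in the kernel, [l] and [r] are in the kernel at smaller height, hence zero, and [y]
    commutes with every [E i]. Its expansion along [F_i] likewise reduces to the coefficient of
    [F_i^0], on which [ad(F_i)] is nilpotent. So [H i mu <= 0] for all [i], and definiteness leaves
    weight 0 only. *)
Lemma Psi_inj mu y : hom F mu y -> Psi y = 0 -> y = 0.
Proof.
have [m] : exists m : nat, height mu < m%:Z by exists `|height mu|.+1%N; lia.
elim: m mu y => [|m IH] mu y hm hy py.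
  by apply: contrapT => /eqP y0; have [] := nonneg hy y0; lia.
apply: contrapT => /eqP y0; have [_ mu0] := nonneg hy y0.
suff mu_eq0 : mu = 0.
  move: hy py y0; rewrite mu_eq0 => /hom_weight0[c ->].
  rewrite PsiZ ?Psi1; last by rewrite -(wmon_nil F); apply: span_mon.
  by move=> /eqP; rewrite scaler_eq0 oner_eq0 orbF => /eqP ->; rewrite scale0r eqxx.
apply: a_def => i; apply: mulr_ge0_le0 => //.
have low k x : hom F (mu - alpha i *+ k.+1) x -> Psi x = 0 -> x = 0.
  by apply: IH; rewrite heightD heightN height_alphaMn; lia.
have [l [r [hl hr el er e]]] := commutator_der i hy.
have l0 : l = 0 by apply: (low 0%N) => //; rewrite el py linear0.
have r0 : r = 0 by apply: (low 0%N) => //; rewrite er py linear0.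
have ey : E i * y = y * E i.
  by apply/eqP; rewrite -subr_eq0 e l0 r0 mulr0 mul0r subrr scaler0.
have [N [ys [hys yE]]] := uminus_expansion i hy.
have sF k : span F (F i ^+ k) by apply: span_hom (homX k (hom_gen F i)).
have sy k : span F (ys k) by have [_ []] := hys k.
have PF k : Psi (F i ^+ k) = Fs i ^+ k.
  elim: k => [|k IHk]; first by rewrite Psi1.
  by rewrite !exprS PsiM ?PsiF ?IHk //; apply: span_gen.
have zs0 k : (k < N)%N -> Psi (ys k) = 0.
  apply: (@shuf_expansion_uniq i mu N (fun k => Psi (ys k))) => [k'|].
    have [h1 [_ h2] [N' h3]] := hys k'; split => //; first exact: Psi_homog.
    by exists N'; rewrite -(Psi_iter_adU _ _ h1) h3 Psi0.
  rewrite -[RHS]py yE Psi_sum => [|k']; last exact: spanM.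
  by apply: eq_bigr => k' _; rewrite PsiM // PF.
case: N yE zs0 => [|N] yE zs0; first by rewrite yE big_ord0 eqxx in y0.
have yE0 : y = ys 0%N.
  rewrite {1}yE big_ord_recl mulr1 big1 ?addr0 // => k _.
  have [h1 _ _] := hys (lift ord0 k).
  by rewrite (low _ _ h1) ?mul0r // zs0.
have [_ _ [N' hN]] := hys 0%N.
by apply: (commuting_weight hy y0 ey (N := N')); rewrite yE0.
Qed.

(** The commutator formula gives [K_i l = r K_i^-1], so [r] is a multiple of [l K_i^2]. A triangular
    decomposition would conclude here; [PsiK2] together with [Psi_inj] takes its place. *)
Lemma highest_weight_der i mu y : hom F mu y -> E i * y = y * E i ->
  lder i (Psi y) = 0 /\ rder i (Psi y) = 0.
Proof.
move=> hy ey; have [l [r [hl hr el er]]] := commutator_der i hy.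
rewrite ey subrr => /esym/eqP; rewrite scaler_eq0 invr_eq0 (negPf (tV_neq0 Q i)).
rewrite subr_eq0 => /eqP e.
have kl : KK i * l = t i ^ (- H i (mu - alpha i)) *: (l * KK i).
  by have [] := KV_weight (KF_hom i hl).
have e' : t i ^ (- H i (mu - alpha i)) *: (l * (KK i * KK i)) = r.
  by rewrite mulrA scalerAl -kl e -mulrA gVK mulr1.
have r0 : Psi r = 0 := PsiK2 (span_hom hl) (span_hom hr) e'.
split; last by rewrite -er.
have l0 : l = 0.
  rewrite -[l]mul1r -(gVK G i) -mulrA e (Psi_inj hr r0).
  by rewrite mul0r mulr0.
by rewrite -el l0 Psi0.
Qed.

End Injectivity.

(** * The pairing on words, and the scalars b_s *)

Section Homogeneous.
Context (K : fieldType) (n : nat) (A : algType K) (x : 'I_n -> A).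

Definition component (mu : weight n) (s : seq (K * seq 'I_n)) :=
  [seq p <- s | wt p.2 == mu].

Lemma component_hom mu s : hom x mu (lincomb x (component mu s)).
Proof. by exists (component mu s) => // p; rewrite mem_filter => /andP[/eqP]. Qed.

Lemma sum_components s : lincomb x s =
  \sum_(mu <- undup [seq wt p.2 | p <- s]) lincomb x (component mu s).
Proof.
rewrite /lincomb; under [RHS]eq_bigr => mu _ do rewrite big_filter.
rewrite (exchange_big_dep predT) //= big_seq [RHS]big_seq; apply: eq_bigr => p ps.
rewrite -big_filter (_ : [seq mu <- _ | _] = [:: wt p.2]) ?big_seq1 //.
have pin : wt p.2 \in undup [seq wt p.2 | p <- s]
  by rewrite mem_undup; apply/mapP; exists p.
rewrite -[RHS](filter_pred1_uniq (undup_uniq _) pin).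
by apply: eq_filter => mu; rewrite /= eq_sym.
Qed.

End Homogeneous.

Section BFunction.
Context (K : fieldType) (n : nat) (Q : qdatum K n) (G : qgroup Q).
Notation t := (qt Q).
Notation a := (qa Q).
Notation H := (cpair a).
Notation E := (gE G).
Notation F := (gF G).
Notation KK := (gK G).
Notation KV := (gV G).
Notation sh := (qshuffle (qP Q)).
Notation Fs := (@Fsh K n (qP Q)).
Implicit Types (x y z : G) (mu nu : weight n).

Let t0 := qt_neq0 Q.
Let tD i (m k : int) : t i ^ (m + k) = t i ^ m * t i ^ k.
Proof. by rewrite expfzDr ?t0. Qed.
Let tn0 i (m : int) : t i ^ m != 0.
Proof. by rewrite expfz_neq0 ?t0. Qed.

Context (Delta : G -> tensor G G) (form : G -> G -> K).
Hypothesis Delta_lin : linear Delta.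
Hypothesis Delta1 : Delta 1 = 1.
Hypothesis DeltaM : {morph Delta : x y / x * y}.
Hypothesis DeltaK : forall i, Delta (KK i) = tens (KK i) (KK i).
Hypothesis DeltaE : forall i, Delta (E i) = tens (E i) (KV i) + tens 1 (E i).
Hypothesis DeltaF : forall i, Delta (F i) = tens (F i) 1 + tens (KK i) (F i).
Hypothesis formLl : forall c y y' x, bminus y -> bminus y' -> bplus x ->
  form (c *: y + y') x = c * form y x + form y' x.
Hypothesis form_mulr : forall y x x' s, bminus y -> bplus x -> bplus x' ->
  tens_sum (Delta y) s ->
  (forall p, p \in s -> bminus p.1 /\ bminus p.2) ->
  form y (x * x') = \sum_(p <- s) form p.1 x' * form p.2 x.
Hypothesis form_mull : forall y y' x s, bminus y -> bminus y' -> bplus x ->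
  tens_sum (Delta x) s ->
  (forall p, p \in s -> bplus p.1 /\ bplus p.2) ->
  form (y * y') x = \sum_(p <- s) form y p.1 * form y' p.2.
Hypothesis formKK : forall i j, form (KK i) (KK j) = t i ^ (- a i j).
Hypothesis formFE : forall i j,
  form (F i) (E j) = - ((i == j)%:R / (t i - (t i)^-1)).
Hypothesis formFK : forall i j, form (F i) (KK j) = 0.
Hypothesis formKE : forall i j, form (KK i) (E j) = 0.
Hypothesis formLr : forall c y x x', bminus y -> bplus x -> bplus x' ->
  form y (c *: x + x') = c * form y x + form y x'.

Let tens_sum1 (y z : G) : tens_sum (tens y z) [:: (y, z)].
Proof. by rewrite /tens_sum big_seq1. Qed.
Let tens_sum2 (y z y' z' : G) : tens_sum (tens y z + tens y' z') [:: (y, z); (y', z')].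
Proof. by rewrite /tens_sum big_cons big_seq1. Qed.

Lemma DeltaV i : Delta (KV i) = tens (KV i) (KV i).
Proof.
have h : tens (KV i) (KV i) * (tens (KK i) (KK i) * Delta (KV i)) = tens (KV i) (KV i).
  by rewrite -DeltaK -DeltaM gKV Delta1 mulr1.
by rewrite -h mulrA tensM gVK tens11 mul1r.
Qed.

Lemma form_mull_K y y' j : bminus y -> bminus y' ->
  form (y * y') (KK j) = form y (KK j) * form y' (KK j).
Proof.
move=> hy hy'; rewrite (form_mull hy hy' (bplusK j) (s := [:: (KK j, KK j)])) ?big_seq1 //.
  by rewrite DeltaK; apply: tens_sum1.
by move=> p; rewrite inE => /eqP ->; split; apply: bplusK.
Qed.

Lemma form_mull_V y y' j : bminus y -> bminus y' ->
  form (y * y') (KV j) = form y (KV j) * form y' (KV j).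
Proof.
move=> hy hy'; rewrite (form_mull hy hy' (bplusV j) (s := [:: (KV j, KV j)])) ?big_seq1 //.
  by rewrite DeltaV; apply: tens_sum1.
by move=> p; rewrite inE => /eqP ->; split; apply: bplusV.
Qed.

Lemma form_mull_1 y y' : bminus y -> bminus y' ->
  form (y * y') 1 = form y 1 * form y' 1.
Proof.
move=> hy hy'; rewrite (form_mull hy hy' (gsub1 _) (s := [:: (1, 1)])) ?big_seq1 //.
  by rewrite Delta1 -tens11; apply: tens_sum1.
by move=> p; rewrite inE => /eqP ->; split; apply: gsub1.
Qed.

Lemma form_mull_E y y' j : bminus y -> bminus y' ->
  form (y * y') (E j) = form y (E j) * form y' (KV j) + form y 1 * form y' (E j).
Proof.
move=> hy hy'.
rewrite (form_mull hy hy' (bplusE j) (s := [:: (E j, KV j); (1, E j)])).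
- by rewrite big_cons big_seq1.
- by rewrite DeltaE; apply: tens_sum2.
move=> p; rewrite !inE => /orP[] /eqP ->; split;
  by [apply: bplusE|apply: bplusV|apply: gsub1].
Qed.

Lemma form_K_mulr i x x' : bplus x -> bplus x' ->
  form (KK i) (x * x') = form (KK i) x' * form (KK i) x.
Proof.
move=> hx hx'; rewrite (form_mulr (bminusK i) hx hx' (s := [:: (KK i, KK i)])) ?big_seq1 //.
  by rewrite DeltaK; apply: tens_sum1.
by move=> p; rewrite inE => /eqP ->; split; apply: bminusK.
Qed.

Lemma form_1_mulr x x' : bplus x -> bplus x' ->
  form 1 (x * x') = form 1 x' * form 1 x.
Proof.
move=> hx hx'; rewrite (form_mulr (gsub1 _) hx hx' (s := [:: (1, 1)])) ?big_seq1 //.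
  by rewrite Delta1 -tens11; apply: tens_sum1.
by move=> p; rewrite inE => /eqP ->; split; apply: gsub1.
Qed.

Lemma form_F_mulr i x x' : bplus x -> bplus x' ->
  form (F i) (x * x') = form (F i) x' * form 1 x + form (KK i) x' * form (F i) x.
Proof.
move=> hx hx'.
rewrite (form_mulr (bminusF i) hx hx' (s := [:: (F i, 1); (KK i, F i)])).
- by rewrite big_cons big_seq1.
- by rewrite DeltaF; apply: tens_sum2.
move=> p; rewrite !inE => /orP[] /eqP ->; split;
  by [apply: bminusF|apply: bminusK|apply: gsub1].
Qed.

(** The values of the form at 1 are not among the axioms. They come out of multiplicativity by
    cancelling a nonzero value [(K_i, K_j)], here and in the next lemmas. *)
Lemma form_K1 i : form (KK i) 1 = 1.
Proof.
have := form_K_mulr i (bplusK i) (gsub1 _); rewrite mulr1 formKK.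
by rewrite -[X in X = _]mul1r => /(mulIf (tn0 _ _)).
Qed.

Context (i0 : 'I_n).

Lemma form_1K j : form 1 (KK j) = 1.
Proof.
have := form_mull_K j (gsub1 _) (bminusK i0); rewrite mul1r formKK.
by rewrite -[X in X = _]mul1r => /(mulIf (tn0 _ _)).
Qed.

Lemma form_11 : form 1 1 = 1.
Proof.
have := form_1_mulr (bplusK i0) (gsub1 _); rewrite mulr1 form_1K => /esym.
by rewrite mulr1.
Qed.

Lemma form_1V j : form 1 (KV j) = 1.
Proof.
have := form_1_mulr (bplusK j) (bplusV j); rewrite gKV form_11 form_1K => /esym.
by rewrite mulr1.
Qed.

Lemma form_1E j : form 1 (E j) = 0.
Proof.
have := form_mull_E j (gsub1 _) (gsub1 _); rewrite mulr1 form_1V form_11 mulr1 mul1r.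
by move/eqP; rewrite -subr_eq subrr eq_sym => /eqP.
Qed.

Lemma form_F1 i : form (F i) 1 = 0.
Proof.
have := form_F_mulr i (gsub1 _) (gsub1 _); rewrite mulr1 form_11 form_K1 mulr1 mul1r.
by move/eqP; rewrite -subr_eq subrr eq_sym => /eqP.
Qed.

Lemma form_FV i j : form (F i) (KV j) = 0.
Proof.
have := form_F_mulr i (bplusK j) (bplusV j).
by rewrite gKV form_F1 form_1K formFK mulr0 addr0 mulr1 => /esym.
Qed.

Lemma form_0l x : bplus x -> form 0 x = 0.
Proof.
move=> hx; have := formLl (-1) (gsub0 _) (gsub0 _) hx.
by rewrite scaleN1r oppr0 addr0 mulN1r addNr.
Qed.

Lemma form_suml (s : seq (G * G)) (c : G * G -> K) (u : G * G -> G) x : bplus x ->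
  (forall p, p \in s -> bminus (u p)) ->
  form (\sum_(p <- s) c p *: u p) x = \sum_(p <- s) c p * form (u p) x.
Proof.
move=> hx; elim: s => [|p s IH] hs; first by rewrite !big_nil form_0l.
have hs' r : r \in s -> bminus (u r) by move=> rs; apply: hs; rewrite in_cons rs orbT.
rewrite !big_cons formLl ?IH //; first by apply: hs; rewrite mem_head.
rewrite big_seq; elim/big_rec: _ => [|r z rs hz]; first exact: gsub0.
by apply: gsubD => //; apply: gsubZ; apply: hs'.
Qed.

Definition decomposable (P1 P2 : G -> Prop) (u : tensor G G) : Prop :=
  exists2 s, tens_sum u s & forall p, p \in s -> P1 p.1 /\ P2 p.2.

Lemma dec_lin (P1 P2 : G -> Prop) c u v : (forall b y, P1 y -> P1 (b *: y)) ->
  decomposable P1 P2 u -> decomposable P1 P2 v -> decomposable P1 P2 (c *: u + v).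
Proof.
move=> hP [s es hs] [r er hr]; exists ([seq (c *: p.1, p.2) | p <- s] ++ r).
  rewrite /tens_sum es er big_cat big_map scaler_sumr; congr (_ + _).
  by apply: eq_bigr => p _; rewrite tensZl.
move=> p; rewrite mem_cat => /orP[/mapP[p' /hs[h1 h2] ->]|/hr] //.
by split=> //; apply: hP.
Qed.

Lemma dec_mul (P1 P2 : G -> Prop) u v :
  (forall y z, P1 y -> P1 z -> P1 (y * z)) ->
  (forall y z, P2 y -> P2 z -> P2 (y * z)) ->
  decomposable P1 P2 u -> decomposable P1 P2 v -> decomposable P1 P2 (u * v).
Proof.
move=> h1 h2 [s es hs] [r er hr].
exists (flatten [seq [seq (p.1 * p'.1, p.2 * p'.2) | p' <- r] | p <- s]).
  rewrite /tens_sum es er big_flatten big_map mulr_suml; apply: eq_bigr => p _.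
  by rewrite big_map mulr_sumr; apply: eq_bigr => p' _; rewrite tensM.
move=> p /flattenP[_ /mapP[p1 /hs[h3 h4] ->] /mapP[p2 /hr[h5 h6] ->]].
by split; [apply: h1|apply: h2].
Qed.

(** In [Delta (F i)] the element [K_i] occurs in the left factor only. The right factors thus stay
    in [U_q(n^-)], where [form_counit] does not distinguish [K_i] from 1. *)
Lemma Delta_nminus y : span F y -> decomposable bminus (span F) (Delta y).
Proof.
have hZ b z : bminus z -> bminus (b *: z) by apply: gsubZ.
elim/span_lin_ind => [|c u v hu hv|w].
- exists [::] => //; have := Delta_lin (-1) 0 0.
  by rewrite /tens_sum big_nil scaleN1r oppr0 addr0 scaleN1r addNr.
- by rewrite Delta_lin; apply: dec_lin.
elim: w => [|i w IH].
  rewrite wmon_nil Delta1 -tens11; exists [:: (1, 1)]; first exact: tens_sum1.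
  move=> p; rewrite inE => /eqP ->; split; first exact: gsub1.
  by rewrite -(wmon_nil F); apply: span_mon.
rewrite wmon_cons DeltaM; apply: dec_mul IH => //; [exact: gsubM|exact: spanM|].
rewrite DeltaF; exists [:: (F i, 1); (KK i, F i)]; first exact: tens_sum2.
move=> p; rewrite !inE => /orP[] /eqP ->; split.
- exact: bminusF.
- by rewrite -(wmon_nil F); apply: span_mon.
- exact: bminusK.
exact: span_gen.
Qed.

Lemma form_counit y j : span F y -> form y (KK j) = form y 1 /\ form y (KV j) = form y 1.
Proof.
move=> hy; suff [] : bminus y /\ (form y (KK j) = form y 1 /\ form y (KV j) = form y 1) by [].
elim/span_lin_ind: y / hy => [|c u v [hu [u1 u2]] [hv [v1 v2]]|w].
- rewrite !form_0l; [by split; first exact: gsub0|..];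
  by [apply: gsub1|apply: bplusV|apply: bplusK].
- split; first by apply: gsubD => //; apply: gsubZ.
  rewrite !formLl ?u1 ?u2 ?v1 ?v2 //; by [apply: gsub1|apply: bplusV|apply: bplusK].
split; first exact/span_bminus/span_mon.
elim: w => [|i w [IH1 IH2]]; first by rewrite wmon_nil form_1K form_1V form_11.
have hw : bminus (wmon F w) by apply/span_bminus/span_mon.
have hF : bminus (F i) := bminusF i.
by rewrite wmon_cons form_mull_K ?form_mull_V ?form_mull_1 // formFK form_FV form_F1 !mul0r.
Qed.

(** The pairing reverses the order of factors, so [KV i] on the left of [x] meets the right tensor
    factors of [Delta y], which lie in [U_q(n^-)]. *)
Lemma form_Vx y i x : span F y -> bplus x -> form y (KV i * x) = form y x.
Proof.
move=> hy hx; have [s es hs] := Delta_nminus hy; have sy := span_bminus hy.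
have hs' p : p \in s -> bminus p.1 /\ bminus p.2.
  by move=> /hs[h1 h2]; split => //; apply: span_bminus.
rewrite (form_mulr sy (bplusV i) hx es hs') -[x in RHS]mul1r.
rewrite (form_mulr sy (gsub1 _) hx es hs') big_seq [RHS]big_seq.
apply: eq_bigr => p /hs[_ h2]; congr (_ * _).
by have [_] := form_counit i h2.
Qed.

Lemma form_Kx y i x : span F y -> bplus x -> form y (KK i * x) = form y x.
Proof.
move=> hy hx; have [s es hs] := Delta_nminus hy; have sy := span_bminus hy.
have hs' p : p \in s -> bminus p.1 /\ bminus p.2.
  by move=> /hs[h1 h2]; split => //; apply: span_bminus.
rewrite (form_mulr sy (bplusK i) hx es hs') -[x in RHS]mul1r.
rewrite (form_mulr sy (gsub1 _) hx es hs') big_seq [RHS]big_seq.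
apply: eq_bigr => p /hs[_ h2]; congr (_ * _).
by have [] := form_counit i h2.
Qed.

(* The derivation of U_q(n^-) adjoint to the right multiplication by E_i. *)
Lemma form_xE y i : span F y -> exists2 y', span F y' &
  (forall x, bplus x -> form y (x * E i) = form y' x) /\
  (forall j x, bplus x -> form (F j * y) (x * E i)
     = form (F j) (E i) * form y (x * KV i) + form (F j * y') x).
Proof.
move=> hy; have [s es hs] := Delta_nminus hy; have sy := span_bminus hy.
have hs' p : p \in s -> bminus p.1 /\ bminus p.2.
  by move=> /hs[h1 h2]; split => //; apply: span_bminus.
have hE : bplus (E i) := bplusE i; have hV : bplus (KV i) := bplusV i.
exists (\sum_(p <- s) form p.1 (E i) *: p.2).
  rewrite big_seq; elim/big_rec: _ => [|p z /hs[_ h2] hz]; first exact: span0.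
  exact: spanL.
split=> [x hx|j x hx].
  rewrite (form_mulr sy hx hE es hs') (form_suml (fun p => form p.1 (E i)) (u := snd) hx) //.
  by move=> p /hs'[].
have hF : bminus (F j) := bminusF j; have hK : bminus (KK j) := bminusK j.
pose s1 := [seq (F j * p.1, p.2) | p <- s]; pose s2 := [seq (KK j * p.1, F j * p.2) | p <- s].
have es' : tens_sum (Delta (F j * y)) (s1 ++ s2).
  rewrite /tens_sum DeltaM DeltaF es mulrDl big_cat !big_map !mulr_sumr.
  by congr (_ + _); apply: eq_bigr => p _; rewrite tensM ?mul1r.
rewrite (form_mulr _ hx hE es'); first last.
- move=> p; rewrite mem_cat => /orP[] /mapP[p' /hs'[h1 h2] ->]; split => //; exact: gsubM.
- exact: gsubM.
rewrite big_cat !big_map /=; congr (_ + _).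
  rewrite (form_mulr sy hx hV es hs') mulr_sumr big_seq [RHS]big_seq.
  apply: eq_bigr => p /hs'[h1 h2].
  by rewrite form_mull_E // form_F1 mul0r addr0 mulrA.
have -> : F j * (\sum_(p <- s) form p.1 (E i) *: p.2)
    = \sum_(p <- s) form p.1 (E i) *: (F j * p.2).
  by rewrite mulr_sumr; apply: eq_bigr => p _; rewrite scalerAr.
rewrite (form_suml (fun p => form p.1 (E i)) (u := fun p => F j * p.2) hx) //.
  rewrite big_seq [RHS]big_seq; apply: eq_bigr => p /hs'[h1 h2].
  by rewrite form_mull_E // formKE mul0r add0r form_K1 mul1r.
by move=> p /hs'[h1 h2]; apply: gsubM.
Qed.

Definition cform i : K := form (F i) (E i).
Definition cword w : K := \prod_(i <- w) cform i.

Lemma cform_neq0 i : cform i != 0.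
Proof.
by rewrite /cform formFE eqxx oppr_eq0 mul1r invr_eq0 tV_neq0.
Qed.

Lemma cword_neq0 w : cword w != 0.
Proof.
rewrite /cword; elim: w => [|i w IH]; first by rewrite big_nil oner_eq0.
by rewrite big_cons mulf_neq0 // cform_neq0.
Qed.

(** Dividing by [cword] makes [Psi (F i)] the letter [i] and makes [Psi] multiplicative without
    scalars. *)
Definition Psi y : sh := fun w => (cword w)^-1 * form y (wmon E w).

Lemma PsiL c y z : bminus y -> bminus z -> Psi (c *: y + z) = c *: Psi y + Psi z.
Proof.
move=> hy hz; apply/funext => w; rewrite shufD shufZ /Psi formLl //; last exact: mon_bplus.
by rewrite mulrDr mulrCA.
Qed.

Lemma Psi1 : Psi 1 = 1.
Proof.
apply/funext => w; rewrite /Psi shuf1E.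
case: (lastP w) => [|u i]; first by rewrite /cword big_nil wmon_nil form_11 invr1 mulr1.
rewrite wmon_rcons form_1_mulr; [|exact: mon_bplus|exact: bplusE].
by rewrite form_1E mul0r mulr0; case: u.
Qed.

(** Induction on the last letter: pairing with [x E_i] is a derivation by [form_xE], with the
    Leibniz rule of [rder i]. Its twist arises when [KV i] is moved to the left of the word in the
    [E], where it has no effect. *)
Lemma PsiF j y : span F y -> Psi (F j * y) = Fs j * Psi y.
Proof.
move=> hy; apply/funext => w; elim/last_ind: w y hy => [|w i IH] y hy.
  rewrite /Psi wmon_nil form_mull_1; [|exact: bminusF|exact: span_bminus].
  by rewrite form_F1 mul0r mulr0 shufM_nil mul0r.
have [y' hy' [e1 e2]] := form_xE i hy.
have hw : bplus (wmon E w) := mon_bplus w.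
have er : rder i (Psi y) = (cform i)^-1 *: Psi y'.
  apply/funext => u; rewrite /rder shufZ /Psi wmon_rcons e1; last exact: mon_bplus.
  by rewrite /cword -cats1 big_cat big_seq1 invfM mulrA [_ * (cform i)^-1]mulrC.
rewrite -[RHS]/(rder i (Fs j * Psi y) w) rderM; last exact: qt_sym.
rewrite rderF er -scalerAl mul1r -scalerAr shufD !shufZ twistE -(IH y' hy').
rewrite /Psi wmon_rcons e2 // EV_mon.
have -> : form y (t i ^ H i (wt w) *: (KV i * wmon E w))
    = t i ^ H i (wt w) * form y (wmon E w).
  have h := formLr (t i ^ H i (wt w)) (span_bminus hy) (gsubM (bplusV i) hw) (gsub0 _).
  rewrite addr0 in h; rewrite h form_Vx //.
  have -> : form y 0 = 0; last by rewrite addr0.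
  have := formLr (-1) (span_bminus hy) (gsub0 _) (gsub0 _).
  by rewrite scaleN1r oppr0 addr0 mulN1r addNr.
rewrite mulrDr /cword -cats1 big_cat big_seq1 invfM -/(cword w); congr (_ + _).
  have -> : form (F j) (E i) = (i == j)%:R * cform i.
    have [->|ij] := eqVneq i j; first by rewrite mul1r.
    by rewrite formFE eq_sym (negPf ij) mul0r oppr0 mul0r.
  by have := cform_neq0 i; have := cword_neq0 w => ? ?; field; apply/andP.
by rewrite mulrCA mulrA.
Qed.

Lemma Psi0 : Psi 0 = 0.
Proof. by apply/funext => w; rewrite /Psi form_0l ?mulr0 //; apply: mon_bplus. Qed.

Lemma Psi_mon w : Psi (wmon F w) = wmon Fs w.
Proof.
elim: w => [|i w IH]; first by rewrite !wmon_nil Psi1.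
by rewrite !wmon_cons PsiF ?IH //; apply: span_mon.
Qed.

Lemma PsiM y z : span F y -> span F z -> Psi (y * z) = Psi y * Psi z.
Proof.
move=> hy hz; suff [] : span F y /\ Psi (y * z) = Psi y * Psi z by [].
elim/span_lin_ind: y / hy => [|c u v [hu eu] [hv ev]|w].
- by rewrite mul0r Psi0 mul0r; split=> //; apply: span0.
- split; first exact: spanL.
  rewrite mulrDl -scalerAl !PsiL; try by apply: span_bminus => //; apply: spanM.
  by rewrite eu ev mulrDl -scalerAl.
split; first exact: span_mon.
elim: w => [|i w IH]; first by rewrite wmon_nil Psi1 !mul1r.
rewrite wmon_cons -mulrA PsiF; last by apply: spanM => //; apply: span_mon.
by rewrite IH PsiF ?mulrA //; apply: span_mon.
Qed.

Lemma Psi_lincomb s : Psi (lincomb F s) = lincomb Fs s.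
Proof.
elim: s => [|p s IH]; first by rewrite /lincomb !big_nil Psi0.
rewrite /lincomb !big_cons PsiL ?Psi_mon; first by congr (_ + _).
  exact/span_bminus/span_mon.
by apply: span_bminus; exists s.
Qed.

Lemma form_mulK2 l i x : span F l -> bplus x ->
  form (l * (KK i * KK i)) (KK i * x) = t i ^ (-4) * form (l * (KK i * KK i)) x.
Proof.
move=> hl hx; have [s es hs] := Delta_nminus hl; pose k := KK i * KK i.
have hk : bminus k by apply: gsubM; apply: bminusK.
pose s' := [seq (p.1 * k, p.2 * k) | p <- s].
have hy : bminus (l * k) by apply: gsubM => //; apply: span_bminus.
have hs' p : p \in s' -> bminus p.1 /\ bminus p.2.
  by move=> /mapP[p' /hs[h1 h2] ->]; split; apply: gsubM => //; apply: span_bminus.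
have es' : tens_sum (Delta (l * k)) s'.
  rewrite /tens_sum big_map !DeltaM DeltaK tensM es mulr_suml.
  by apply: eq_bigr => p _; rewrite tensM.
have fk1 : form k 1 = 1 by rewrite form_mull_1 ?form_K1 ?mulr1 //; apply: bminusK.
have fkK : form k (KK i) = t i ^ (-4).
  rewrite form_mull_K; try exact: bminusK.
  by rewrite formKK qa_diag -tD.
rewrite (form_mulr hy (bplusK i) hx es' hs') -[x in RHS]mul1r.
rewrite (form_mulr hy (gsub1 _) hx es' hs') !big_map mulr_sumr big_seq [RHS]big_seq.
apply: eq_bigr => p /hs[_ h2]; have [fK _] := form_counit i h2.
have hp := span_bminus h2.
by rewrite /= form_mull_K // form_mull_1 // fkK fk1 fK mulr1 mulrA [RHS]mulrC.
Qed.

(** A factor [K_i] on the left of the second argument has no effect on the pairing with [U_q(n^-)],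
    but multiplies the pairing with [l K_i^2] by [(K_i^2, K_i) = t^-4]. An element of both kinds
    pairs to 0. *)
Lemma Psi_mulK2 l r i c : span F l -> span F r ->
  c *: (l * (KK i * KK i)) = r -> Psi r = 0.
Proof.
move=> hl hr e; apply/funext => w; have hw : bplus (wmon E w) := mon_bplus w.
have hk : bminus (l * (KK i * KK i)).
  by apply: gsubM; [exact: span_bminus|apply: gsubM; apply: bminusK].
have fZ x : bplus x -> form r x = c * form (l * (KK i * KK i)) x.
  move=> hx; rewrite -e; have := formLl c hk (gsub0 _) hx.
  by rewrite form_0l // !addr0.
have := form_Kx i hr hw; rewrite !fZ //; last by apply: gsubM => //; apply: bplusK.
have h4 : t i ^ (-4) != 1 by apply: qt_generic.
rewrite form_mulK2 // mulrCA -fZ // => /eqP; rewrite -subr_eq0 -[X in _ - X]mul1r -mulrBl.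
by rewrite mulf_eq0 subr_eq0 (negPf h4) => /eqP h; rewrite /Psi h mulr0.
Qed.

Definition kform (mu : weight n) : K := \prod_i cform i ^ mu i.

Lemma kformD mu nu : kform (mu + nu) = kform mu * kform nu.
Proof.
rewrite -big_split; apply: eq_bigr => i _.
by rewrite ffunE expfzDr // cform_neq0.
Qed.

Lemma kform0 : kform 0 = 1.
Proof. by apply: big1 => i _; rewrite ffunE. Qed.

Lemma kformMn mu k : kform (mu *+ k) = kform mu ^+ k.
Proof. by elim: k => [|k IH]; rewrite ?kform0 // mulrS kformD IH exprS. Qed.

Lemma kform_wt w : kform (wt w) = cword w.
Proof.
rewrite /cword; elim: w => [|i w IH]; first by rewrite wt_nil kform0 big_nil.
rewrite wt_cons kformD IH big_cons; congr (_ * _).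
rewrite /kform (bigD1 i) //= big1 => [|j ji]; rewrite ffunE ?eqxx ?mulr1 //.
by rewrite eq_sym (negPf ji).
Qed.

Lemma kform_neq0 mu : kform mu != 0.
Proof. by apply/prodf_neq0 => i _; rewrite expfz_neq0 // cform_neq0. Qed.

(** [tr] takes a word in the [F] to the reversed word in the [E], hence the [shrev]. The
    normalization in [Psi] is undone by a factor that depends on the weight alone. *)
Lemma form_tr (tr : G -> G) mu y z : linear tr -> tr 1 = 1 ->
  (forall u v, tr (u * v) = tr v * tr u) -> (forall i, tr (F i) = E i) ->
  span F y -> hom F mu z ->
  form y (tr z) = kform mu * pr (shrev (Psi z)) (Psi y).
Proof.
move=> trL tr1 trM trF hy hz; have sy := span_bminus hy.
have f0 : form y 0 = 0.
  have := formLr (-1) sy (gsub0 _) (gsub0 _).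
  by rewrite scaleN1r oppr0 addr0 mulN1r addNr.
have tr0 : tr 0 = 0.
  by have := trL (-1) 0 0; rewrite scaleN1r oppr0 addr0 scaleN1r addNr.
have spy : span Fs (Psi y) by case: hy => s ->; exists s; apply: Psi_lincomb.
have trW w : tr (wmon F w) = wmon E (rev w).
  elim: w => [|i w IH]; first by rewrite wmon_nil tr1 wmon_nil.
  by rewrite wmon_cons trM IH trF rev_cons wmon_rcons.
case: hz => s hs ->.
have trL' r : bplus (tr (lincomb F r)) /\
    form y (tr (lincomb F r)) = \sum_(p <- r) p.1 * form y (wmon E (rev p.2)).
  elim: r => [|p r [IH1 IH2]].
    by rewrite /lincomb !big_nil tr0 f0; split=> //; apply: gsub0.
  rewrite /lincomb !big_cons trL trW formLr //; last exact: mon_bplus.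
  by rewrite IH2; split=> //; apply: gsubD => //; apply/gsubZ/mon_bplus.
have -> : shrev (Psi (lincomb F s)) = lincomb Fs [seq (p.1, rev p.2) | p <- s].
  rewrite Psi_lincomb /lincomb linear_sum big_map; apply: eq_bigr => p _.
  by rewrite -shrev_mon linearZ.
have [_ ->] := trL' s.
rewrite pr_lincomb // /evalw big_map mulr_sumr big_seq [RHS]big_seq.
apply: eq_bigr => p /hs hp; rewrite /Psi mulrCA -hp -wt_rev kform_wt mulVKf //.
exact: cword_neq0.
Qed.

Hypothesis a_le0 : forall i j, i != j -> a i j <= 0.
Hypothesis a_def : forall nu : weight n,
  (forall i, nu i * H i nu <= 0) -> nu = 0.

Let PL c y z : span F y -> span F z -> Psi (c *: y + z) = c *: Psi y + Psi z.
Proof. by move=> hy hz; apply: PsiL; apply: span_bminus. Qed.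
Let PF i : Psi (F i) = Fs i.
Proof.
rewrite -[F i]mulr1 PsiF ?Psi1 ?mulr1 //.
by rewrite -(wmon_nil F); apply: span_mon.
Qed.
Let inj mu y : hom F mu y -> Psi y = 0 -> y = 0.
Proof. exact: (Psi_inj PL PsiM Psi1 PF a_le0 a_def). Qed.
Lemma Psi_component mu s w :
  Psi (lincomb F (component mu s)) w = (wt w == mu)%:R * Psi (lincomb F s) w.
Proof.
rewrite !Psi_lincomb /lincomb !shuf_sum big_filter big_mkcond mulr_sumr.
apply: eq_bigr => p _; rewrite !shufZ.
have [e|e] := eqVneq (wt w) mu; have [e'|e'] := eqVneq (wt p.2) mu.
- by rewrite mul1r.
- rewrite (hom_supported (hom_mon Fs p.2)) ?mulr0 //.
  by rewrite e eq_sym.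
- rewrite mul0r (hom_supported (hom_mon Fs p.2)) ?mulr0 //.
  by rewrite e'.
by rewrite mul0r.
Qed.

(* Since the Cartan matrix is nondegenerate, the eigenvalues of the K_i
   determine the weight. *)
Lemma weight_homogeneous f (m : 'I_n -> int) : span F f -> f != 0 ->
  (forall j, KK j * f * KV j = t j ^ (- m j) *: f) ->
  exists2 c0, hom F c0 f & forall j, H j c0 = m j.
Proof.
move=> [s fE] f0 hf.
have nz (u v : sh) w : u w != 0 -> v w = 0 -> u != v.
  by move=> h1 h2; apply: contraNneq h1 => ->; rewrite h2.
have hw w : Psi f w != 0 -> forall j, H j (wt w) = m j.
  move=> fw j; have : Psi (KK j * f * KV j) w = t j ^ (- H j (wt w)) * Psi f w.
    have -> : KK j * f * KV j = \sum_(mu <- undup [seq wt p.2 | p <- s])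
       t j ^ (- H j mu) *: lincomb F (component mu s).
      rewrite fE (sum_components F s) mulr_sumr mulr_suml; apply: eq_bigr => mu _.
      exact/KF_hom/component_hom.
    rewrite (Psi_sum PL) => [|mu]; last first.
      rewrite -[_ *: _]addr0; apply: spanL; last exact: span0.
      exact: span_hom (component_hom F mu s).
    have fE2 : Psi f w = \sum_(mu <- undup [seq wt p.2 | p <- s])
       Psi (lincomb F (component mu s)) w.
      rewrite {1}fE (sum_components F s) (Psi_sum PL) ?shuf_sum // => mu.
      exact: span_hom (component_hom F mu s).
    rewrite fE2 shuf_sum mulr_sumr; apply: eq_bigr => mu _.
    have sc := span_hom (component_hom F mu s).
    have := PL (t j ^ (- H j mu)) sc (span0 F); rewrite addr0 Psi0 addr0 => ->.
    rewrite shufZ Psi_component; case: eqP => [->//|_].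
    by rewrite mul0r !mulr0.
  rewrite hf; have sf : span F f by exists s.
  have := PL (t j ^ (- m j)) sf (span0 F); rewrite addr0 Psi0 addr0 => ->.
  rewrite shufZ => /(mulIf fw) h.
  have [e|hm] := eqVneq (H j (wt w) - m j) 0; first by lia.
  have /eqP[] := qt_generic Q j hm.
  apply: (mulIf (tn0 j (- H j (wt w)))); rewrite -tD mul1r.
  by rewrite -h; congr (_ ^ _); lia.
have [w fw] : exists w, Psi f w != 0.
  apply: contrapT => h; case/eqP: f0; rewrite fE (sum_components F s) big1 // => mu _.
  apply: (inj (component_hom F mu s)); apply/funext => w; rewrite Psi_component -fE.
  have [->|fw] := eqVneq (Psi f w) 0; first by rewrite mulr0.
  by case: h; exists w.
exists (wt w); last exact: hw.
have -> : f = lincomb F (component (wt w) s); last exact: component_hom.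
have sc mu := component_hom F mu s.
have cz mu : mu != wt w -> lincomb F (component mu s) = 0.
  move=> hmu; apply: (inj (sc mu)); apply/funext => v; rewrite Psi_component -fE.
  case: eqP => [ev|_]; last by rewrite mul0r.
  rewrite mul1r; have [//|fv] := eqVneq (Psi f v) 0.
  case/eqP: hmu; rewrite -ev; apply/eqP; rewrite -subr_eq0; apply/eqP/a_def => i.
  by rewrite cpairD cpairN !hw // subrr mulr0.
rewrite {1}fE (sum_components F s).
have [hin|hin] := boolP (wt w \in undup [seq wt p.2 | p <- s]).
  by rewrite (bigD1_seq _ hin) ?undup_uniq //= big1 ?addr0.
case/eqP: f0; rewrite fE (sum_components F s) big_seq big1 // => mu hmu.
by apply: cz; apply: contraNneq hin => <-.
Qed.

Context (pos : K -> Prop) (cj : K -> K).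
Hypothesis PC : positive_cone pos cj.
Hypothesis pos_t : forall i (m : int), pos (t i ^ m).
Hypothesis pos_t1 : forall i (m : int), 0 < m -> pos (t i ^ m - 1).
Hypothesis cj_t : forall i (m : int), cj (t i ^ m) = t i ^ m.
Context (Pcl : weight n -> Prop).
Hypothesis CD : commutative_datum Q i0 Pcl.
Context (tr : G -> G).
Hypothesis tr_lin : linear tr.
Hypothesis tr1 : tr 1 = 1.
Hypothesis trM : forall u v, tr (u * v) = tr v * tr u.
Hypothesis trF : forall i, tr (F i) = E i.

Theorem qgroup_bfunction f : span F f -> f != 0 ->
  (forall i, i != i0 -> E i * f = f * E i) ->
  (forall j, KK j * f * KV j = t j ^ (- ((j == i0)%:Z *+ 2)) *: f) ->
  exists c0, [/\ hom F c0 f, forall s, form (f ^+ s) (tr (f ^+ s)) != 0 &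
    exists p : {poly K}, forall s,
      form (f ^+ s.+1) (tr (f ^+ s.+1)) = p.[t i0 ^+ s] * form (f ^+ s) (tr (f ^+ s))].
Proof.
move=> sf f0 hE hK; have [c0 hf c0E] := weight_homogeneous sf f0 hK.
exists c0; pose phi := Psi f.
have PD : positive_datum Q pos cj.
  by split=> //; apply: (qgroup_integrable PL PsiM Psi1 PF a_le0).
have phiZ : Zs i0 c0 1 phi.
  split; first by rewrite mulr1n; apply: (Psi_homog PL PsiM Psi1 PF hf).
  by move=> i ii0; apply: (highest_weight_der PL PsiM Psi1 PF Psi_mulK2 a_le0 a_def hf (hE _ ii0)).
have phi0 : phi != 0 by apply: contra_neq f0; apply: inj hf.
have hX s : hom F (c0 *+ s) (f ^+ s) by apply: homX.
have PX s : Psi (f ^+ s) = phi ^+ s.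
  elim: s => [|s IH]; first by rewrite Psi1.
  by rewrite !exprS PsiM ?IH //; apply: span_hom (hX s).
have rX s : shrev (phi ^+ s) = shrev phi ^+ s.
  elim: s => [|s IH]; first exact: shrev1.
  by rewrite exprSr shrevM ?IH -?exprS //; apply: qt_sym.
have fX s : form (f ^+ s) (tr (f ^+ s))
    = kform c0 ^+ s * pr (shrev phi ^+ s) (phi ^+ s).
  rewrite (form_tr tr_lin tr1 trM trF (span_hom (hX s)) (hX s)).
  by rewrite PX rX kformMn.
have k0 : kform c0 != 0 by apply: kform_neq0.
split=> // [s|].
  by rewrite fX mulf_neq0 ?expf_neq0 // (pr_powers_neq0 PD CD c0E phiZ phi0).
have [p hp] := shuffle_bfunction PD CD c0E phiZ phi0.
exists (kform c0 *: p) => s; rewrite !fX hp hornerZ exprS.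
by ring.
Qed.

Context (S : G -> G) (ad : G -> G -> G).
Hypothesis S1 : S 1 = 1.
Hypothesis SM : forall u v, S (u * v) = S v * S u.
Hypothesis SK : forall i, S (KK i) = KV i.
Hypothesis SE : forall i, S (E i) = - (E i * KK i).
Hypothesis adP : forall x s, tens_sum (Delta x) s ->
  forall y, ad x y = \sum_(p <- s) p.1 * y * S p.2.
Context (N : G -> Prop) (nform : G -> G -> K) (q : K).
Hypothesis N1 : N 1.
Hypothesis NM : forall x y, N x -> N y -> N (x * y).
Hypothesis Nspan : forall x, N x -> span F x.
Hypothesis nformL : forall c f f' g, N f -> N f' -> N g ->
  nform (c *: f + f') g = c * nform f g + nform f' g.
Hypothesis nformE : forall f g (c c' : 'I_n -> nat), N f -> N g ->
  (forall j, ad (KK j) f = t j ^ (- \sum_i a j i * (c i)%:Z) *: f) ->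
  (forall j, ad (KK j) g = t j ^ (- \sum_i a j i * (c' i)%:Z) *: g) ->
  nform f g = (q^-1 - q) ^+ c i0 * form f (tr g).
Hypothesis q2 : q^-1 - q != 0.

Let SV i : S (KV i) = KK i.
Proof.
have h : S (KV i) * KV i = 1.
  by move: (SM (KK i) (KV i)); rewrite gKV S1 SK => <-.
by rewrite -[LHS]mulr1 -(gVK G i) mulrA h mul1r.
Qed.

Lemma adK j y : ad (KK j) y = KK j * y * KV j.
Proof.
rewrite (adP (s := [:: (KK j, KK j)])) ?big_seq1 ?SK //.
by rewrite DeltaK /tens_sum big_seq1.
Qed.

Lemma ad_E j y : ad (E j) y = (E j * y - y * E j) * KK j.
Proof.
rewrite (adP (s := [:: (E j, KV j); (1, E j)])).
  by rewrite big_cons big_seq1 /= SV SE mul1r mulrN mulrBl !mulrA.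
by rewrite DeltaE /tens_sum big_cons big_seq1.
Qed.

Theorem nil_bfunction f (tf : G -> G) (b : nat -> K) : N f -> f != 0 ->
  (forall i, i != i0 -> ad (E i) f = 0) ->
  (forall j, ad (KK j) f = t j ^ (- 2%:Z * (j == i0)%:Z) *: f) ->
  (forall h h', N h -> N h' -> nform (tf h) h' = nform h (f * h')) ->
  (forall s, tf (f ^+ s.+1) = b s *: f ^+ s) ->
  exists p : {poly K}, forall s, b s = p.[t i0 ^+ s].
Proof.
move=> Nf f0 hE hK htf hb; have NX s : N (f ^+ s).
  by elim: s => [//|s IH]; rewrite exprS; apply: NM.
have hE' i : i != i0 -> E i * f = f * E i.
  move=> ii0; apply/eqP; rewrite -subr_eq0; apply/eqP.
  by rewrite -[LHS]mulr1 -(gKV G i) mulrA -ad_E hE // mul0r.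
have hK' j : KK j * f * KV j = t j ^ (- ((j == i0)%:Z *+ 2)) *: f.
  by rewrite -adK hK; congr (_ ^ _ *: _); lia.
have [c0 [hf nz [p hp]]] := qgroup_bfunction (Nspan Nf) f0 hE' hK'.
have c00 j : 0 <= c0 j by have [w <-] := hom_neq0 hf f0; rewrite wtE.
have hX s : hom F (c0 *+ s) (f ^+ s) by apply: homX.
have nX s : nform (f ^+ s) (f ^+ s)
    = (q^-1 - q) ^+ (`|c0 i0|%N * s) * form (f ^+ s) (tr (f ^+ s)).
  have hw j : ad (KK j) (f ^+ s)
      = t j ^ (- \sum_i a j i * (`|c0 i|%N * s)%:Z) *: f ^+ s.
    rewrite adK (KF_hom j (hX s)) cpairMn; congr (_ ^ (- _) *: _).
    rewrite /cpair -sumrMnl; apply: eq_bigr => i _.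
    by rewrite PoszM gez0_abs // mulrA -mulr_natr natz.
  exact: (nformE (NX s) (NX s) hw hw).
have bE s : b s * nform (f ^+ s) (f ^+ s) = nform (f ^+ s.+1) (f ^+ s.+1).
  have <- : nform (tf (f ^+ s.+1)) (f ^+ s) = nform (f ^+ s.+1) (f ^+ s.+1).
    by rewrite htf // -exprS.
  rewrite hb.
  (* Linearity of [nform] is given for [c f + f'] with both vectors in [N]; this way of writing the
     multiple keeps both equal to [f^s], without appeal to 0 in [N]. *)
  have -> : b s *: f ^+ s = (b s - 1) *: f ^+ s + f ^+ s by rewrite scalerBl scale1r subrK.
  by rewrite nformL //; ring.
(* [f] has degree [c0 i0], so each further factor [f] multiplies the normalization of [nform] by
   this fixed power. *)
exists ((q^-1 - q) ^+ `|c0 i0|%N *: p) => s.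
have ns0 : nform (f ^+ s) (f ^+ s) != 0 by rewrite nX mulf_neq0 ?expf_neq0.
apply: (mulIf ns0); rewrite bE !nX hp hornerZ mulnS exprD; ring.
Qed.

End BFunction.

(** * U_q(g) and U_q(n_I^-) as instances *)

Lemma foldr_morph (I : Type) (A : pzRingType) (T : I -> A -> A) w :
  (forall i, monoid_morphism (T i)) ->
  foldr T 1 w = 1 /\ forall x y, foldr T (x * y) w = foldr T x w * foldr T y w.
Proof.
move=> hT; elim: w => [//|i w [IH1 IHM]] /=; have [h1 hM] := hT i.
by rewrite IH1; split=> // x y; rewrite IHM hM.
Qed.

Section Uq.
Context (K : fieldType) (q : K) (n : nat) (Q : qdatum K n) (d : 'I_n -> nat).
Hypothesis Qt : qt Q = qi q d.
Notation a := (qa Q).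
Notation U := (Uq q a d).

Definition uq_qgroup : qgroup Q.
Proof.
refine (@QGroup K n Q U (uE q a d) (uF q a d) (uK q a d) (uKV q a d)
  (@uq_KKV K q n a d) (@uq_KVK K q n a d) _ _ _ _).
- rewrite Qt; exact (@uq_KE K q n a d).
- rewrite Qt; exact (@uq_KF K q n a d).
- rewrite Qt; exact (@uq_EF K q n a d).
- rewrite Qt; exact (@uq_serreF K q n a d).
Defined.

Notation G := uq_qgroup.

Lemma subalg_gen_gsub (S : U -> Prop) (x : U) : subalg_gen S x <-> @gsub K G S x.
Proof.
split; elim=> {x} [x|||c x|].
- exact: gsubS.
- exact: gsub1.
- by move=> x y _ hx _ hy; apply: gsubD hx hy.
- by move=> _ hx; apply: gsubZ hx.
- by move=> x y _ hx _ hy; apply: gsubM hx hy.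
- exact: subalg_genS.
- exact: subalg_gen1.
- by move=> x y _ hx _ hy; apply: subalg_genD hx hy.
- by move=> _ hx; apply: subalg_genZ hx.
- by move=> x y _ hx _ hy; apply: subalg_genM hx hy.
Qed.

Lemma uq_bminusP (x : U) : uq_bminus x <-> @bminus K n Q G x.
Proof. exact: subalg_gen_gsub. Qed.

Lemma uq_bplusP (x : U) : uq_bplus x <-> @bplus K n Q G x.
Proof. exact: subalg_gen_gsub. Qed.

Lemma uq_nminus_span (x : U) : uq_nminus x -> span (gF G) x.
Proof.
move=> /subalg_gen_gsub; elim=> {x} [x [i ->]||x y _ hx _ hy|c x _ hx|x y _ hx _ hy].
- exact: span_gen.
- by rewrite -(wmon_nil (gF G)); apply: span_mon.
- by rewrite -[x]scale1r; apply: spanL.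
- by rewrite -[_ *: _]addr0; apply: spanL => //; apply: span0.
- exact: spanM.
Qed.

Lemma braid_word_morph (T : 'I_n -> U -> U) w : is_braid T ->
  braid_word T w 1 = 1 /\ forall x y, braid_word T w (x * y) = braid_word T w x * braid_word T w y.
Proof.
move=> hT; apply: foldr_morph => i; have [_ hM _ _ _] := hT i; exact: hM.
Qed.

Lemma uq_nil1 T w : is_braid T -> uq_nil T w (1 : U).
Proof.
move=> hT; split; first exact: subalg_gen1.
exact: (eq_ind_r (@uq_nminus K q n a d) (@subalg_gen1 K q n a d _)
  (proj1 (braid_word_morph w hT))).
Qed.

Lemma uq_nilM T w (x y : U) : is_braid T -> uq_nil T w x -> uq_nil T w y ->
  uq_nil T w (x * y).
Proof.
move=> hT h h'; split; first exact: (subalg_genM (proj1 h) (proj1 h')).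
exact: (eq_ind_r (@uq_nminus K q n a d) (subalg_genM (proj2 h) (proj2 h'))
  (proj2 (braid_word_morph w hT) x y)).
Qed.

End Uq.

(** * Leading coefficients of rational functions *)

Lemma fracE (R : idomainType) (x : {fraction R}) :
  exists p : R * R, p.2 != 0 /\ x = tofrac p.1 / tofrac p.2.
Proof.
elim/quotW: x => x; exists (\n_x, \d_x); split; first exact: denom_ratioP.
have d0 : tofrac \d_x != 0 by rewrite tofrac_eq0 denom_ratioP.
apply: (mulIf d0); rewrite mulfVK //=; unlock FracField.tofrac.
rewrite -[LHS]FracField.pi_mul; apply/eqmodP; rewrite /= FracField.equivfE /FracField.mulf.
by rewrite !numden_Ratio ?(oner_neq0, mulf_neq0, denom_ratioP) // !mulr1 mulrC.
Qed.

Section Cone.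
Context (C : numClosedFieldType).
Notation Kq := {fraction {poly C}}.
Implicit Types (p r : {poly C}) (x y : Kq).

Lemma lead_coefD_gt0 p r : 0 < lead_coef p -> 0 < lead_coef r -> 0 < lead_coef (p + r).
Proof.
move=> hp hr; case: (ltngtP (size p) (size r)) => h.
- by rewrite addrC lead_coefDl.
- by rewrite lead_coefDl.
have s : (p + r)`_(size p).-1 = lead_coef p + lead_coef r by rewrite coefD {2}h.
have s0 : 0 < (p + r)`_(size p).-1 by rewrite s addr_gt0.
suff e : (size (p + r)).-1 = (size p).-1 by rewrite /lead_coef e.
apply/eqP; rewrite eqn_leq; apply/andP; split.
  have := size_polyD p r.
  by rewrite -h maxnn; lia.
have : ((size p).-1 < size (p + r)%R)%N; last by lia.
by rewrite ltnNge; apply/negP => /(nth_default 0) e; rewrite e ltxx in s0.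
Qed.

Definition frac_pos x : Prop := exists p r : {poly C},
  [/\ 0 < lead_coef p, 0 < lead_coef r & x = tofrac p / tofrac r].

Let pneq0 p : 0 < lead_coef p -> tofrac p != 0 :> Kq.
Proof. by rewrite tofrac_eq0 -lead_coef_eq0 => h; rewrite gt_eqF. Qed.

Notation pc := (map_poly (@Num.conj C)).

Definition frac_conj x : Kq :=
  let p := sval (cid (fracE x)) in tofrac (pc p.1) / tofrac (pc p.2).

Let pc_neq0 p : p != 0 -> tofrac (pc p) != 0 :> Kq.
Proof. by move=> p0; rewrite tofrac_eq0 map_poly_eq0. Qed.

Lemma frac_conjE p r : r != 0 ->
  frac_conj (tofrac p / tofrac r) = tofrac (pc p) / tofrac (pc r).
Proof.
move=> r0; rewrite /frac_conj; case: cid => -[p' r'] /= [r'0 /eqP].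
rewrite eqr_div ?tofrac_eq0 // -!tofracM tofrac_eq => /eqP e.
apply/eqP; rewrite eqr_div ?pc_neq0 // -!tofracM tofrac_eq -!rmorphM.
by rewrite e.
Qed.

Let frac_conj_poly p : frac_conj (tofrac p) = tofrac (pc p).
Proof.
have := frac_conjE p (oner_neq0 _); rewrite !rmorph1 !divr1; exact.
Qed.

Lemma frac_cone : positive_cone frac_pos frac_conj.
Proof.
split.
- by move=> _ [p [r [hp hr ->]]]; rewrite mulf_neq0 ?invr_eq0 ?pneq0.
- by exists 1, 1; rewrite lead_coef1 ltr01 tofrac1 divr1.
- move=> _ _ [p [r [hp hr ->]]] [p' [r' [hp' hr' ->]]].
  exists (p * r' + p' * r), (r * r'); rewrite addf_div ?pneq0 // -!tofracM -tofracD.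
  by split=> //; rewrite ?lead_coefD_gt0 // lead_coefM mulr_gt0.
- move=> _ _ [p [r [hp hr ->]]] [p' [r' [hp' hr' ->]]].
  exists (p * p'), (r * r'); rewrite mulf_div -!tofracM.
  by split=> //; rewrite lead_coefM mulr_gt0.
- by move=> _ [p [r [hp hr ->]]]; exists r, p; rewrite invf_div.
- by rewrite -tofrac0 frac_conj_poly rmorph0.
- by rewrite -tofrac1 frac_conj_poly rmorph1.
- move=> b c; have [[p r] /= [r0 ->]] := fracE b; have [[p' r'] /= [r'0 ->]] := fracE c.
  rewrite !frac_conjE // addf_div ?tofrac_eq0 // -!tofracM -tofracD frac_conjE ?mulf_neq0 //.
  by rewrite addf_div ?pc_neq0 // -!tofracM -tofracD rmorphD !rmorphM.
- move=> b c; have [[p r] /= [r0 ->]] := fracE b; have [[p' r'] /= [r'0 ->]] := fracE c.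
  rewrite !frac_conjE // mulf_div -!tofracM frac_conjE ?mulf_neq0 //.
  by rewrite mulf_div -!tofracM !rmorphM.
move=> c; have [[p r] /= [r0 ->]] := fracE c.
rewrite mulf_eq0 invr_eq0 !tofrac_eq0 negb_or => /andP[p0 _].
rewrite frac_conjE // mulf_div -!tofracM; exists (p * pc p), (r * pc r); split=> //.
  by rewrite lead_coefM lead_coef_map mul_conjC_gt0 lead_coef_eq0.
by rewrite lead_coefM lead_coef_map mul_conjC_gt0 lead_coef_eq0.
Qed.

Let X : Kq := tofrac 'X.

Let XnE k : X ^+ k = tofrac ('X^k) :> Kq.
Proof. by rewrite /X -tofracXn. Qed.

Lemma fracX_pos (m : int) : frac_pos (X ^ m).
Proof.
have h k : frac_pos (X ^+ k).
  by exists 'X^k, 1; rewrite lead_coefXn lead_coef1 ltr01 tofrac1 divr1 XnE.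
by case: m => k; [exact: h|apply: (posV frac_cone); apply: h].
Qed.

Lemma fracX_pos1 (m : int) : 0 < m -> frac_pos (X ^ m - 1).
Proof.
case: m => // k k0; exists ('X^k - 1), 1; rewrite lead_coef1 tofrac1 divr1.
have -> : lead_coef ('X^k - 1 : {poly C}) = 1 by apply/eqP/monic_Xn_sub_1.
by rewrite ltr01 tofracB -XnE tofrac1.
Qed.

Lemma fracX_conj (m : int) : frac_conj (X ^ m) = X ^ m.
Proof.
have h k : frac_conj (X ^+ k) = X ^+ k by rewrite XnE frac_conj_poly rmorphXn /= map_polyX.
case: m => k; first exact: h.
have X0 : X ^+ k.+1 != 0 by rewrite expf_neq0 // tofrac_eq0 polyX_eq0.
have := cjM frac_cone (X ^+ k.+1) (X ^- k.+1).
rewrite divff // (cj1 frac_cone) h => /(congr1 (fun b => X ^- k.+1 * b)).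
by rewrite mulr1 mulKf.
Qed.

Lemma fracX_generic (m : int) : m != 0 -> X ^ m != 1.
Proof.
have h k : 0 < k -> X ^ k != 1.
  by move=> /fracX_pos1/(pos_neq0 frac_cone); rewrite subr_eq0.
case: (ltrgt0P m) => // [/h|m0 _]; first by [].
have := h (- m); rewrite oppr_gt0 => /(_ m0); rewrite -invr_expz.
by apply: contra_neq => ->; rewrite invr1.
Qed.

End Cone.

(** * Roots of a simple Lie algebra *)

Section LieBasics.
Context (F : fieldType) (g : lie_algebra F).
Implicit Types (x y z : g) (U V : {vspace g}).

Lemma lie_brl_linear x : linear (lie_br x).
Proof. by move=> c y z; apply: lie_brDr. Qed.
HB.instance Definition _ x :=
  GRing.isLinear.Build F g g _ (lie_br x) (lie_brl_linear x).

Lemma lie_br0l x : lie_br 0 x = 0.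
Proof. by have := lie_brDl (-1) 0 0 x; rewrite scaleN1r oppr0 addr0 scaleN1r addNr. Qed.
Lemma lie_brZl c x y : lie_br (c *: x) y = c *: lie_br x y.
Proof. by have := lie_brDl c x 0 y; rewrite lie_br0l !addr0. Qed.
Lemma lie_brDl' x y z : lie_br (x + y) z = lie_br x z + lie_br y z.
Proof. by have := lie_brDl 1 x y z; rewrite !scale1r. Qed.

Lemma lie_brNr x y : lie_br x (- y) = - lie_br x y.
Proof. exact: linearN. Qed.
Lemma lie_brZr c x y : lie_br x (c *: y) = c *: lie_br x y.
Proof. exact: linearZ. Qed.

Lemma lie_brC x y : lie_br x y = - lie_br y x.
Proof.
have := lie_brxx (x + y); rewrite lie_brDl' !linearD /= !lie_brxx add0r addr0.
by move/eqP; rewrite addr_eq0 => /eqP.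
Qed.

Lemma lie_br_der x y z : lie_br x (lie_br y z) = lie_br (lie_br x y) z + lie_br y (lie_br x z).
Proof.
have := lie_jacobi x y z; rewrite (lie_brC z x) linearN (lie_brC z) => /eqP.
by rewrite -addrA -opprD subr_eq0 addrC => /eqP ->.
Qed.

Lemma brackets_ind U V (P : g -> Prop) : P 0 ->
  (forall c x y, P x -> P y -> P (c *: x + y)) ->
  (forall u v, u \in U -> v \in V -> P (lie_br u v)) ->
  forall z, z \in brackets U V -> P z.
Proof.
move=> P0 PL Pb z; rewrite /brackets -[X in <<X>>%VS]in_tupleE => /coord_span ->.
apply: (big_ind P) => // [x y hx hy|i _]; first by rewrite -[x]scale1r; apply: PL.
rewrite -[_ *: _]addr0; apply: PL => //.
have : (in_tuple [seq lie_br u v | u <- vbasis U, v <- vbasis V])`_i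
    \in [seq lie_br u v | u <- vbasis U, v <- vbasis V] by apply: mem_nth.
by move=> /allpairsP[[u v] [/vbasis_mem hu /vbasis_mem hv ->]]; apply: Pb.
Qed.

Lemma mem_brackets U V u v : u \in U -> v \in V -> lie_br u v \in brackets U V.
Proof.
move=> /coord_vbasis -> /coord_vbasis ->.
have -> x : lie_br (\sum_(i < \dim U) coord (vbasis U) i u *: (vbasis U)`_i) x
    = \sum_(i < \dim U) coord (vbasis U) i u *: lie_br (vbasis U)`_i x.
  by elim/big_rec2: _ => [|i a b _ <-]; rewrite ?lie_br0l // lie_brDl.
apply: rpred_sum => i _; apply: rpredZ; rewrite linear_sum.
apply: rpred_sum => j _; rewrite linearZ; apply: rpredZ; apply: memv_span.
by apply: allpairs_f; apply: mem_nth; rewrite size_tuple.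
Qed.

Lemma memv_bigcap_seq (I : eqType) (s : seq I) (V : I -> {vspace g}) x :
  (x \in (\bigcap_(i <- s) V i)%VS) = all (fun i => x \in V i) s.
Proof.
by elim: s => [|i s IH]; rewrite ?big_nil ?memvf // big_cons memv_cap IH.
Qed.

Context (h : {vspace g}).

Lemma root_spaceP (b : dual h) x :
  x \in root_space b <-> forall t : subvs_of h, lie_br (vsval t) x = b t *: x.
Proof.
rewrite memv_bigcap_seq; split=> [/allP hx t|hx].
  rewrite (coord_vbasis (memvf t)) !linear_sum /=.
  have -> : lie_br (\sum_i vsval (coord (vbasis fullv) i t *: (vbasis {:subvs_of h})`_i)) x
     = \sum_i coord (vbasis fullv) i t *: lie_br (vsval (vbasis {:subvs_of h})`_i) x.
    by elim/big_rec2: _ => [|i a c _ <-]; rewrite ?lie_br0l // linearZ lie_brDl.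
  rewrite scaler_suml; apply: eq_bigr => i _; rewrite linearZ -scalerA; congr (_ *: _).
  have /hx : (vbasis {:subvs_of h})`_i \in vbasis {:subvs_of h}.
    by apply: mem_nth; rewrite size_tuple.
  by rewrite memv_ker !lfun_simp subr_eq0 => /eqP.
by apply/allP => t _; rewrite memv_ker !lfun_simp /= hx subrr.
Qed.

Lemma root_space_br (b c : dual h) x y : x \in root_space b -> y \in root_space c ->
  lie_br x y \in root_space (b + c).
Proof.
move=> /root_spaceP hx /root_spaceP hy; apply/root_spaceP => t.
rewrite lie_br_der hx hy lie_brZl linearZ /= -scalerDl add_lfunE.
by [].
Qed.

End LieBasics.

Section Strings.
Context (R : realType) (D : simple_lie R).
Notation C := R[i].
Notation g := (glie D).
Notation h := (csa D).
Notation br := (@lie_br C g).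
Implicit Types (b c : dual h) (x y : g).

Lemma dual_intrI c (k l : int) : c != 0 -> k%:~R *: c = l%:~R *: c -> k = l.
Proof.
move=> c0 /eqP; rewrite -subr_eq0 -scalerBl scaler_eq0 (negPf c0) orbF.
by rewrite -rmorphB intr_eq0 subr_eq0 => /eqP.
Qed.

Section Triple.
Context (al : dual h) (e f : g) (hh : subvs_of h).
Hypothesis he : e \in root_space al.
Hypothesis hf : f \in root_space (- al).
Hypothesis hef : br e f = vsval hh.
Hypothesis alh : al hh = 2%:R.
Context (b0 : dual h) (m0 : int).
Hypothesis b0h : b0 hh = m0%:~R.

Let al0 : al != 0.
Proof.
apply/eqP => h0; move: alh; rewrite h0 zero_lfunE => /esym/eqP.
by rewrite pnatr_eq0.
Qed.

Definition root_string (m : int) (x : g) : Prop :=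
  exists2 k : int, m = m0 + k *+ 2 & x \in root_space (b0 + k%:~R *: al).

(** If no iterate vanished, infinitely many different weights [b0 + k al] would be roots or 0. *)
Lemma root_string_nil (F : g -> g) (s : int) : (s == 1) || (s == -1) -> F 0 = 0 ->
  (forall m x, root_string m x -> root_string (m + s *+ 2) (F x)) ->
  forall m x, root_string m x -> exists N, iter N F x = 0.
Proof.
move=> hs F0 FM m x hx; apply: contrapT => hN.
have it N : root_string (m + (s * N%:Z) *+ 2) (iter N F x).
  elim: N => [|N /FM]; first by rewrite mulr0 mul0rn addr0.
  by congr root_string; lia.
have nz N : iter N F x != 0 by apply/eqP => hz; apply: hN; exists N.
case: hx => k mk _.
have hr N : b0 + (k + s * N%:Z)%:~R *: al \in (0 : dual h) :: Defs.roots D.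
  have [k' ek hk] := it N; have -> : k + s * N%:Z = k' by lia.
  rewrite in_cons; case: eqP => //= /eqP b1; apply/rootsP; split; first exact/eqP.
  by move=> hz; move: hk; rewrite hz memv0 (negPf (nz N)).
pose s1 := [seq b0 + (k + s * N%:Z)%:~R *: al | N <- iota 0 (size (Defs.roots D)).+2].
have inj : injective (fun N : nat => b0 + (k + s * N%:Z)%:~R *: al).
  move=> N N' /addrI/(dual_intrI al0); clear - hs.
  by move: hs => /orP[] /eqP ->; lia.
have us : uniq s1 by rewrite map_inj_uniq; [exact: iota_uniq|exact: inj].
have ss : {subset s1 <= (0 : dual h) :: Defs.roots D} by move=> _ /mapP[N _ ->]; exact: hr.
have := uniq_leq_size us ss.
by rewrite size_map size_iota ltnn.
Qed.

Let brP := @int_is_bracket C (@pchar_num C).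

Let eM m x : root_string m x -> root_string (m + 2) (br e x).
Proof.
move=> [k -> hx]; exists (k + 1); first by lia.
have -> : b0 + (k + 1)%:~R *: al = al + (b0 + k%:~R *: al).
  by rewrite rmorphD rmorph1 scalerDl scale1r addrA addrC.
exact: root_space_br.
Qed.

Let fM m x : root_string m x -> root_string (m - 2) (br f x).
Proof.
move=> [k -> hx]; exists (k - 1); first by lia.
have -> : b0 + (k - 1)%:~R *: al = - al + (b0 + k%:~R *: al).
  by rewrite rmorphB rmorph1 scalerBl scale1r addrA addrC.
exact: root_space_br.
Qed.

Let efM m x : root_string m x -> br e (br f x) = br f (br e x) + m%:~R *: x.
Proof.
move=> [k -> /root_spaceP hx]; rewrite lie_br_der hef hx addrC; congr (_ + _ *: _).
rewrite add_lfunE scale_lfunE b0h alh rmorphD rmorphMn; congr (_ + _).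
exact: mulr_natr.
Qed.

Let ML m (a : C) x y : root_string m x -> root_string m y -> root_string m (a *: x + y).
Proof.
move=> [k ek hx] [k' ek' hy]; exists k; first exact: ek.
have e' : k' = k by move: ek ek'; clear; lia.
apply: rpredD; first exact: rpredZ hx.
by rewrite -e'.
Qed.

Lemma string_up x (p : nat) : x \in root_space b0 -> m0 + p%:Z < 0 ->
  iter p.+1 (br e) x = 0 -> x = 0.
Proof.
move=> hx mp ex.
have Mx : root_string m0 x.
  exists 0; first by rewrite mul0rn addr0.
  by rewrite mulr0z scale0r addr0.
apply: (sl2_inj brP ML (@lie_brl_linear _ _ e) (@lie_brl_linear _ _ f) eM fM efM _ Mx ex mp).
by move=> m y hy; apply: (root_string_nil (s := -1)) hy => //; apply: linear0.
Qed.

End Triple.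

Lemma string_down (al : dual h) e f (hh : subvs_of h) : e \in root_space al ->
  f \in root_space (- al) -> br e f = vsval hh -> al hh = 2%:R ->
  forall (b0 : dual h) (m0 : int), b0 hh = m0%:~R ->
  forall x (p : nat), x \in root_space b0 -> p%:Z < m0 ->
  iter p.+1 (br f) x = 0 -> x = 0.
Proof.
move=> he hf hef alh b0 m0 b0h x p hx mp.
have he' : e \in root_space (- - al) by rewrite opprK.
have hef' : br f e = vsval (- hh) by rewrite lie_brC hef linearN.
have alh' : (- al) (- hh) = 2%:R by rewrite opp_lfunE linearN opprK.
have b0h' : b0 (- hh) = (- m0)%:~R by rewrite (linearN b0 hh : b0 (- hh) = - b0 hh) b0h rmorphN.
have mp' : - m0 + p%:Z < 0 by move: mp; clear; lia.
exact: (string_up hf he' hef' alh' b0h' hx mp').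
Qed.

(** The bracket lies in the weight space of 0, so it normalizes the Cartan subalgebra, which is its
    own normalizer. *)
Lemma br_root_opp (b : dual h) u v : u \in root_space b -> v \in root_space (- b) ->
  exists t : subvs_of h, br u v = vsval t.
Proof.
move=> hu hv; have : br u v \in h.
  have [_ _] := csaP D; apply; apply/subvP => z.
  have /root_spaceP hz : br u v \in root_space (0 : dual h).
    by rewrite -(subrr b); apply: root_space_br.
  apply: (@brackets_ind _ _ _ _ (fun z => z \in h)) => [|c x y hx hy|_ t /vlineP[k ->] ht].
    exact: mem0v.
    exact: rpredD (rpredZ _ hx) hy.
  rewrite lie_brZl lie_brC -[t](vsprojK ht) hz zero_lfunE scale0r oppr0 scaler0.
  exact: mem0v.
by move=> hin; exists (vsproj h (br u v)); rewrite vsprojK.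
Qed.

Lemma vsval_inj (s t : subvs_of h) : vsval s = vsval t -> s = t.
Proof. exact: val_inj. Qed.

(* A vector u of g_al with al([u, f]) = 0 satisfies [f, [f, u]] = 0, which the
   sl_2-weight 2 of u forbids; hence g_al is a line. *)
Lemma root_line (al : dual h) e f (hh : subvs_of h) : e \in root_space al ->
  f \in root_space (- al) -> br e f = vsval hh -> al hh = 2%:R ->
  forall u, u \in root_space al -> exists k : C, u = k *: e.
Proof.
move=> he hf hef alh u hu; have [t ut] := br_root_opp hu hf.
exists (al t / 2%:R); apply/eqP; rewrite -subr_eq0; apply/eqP.
set k := al t / 2%:R; pose t' := t - k *: hh.
have hu' : u - k *: e \in root_space al by exact: rpredB hu (rpredZ _ he).
have e1 : br (u - k *: e) f = vsval t'.
  by rewrite lie_brDl' -scaleNr lie_brZl ut hef scaleNr linearB linearZ.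
have alt' : al t' = 0.
  rewrite linearB linearZ /= alh -[k *: _]/(k * 2%:R) mulfVK ?subrr //.
  by rewrite pnatr_eq0.
have e2 : iter 2 (br f) (u - k *: e) = 0.
  rewrite /= (lie_brC f (u - k *: e)) e1 lie_brNr lie_brC opprK.
  by move/root_spaceP: hf => ->; rewrite opp_lfunE alt' oppr0 scale0r.
have alh' : al hh = 2%:~R by rewrite alh.
by apply: (string_down he hf hef alh alh' hu' _ e2).
Qed.

(** The coroot is given only in the span of all brackets of the two root spaces. Some bracket [t]
    has [al t <> 0], since [al] does not vanish on the coroot. Rescaled, it gives an sl_2-triple, by
    which both root spaces, and so the span of the brackets, are lines. *)
Lemma coroot_triple i : exists e f, [/\ e \in root_space (simple_root i),
  f \in root_space (- simple_root i) & br e f = vsval (coroot i)].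
Proof.
set al := simple_root i.
have [u [v [t [hu hv ut alt]]]] : exists u v t, [/\ u \in root_space al,
    v \in root_space (- al), br u v = vsval t & al t <> 0].
  apply: contrapT => hn.
  suff [t ct alt] : exists2 t : subvs_of h, vsval (coroot i) = vsval t & al t = 0.
    have := coroot_root i; rewrite (vsval_inj ct) alt => /esym/eqP.
    by rewrite pnatr_eq0.
  apply: (@brackets_ind _ _ _ _ (fun z => exists2 t : subvs_of h, z = vsval t & al t = 0)
    _ _ _ _ (coroot_in i)).
  - by exists 0; rewrite linear0.
  - move=> k x y [s -> h1] [t -> h2]; exists (k *: s + t); first by rewrite linearP.
    have -> : al (k *: s + t) = k *: al s + al t by exact: linearP.
    by rewrite h1 h2 scaler0 addr0.
  move=> u v hu hv; have [t ut] := br_root_opp hu hv; exists t; first exact: ut.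
  apply: contrapT => alt; apply: hn; exists u, v, t.
  by split; [exact: hu|exact: hv|exact: ut|exact: alt].
pose k := 2%:R / al t; have alt0 : al t != 0 by apply/eqP.
have hku : k *: u \in root_space al := rpredZ k hu.
have kt : br (k *: u) v = vsval (k *: t) by rewrite lie_brZl ut linearZ.
have alk : al (k *: t) = 2%:R by rewrite linearZ /= -[LHS]/(k * al t) mulfVK.
have hku' : k *: u \in root_space (- - al) by rewrite opprK.
have line1 := root_line hku hv kt alk.
have line2 : forall v', v' \in root_space (- al) -> exists l : C, v' = l *: v.
  apply: (root_line hv hku' (hh := - (k *: t))).
    by rewrite lie_brC kt linearN.
  by rewrite opp_lfunE linearN opprK.
suff [l cl] : exists l : C, vsval (coroot i) = l *: vsval (k *: t).
  have ct : coroot i = l *: (k *: t) by apply: vsval_inj; rewrite linearZ.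
  have := coroot_root i; rewrite ct linearZ /= -/al alk => l2.
  have l1 : l = 1.
    by apply: (@mulIf _ (2%:R : C)); rewrite ?pnatr_eq0 // mul1r; exact: l2.
  by exists (k *: u), v; split; [exact: hku|exact: hv|rewrite l1 scale1r; exact: kt].
apply: (@brackets_ind _ _ _ _ (fun z => exists l : C, z = l *: vsval (k *: t))
  _ _ _ _ (coroot_in i)).
- by exists 0; rewrite scale0r.
- by move=> c x y [l1 ->] [l2 ->]; exists (c * l1 + l2); rewrite scalerDl scalerA.
move=> u' v' /line1[l1 ->] /line2[l2 ->]; exists (l1 * l2).
by rewrite lie_brZl lie_brZr kt scalerA.
Qed.

End Strings.

(** * Roots as integral weights *)

Section RootWeights.
Context (R : realType) (D : simple_lie R).
Notation C := R[i].
Notation g := (glie D).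
Notation h := (csa D).
Notation n := (rank D).
Notation br := (@lie_br C g).
Notation al := (simple_root (s := D)).
Notation a := (cartan_mx D).
Notation d := (half_norm (s := D)).
Notation H := (cpair a).
Implicit Types (mu nu : weight n).

Let form_ge2 i : 2%:R <= inv_form (al i) (al i).
Proof. exact: inv_form_min (simple_root_in i). Qed.

Let form_neq0 i : inv_form (al i) (al i) != 0.
Proof. by rewrite gt_eqF // (lt_le_trans _ (form_ge2 i)) // ltr0n. Qed.

Lemma half_norm_gt0 i : (0 < d i)%N.
Proof.
rewrite -(ltr_nat C) half_normE divr_gt0 ?ltr0n //.
by rewrite (lt_le_trans _ (form_ge2 i)) // ltr0n.
Qed.

Lemma cartan_diag i : a i i = 2.
Proof.
by apply: (@intr_inj C); rewrite cartan_mxE mulfK ?form_neq0.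
Qed.

Lemma cartan_sym i j : (d i)%:Z * a i j = (d j)%:Z * a j i.
Proof.
apply: (@intr_inj C); rewrite !rmorphM /= !cartan_mxE -!pmulrn !half_normE inv_formC.
have := form_neq0 i; have := form_neq0 j => h1 h2.
by field; rewrite h1 h2.
Qed.

Let formDl (x y z : dual h) : inv_form (x + y) z = inv_form x z + inv_form y z :> C.
Proof. by have := inv_formDl 1 x y z; rewrite scale1r mul1r. Qed.
Let form0l (z : dual h) : inv_form (0 : dual h) z = 0 :> C.
Proof. by apply: (addIr (inv_form 0 z)); rewrite -formDl !add0r. Qed.
Let formZl c (x z : dual h) : inv_form (c *: x) z = c * inv_form x z :> C.
Proof. by have := inv_formDl c x 0 z; rewrite form0l !addr0. Qed.

(** Invariance of the form under [s_i], applied to [al i] and [al j], identifies the value of [al j]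
    at the coroot with [2 (al i, al j) / (al i, al i)]. *)
Lemma root_coroot i j : al j (coroot i) = (a i j)%:~R.
Proof.
have := inv_form_refl i (al i) (al j); rewrite coroot_root.
have -> : al i - 2%:R *: al i = - 1 *: al i.
  by rewrite -{1}[al i]scale1r -scalerBl; congr (_ *: _); ring.
rewrite formZl inv_formC formDl -scaleNr formZl [inv_form (al j) _]inv_formC.
move=> e; rewrite cartan_mxE; have h0 := form_neq0 i.
apply: (mulIf h0); rewrite mulfVK //.
move: e; rewrite mulN1r => e.
have -> : 2%:R * inv_form (al i) (al j) = inv_form (al i) (al j) + inv_form (al i) (al j).
  by ring.
by rewrite -{1}e; ring.
Qed.

Definition wroot mu : dual h := \sum_j (mu j)%:~R *: al j.

Lemma wrootD mu nu : wroot (mu + nu) = wroot mu + wroot nu.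
Proof. by rewrite -big_split; apply: eq_bigr => j _; rewrite ffunE rmorphD scalerDl. Qed.
Lemma wrootN mu : wroot (- mu) = - wroot mu.
Proof. by rewrite -sumrN; apply: eq_bigr => j _; rewrite ffunE rmorphN scaleNr. Qed.
Lemma wroot0 : wroot 0 = 0.
Proof. by apply: big1 => j _; rewrite ffunE scale0r. Qed.
Lemma wroot_alpha i : wroot (alpha i) = al i.
Proof.
rewrite /wroot (bigD1 i) //= big1 => [|j ji]; rewrite ffunE ?eqxx ?scale1r ?addr0 //.
by rewrite eq_sym (negPf ji) scale0r.
Qed.
Lemma wrootMn mu k : wroot (mu *+ k) = wroot mu *+ k.
Proof. by elim: k => [|k IH]; rewrite ?mulr0n ?wroot0 // !mulrS wrootD IH. Qed.

Lemma wroot_coroot mu i : wroot mu (coroot i) = (H i mu)%:~R.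
Proof.
rewrite sum_lfunE rmorph_sum; apply: eq_bigr => j _.
by rewrite scale_lfunE root_coroot rmorphM /= mulrC.
Qed.

Lemma wroot_coord mu k : coord [tuple al k | k < n] k (wroot mu) = (mu k)%:~R.
Proof.
have fr := basis_free (simple_root_basis D).
rewrite -(coord_sum_free (fun j => (mu j)%:~R) k fr) /wroot; congr (coord _ _ _).
by apply: eq_bigr => j _; rewrite -tnth_nth tnth_mktuple.
Qed.

Lemma wroot_inj mu nu : wroot mu = wroot nu -> mu = nu.
Proof.
move=> e; apply/ffunP => k; apply: (@intr_inj C).
by rewrite -!wroot_coord e.
Qed.

Definition isroot mu : Prop := wroot mu \in Defs.roots D.

Lemma isroot_alpha i : isroot (alpha i).
Proof. by rewrite /isroot wroot_alpha simple_root_in. Qed.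

Lemma isroot_neq0 mu : isroot mu -> mu != 0.
Proof.
move=> /rootsP[h0 _]; apply/eqP => e; apply: h0; by rewrite e wroot0.
Qed.

Lemma root_weight b : b \in Defs.roots D -> exists2 mu, b = wroot mu &
  (forall j, 0 <= mu j) \/ (forall j, mu j <= 0).
Proof.
move=> /simple_root_base[c hc]; pose mu : weight n := [ffun j => (c j)%:Z].
have e : \sum_j (c j)%:R *: al j = wroot mu.
  by apply: eq_bigr => j _; rewrite ffunE.
case: hc => ->; rewrite e; first by exists mu => //; left=> j; rewrite ffunE.
by exists (- mu); rewrite ?wrootN //; right=> j; rewrite !ffunE oppr_le0.
Qed.

Lemma isroot_sign mu : isroot mu -> (forall j, 0 <= mu j) \/ (forall j, mu j <= 0).
Proof. by move=> /root_weight[nu /wroot_inj ->]. Qed.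

Lemma root_vector mu : isroot mu -> exists2 x, x \in root_space (wroot mu) & x != 0.
Proof.
move=> /rootsP[_ h0]; exists (vpick (root_space (wroot mu))); first exact: memv_pick.
by rewrite vpick0; apply/eqP.
Qed.

Lemma vector_isroot mu x : mu != 0 -> x \in root_space (wroot mu) -> x != 0 -> isroot mu.
Proof.
move=> mu0 hx x0; apply/rootsP; split.
  by rewrite -wroot0 => /wroot_inj/eqP; rewrite (negPf mu0).
by move=> h0; move: hx; rewrite h0 memv0 (negPf x0).
Qed.

Lemma iter_root_space (b c : dual h) e x k : e \in root_space b ->
  x \in root_space c -> iter k (br e) x \in root_space (c + b *+ k).
Proof.
move=> he hx; elim: k => [|k IH]; first by rewrite addr0.
by rewrite mulrSr addrA addrC; apply: root_space_br.
Qed.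

(** By [string_up], a root vector survives [p] applications of [e]. The weight 0 has to be excluded,
    because the string from [- alpha i] passes through it. *)
Lemma isroot_up i mu (p : nat) : isroot mu -> H i mu <= - p%:Z ->
  mu + alpha i *+ p != 0 -> isroot (mu + alpha i *+ p).
Proof.
move=> hmu hp h0; case: p hp h0 => [|p] hp h0; first by rewrite addr0.
have [x hx x0] := root_vector hmu; have [e [f [he hf hef]]] := coroot_triple i.
apply: (vector_isroot (x := iter p.+1 (br e) x) h0).
  by rewrite wrootD wrootMn wroot_alpha; apply: iter_root_space.
apply: contra_neq x0; apply: (string_up he hf hef (coroot_root i) (wroot_coroot mu i) hx).
by lia.
Qed.

Lemma isroot_down i mu (p : nat) : isroot mu -> p%:Z <= H i mu ->
  mu - alpha i *+ p != 0 -> isroot (mu - alpha i *+ p).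
Proof.
move=> hmu hp h0; case: p hp h0 => [|p] hp h0; first by rewrite subr0.
have [x hx x0] := root_vector hmu; have [e [f [he hf hef]]] := coroot_triple i.
apply: (vector_isroot (x := iter p.+1 (br f) x) h0).
  by rewrite wrootD wrootN wrootMn wroot_alpha -mulNrn; apply: iter_root_space.
apply: contra_neq x0; apply: (string_down he hf hef (coroot_root i) (wroot_coroot mu i) hx).
by lia.
Qed.

(** If [a i j] were positive, [alpha j - alpha i] would be a root with coefficients of both
    signs. *)
Lemma cartan_le0 i j : i != j -> a i j <= 0.
Proof.
move=> ij; rewrite leNgt; apply/negP => h1.
have h0 : alpha j - alpha i *+ 1 != 0.
  apply/eqP => /ffunP/(_ j); rewrite !ffunE eqxx (negPf ij) => /eqP.
  by [].
have hr : isroot (alpha j - alpha i *+ 1).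
  by apply: isroot_down => //; [exact: isroot_alpha|rewrite cpair_alpha; lia].
case: (isroot_sign hr) => [/(_ i)|/(_ j)]; rewrite !ffunE eqxx.
  by rewrite eq_sym (negPf ij).
by rewrite (negPf ij).
Qed.

Lemma isroot_refl i mu : isroot mu -> isroot (mu - alpha i *~ H i mu).
Proof.
move=> hmu; have h0 : mu - alpha i *~ H i mu != 0.
  apply/eqP => /subr0_eq e; have := congr1 (H i) e.
  have cz k : H i (alpha i *~ k) = k *+ 2.
    by case: k => k; rewrite ?NegzE ?mulrNz ?cpairN -?pmulrn cpairMn cpair_alpha cartan_diag; lia.
  rewrite cz => e'; have m0 : H i mu = 0 by lia.
  by move: (isroot_neq0 hmu); rewrite e m0 mulr0z eqxx.
have [m0|m0] := leP 0 (H i mu).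
  have e : alpha i *~ H i mu = alpha i *+ `|H i mu|%N by rewrite pmulrn gez0_abs.
  rewrite e in h0 *; apply: isroot_down => //; by rewrite gez0_abs.
have e : - (alpha i *~ H i mu) = alpha i *+ `|H i mu|%N.
  by rewrite -mulrNz pmulrn ltz0_abs.
rewrite e in h0 *; apply: isroot_up => //; rewrite ltz0_abs //; lia.
Qed.

End RootWeights.

(* For a finite set of weights stable under the reflections, twice the sum of
   the H_i(b) b is a positive multiple of alpha_i; so nu is a combination of
   the b with coefficients c_b such that sum_b c_b^2 is a combination with
   positive coefficients of the nu_i H_i(nu). *)
Lemma reflections_definite (n : nat) (a : 'M[int]_n) (Phi : seq (weight n)) :
  (forall i, a i i = 2) -> uniq Phi -> (forall i, alpha i \in Phi) ->
  (forall i mu, mu \in Phi -> mu - alpha i *~ cpair a i mu \in Phi) ->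
  forall nu : weight n, (forall i, nu i * cpair a i nu <= 0) -> nu = 0.
Proof.
move=> a2 uPhi hal hs nu hnu.
pose s i (mu : weight n) := mu - alpha i *~ cpair a i mu.
have cz i j k : cpair a i (alpha j *~ k) = a i j * k.
  by case: k => k; rewrite ?NegzE ?mulrNz ?cpairN -?pmulrn cpairMn cpair_alpha; lia.
have az i l k : (alpha i *~ k : weight n) l = (i == l)%:Z * k.
  have dl : (alpha i : weight n) l = (i == l)%:Z by rewrite ffunE natz.
  case: k => k; rewrite ?NegzE ?mulrNz ?ffunE -?pmulrn ffunMnE dl -mulr_natr natz //.
have hi i mu : cpair a i (s i mu) = - cpair a i mu.
  by rewrite /s cpairD cpairN cz a2; lia.
have sK i : involutive (s i).
  by move=> mu; rewrite {1}/s hi /s mulrNz opprK subrK.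
have sPhi i : perm_eq [seq s i mu | mu <- Phi] Phi.
  apply: uniq_perm => [||mu]; [by rewrite map_inj_uniq //; apply: inv_inj|by []|].
  apply/mapP/idP => [[nu' h ->]|h]; first exact: hs.
  by exists (s i mu); [exact: hs|rewrite sK].
pose Q i := \sum_(b <- Phi) cpair a i b ^+ 2.
have Q0 i : 0 < Q i.
  rewrite /Q (big_rem _ (hal i)) /= cpair_alpha a2 ltr_wpDr //.
  by apply: sumr_ge0 => b _; apply: sqr_ge0.
have key i l : 2 * \sum_(b <- Phi) cpair a i b * b l = Q i * (i == l)%:Z.
  (* Reindexing the sum by the reflection [s_i] turns the term [H_i(b) b] into
     [H_i(b)^2 alpha_i - H_i(b) b]. *)
  have e : \sum_(b <- Phi) cpair a i b * b l
      = \sum_(b <- Phi) (cpair a i b ^+ 2 * (i == l)%:Z - cpair a i b * b l).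
    rewrite -(perm_big _ (sPhi i)) big_map; apply: eq_bigr => b _.
    rewrite hi /s !ffunE.
    rewrite az.
    by ring.
  have e2 : \sum_(b <- Phi) cpair a i b * b l
      = Q i * (i == l)%:Z - \sum_(b <- Phi) cpair a i b * b l.
    by rewrite {1}e sumrB -mulr_suml.
  by lia.
clearbody Q; pose c (b : weight n) : rat := \sum_j (nu j)%:~R / (Q j)%:~R * (cpair a j b)%:~R.
have Qr i : (Q i)%:~R != 0 :> rat by rewrite intr_eq0 gt_eqF.
have nuE l : (nu l)%:~R = 2 * \sum_(b <- Phi) c b * (b l)%:~R :> rat.
  have -> : \sum_(b <- Phi) c b * (b l)%:~R = \sum_j (nu j)%:~R / (Q j)%:~R *
      (\sum_(b <- Phi) cpair a j b * b l)%:~R :> rat.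
    under eq_bigr => b _ do rewrite /c mulr_suml.
    rewrite exchange_big; apply: eq_bigr => j _; rewrite rmorph_sum mulr_sumr.
    by apply: eq_bigr => b _; rewrite rmorphM mulrA.
  have keyQ j : 2 * (\sum_(b <- Phi) cpair a j b * b l)%:~R
      = (Q j)%:~R * (j == l)%:~R :> rat.
    by have := congr1 (fun z : int => z%:~R : rat) (key j l); rewrite !rmorphM.
  rewrite mulr_sumr (bigD1 l) //= [X in _ + X]big1 => [|j jl]; rewrite mulrCA keyQ.
    by rewrite eqxx mulr1 addr0 mulfVK.
  by rewrite (negPf jl) !mulr0.
have cH k : 2 * \sum_(b <- Phi) c b * (cpair a k b)%:~R = (cpair a k nu)%:~R :> rat.
  have cE b : (cpair a k b)%:~R = \sum_l (a k l)%:~R * (b l)%:~R :> rat.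
    by rewrite /cpair rmorph_sum; apply: eq_bigr => l _; rewrite rmorphM.
  rewrite cE mulr_sumr.
  have -> : \sum_(b <- Phi) 2 * (c b * (cpair a k b)%:~R)
     = \sum_(b <- Phi) \sum_l (a k l)%:~R * (2 * (c b * (b l)%:~R)).
    apply: eq_bigr => b _; rewrite cE !mulr_sumr; apply: eq_bigr => l _; ring.
  rewrite exchange_big; apply: eq_bigr => l _.
  by rewrite nuE -mulr_sumr -mulr_sumr.
have c2 : 2 * \sum_(b <- Phi) c b ^+ 2 = \sum_k (nu k * cpair a k nu)%:~R / (Q k)%:~R.
  under eq_bigr => b _ do rewrite expr2 {2}/c mulr_sumr.
  rewrite exchange_big mulr_sumr; apply: eq_bigr => k _.
  rewrite rmorphM /= -cH.
  have -> : \sum_(b <- Phi) c b * ((nu k)%:~R / (Q k)%:~R * (cpair a k b)%:~R)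
     = (nu k)%:~R / (Q k)%:~R * \sum_(b <- Phi) c b * (cpair a k b)%:~R.
    by rewrite mulr_sumr; apply: eq_bigr => b _; rewrite mulrCA.
  by rewrite mulrCA -!mulrA; congr (_ * _); rewrite mulrC !mulrA.
have c0 b : b \in Phi -> c b = 0.
  have h : \sum_(b <- Phi) c b ^+ 2 <= 0.
    rewrite -(pmulr_rle0 _ (_ : 0 < 2 :> rat)) // c2; apply: sumr_le0 => k _.
    by rewrite mulr_le0_ge0 ?invr_ge0 ?ler0z ?(ltW (Q0 k)) // lerz0.
  have : \sum_(b <- Phi) c b ^+ 2 == 0.
    by rewrite eq_le h sumr_ge0 // => b' _; apply: sqr_ge0.
  rewrite psumr_eq0 => [/allP hb hin|b' _]; last exact: sqr_ge0.
  by have := hb b hin; rewrite sqrf_eq0 => /eqP.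
apply/ffunP => l; rewrite ffunE; apply: (@intr_inj rat); rewrite nuE big_seq big1 ?mulr0 //.
by move=> b hb; rewrite c0 ?mul0r.
Qed.

(** * The q-datum of a simple Lie algebra and its commutative nilradical *)

Section Datum.
Context (R : realType) (D : simple_lie R).
Notation h := (csa D).
Notation n := (rank D).
Notation a := (cartan_mx D).
Notation H := (cpair a).
Implicit Types (mu nu : weight n).

Lemma root_weights : exists2 Phi : seq (weight n), uniq Phi &
  forall mu, mu \in Phi <-> isroot mu.
Proof.
pose w (b : dual h) : weight n :=
  if pselect (exists mu, b = wroot mu) is left e then sval (cid e) else 0.
have wK mu : w (wroot mu) = mu.
  rewrite /w; case: pselect => [e|[]]; last by exists mu.
  by case: cid => nu /= /wroot_inj.
exists (undup [seq w b | b <- Defs.roots D]); first exact: undup_uniq.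
move=> mu; rewrite mem_undup; split=> [/mapP[b hb ->]|hmu].
  by have [nu e _] := root_weight hb; rewrite /isroot {1}e wK -e.
by apply/mapP; exists (wroot mu); rewrite ?wK.
Qed.

Lemma cartan_definite nu : (forall i, nu i * H i nu <= 0) -> nu = 0.
Proof.
have [Phi uPhi hPhi] := root_weights.
apply: (reflections_definite (@cartan_diag _ D) uPhi) => [i|i mu /hPhi hmu].
  by apply/hPhi; apply: isroot_alpha.
by apply/hPhi; apply: isroot_refl.
Qed.

Context (i0 : 'I_n).

Definition radical_weight mu : Prop := isroot mu /\ mu i0 = 1.

Lemma radical_weightP mu x : radical_weight mu -> x \in root_space (wroot mu) ->
  x \in nil_radical [set~ i0].
Proof.
move=> [hmu m1] hx; have mu0 j : 0 <= mu j.
  by case: (isroot_sign hmu) => // /(_ i0); rewrite m1.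
rewrite /nil_radical (big_rem _ hmu) /=.
have -> : pos_root (wroot mu) && ~~ levi_root [set~ i0] (wroot mu).
  rewrite /pos_root /levi_root hmu; apply/andP; split.
    by apply/forallP => i; rewrite wroot_coord ler0z.
  apply/negP => /= /forallP/(_ i0); rewrite wroot_coord m1 in_setC1 eqxx /=.
  by rewrite oner_eq0.
by rewrite -[x]addr0; apply: memv_add; [exact: hx|exact: mem0v].
Qed.

Hypothesis Hcomm : commutative_parabolic [set~ i0].

(** If the value were negative, [string_up] would make the bracket of root vectors for [alpha i0]
    and [mu] nonzero; but both vectors lie in the nilradical, whose brackets vanish. *)
Lemma radical_weight_ge0 mu : radical_weight mu -> 0 <= H i0 mu.
Proof.
move=> hm; have [hmu m1] := hm; rewrite leNgt; apply/negP => hneg.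
have [x hx x0] := root_vector hmu; have [e [f [he hf hef]]] := coroot_triple i0.
have hal : radical_weight (alpha i0).
  by split; [exact: isroot_alpha|rewrite ffunE eqxx].
have he' : e \in root_space (wroot (alpha i0)) by rewrite wroot_alpha.
have [_ c0] := Hcomm.
have := mem_brackets (radical_weightP hal he') (radical_weightP hm hx).
rewrite c0 memv0 => /eqP ex; case/eqP: x0.
apply: (string_up he hf hef (coroot_root i0) (wroot_coroot mu i0) hx (p := 0)) => //.
by rewrite addr0.
Qed.

End Datum.

Section Datum.
Context (R : realType) (D : simple_lie R).
Notation n := (rank D).
Notation d := (half_norm (s := D)).
Notation t := (qi (qvar R) d).

Lemma qi_expz i (m : int) : t i ^ m = qvar R ^ ((d i)%:Z * m).
Proof. by rewrite /qi exprnP exprz_exp. Qed.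

Let q0 : qvar R != 0.
Proof. by rewrite /qvar tofrac_eq0 polyX_eq0. Qed.

Let dm_gt0 i (m : int) : 0 < m -> 0 < (d i)%:Z * m.
Proof. by move=> m0; rewrite mulr_gt0 // ltz_nat half_norm_gt0. Qed.

Definition lie_qdatum : qdatum (Cq R) n.
Proof.
apply: (@QDatum _ _ t (cartan_mx D)).
- by move=> i; rewrite expf_neq0.
- move=> i m m0; rewrite qi_expz; apply: (@fracX_generic R[i]).
  by rewrite mulf_neq0 // eqz_nat -lt0n half_norm_gt0.
- by move=> i j; rewrite !qi_expz cartan_sym.
- exact: cartan_diag.
Defined.

Lemma lie_pos i (m : int) : frac_pos (t i ^ m : {fraction {poly R[i]}}).
Proof. by rewrite qi_expz; apply: fracX_pos. Qed.

Lemma lie_pos1 i (m : int) : 0 < m -> frac_pos (t i ^ m - 1 : {fraction {poly R[i]}}).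
Proof. by move=> m0; rewrite qi_expz; apply/fracX_pos1/dm_gt0. Qed.

Lemma lie_conj i (m : int) : frac_conj (t i ^ m : {fraction {poly R[i]}}) = t i ^ m.
Proof. by rewrite qi_expz; apply: fracX_conj. Qed.

Lemma lie_commutative (i0 : 'I_n) : commutative_parabolic [set~ i0] ->
  commutative_datum lie_qdatum i0 (@radical_weight R D i0).
Proof.
move=> hc; split.
- by split; [exact: isroot_alpha|rewrite ffunE eqxx].
- move=> i mu p ii0 [hmu m1] hp.
  have e : (mu + alpha i *+ p) i0 = 1.
    by rewrite ffunE ffunMnE ffunE (negPf ii0) mul0rn addr0.
  split=> //; apply: isroot_up => //.
  by apply/eqP => e0; move: e; rewrite e0 ffunE.
by move=> mu; apply: radical_weight_ge0.
Qed.

Lemma qvar_inv : (qvar R)^-1 - qvar R != 0.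
Proof.
rewrite subr_eq0; apply/eqP => e; have := @fracX_generic R[i] 2 isT.
rewrite -[FracField.tofrac 'X]/(qvar R) -[2]/(1 + 1) expfzDr // expr1z.
by rewrite -{1}e mulVf // eqxx.
Qed.

End Datum.

Theorem proposition5p6 (R : realType) (D : simple_lie R) (i0 : 'I_(rank D))
    (Hcomm : commutative_parabolic [set~ i0])
    (Hreg : regular_prehomogeneous [set~ i0])
    (Delta : Uqg D -> tensor (Uqg D) (Uqg D)) (HDelta : is_coproduct Delta)
    (S : Uqg D -> Uqg D) (HS : is_antipode S)
    (tr : Uqg D -> Uqg D) (Htr : is_transpose tr)
    (ad : Uqg D -> Uqg D -> Uqg D) (Had : is_adjoint_action Delta S ad)
    (T : 'I_(rank D) -> Uqg D -> Uqg D) (HT : is_braid T)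
    (form : Uqg D -> Uqg D -> Cq R) (Hform : is_pairing Delta form)
    (wI : seq 'I_(rank D)) (HwI : reduced_longest [set~ i0] wI)
    (nform : Uqg D -> Uqg D -> Cq R)
    (Hnform : is_nil_form i0 (uq_nil T wI) ad tr form nform)
    (f : Uqg D) (Hf : is_hwv i0 (uq_nil T wI) ad f)
    (tf : Uqg D -> Uqg D) (Htf : is_tpartial (uq_nil T wI) nform f tf)
    (b : nat -> Cq R) (Hb : forall s : nat, tf (f ^+ s.+1) = b s *: f ^+ s) :
  exists p : {poly Cq R},
    forall s : nat, b s = p.[qi (qvar R) (half_norm (s := D)) i0 ^+ s].
Proof.
pose Q := lie_qdatum D.
pose G : qgroup Q := @uq_qgroup (Cq R) (qvar R) (rank D) Q (half_norm (s := D)) erefl.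
have minus (x : G) : @bminus _ _ _ G x -> uq_bminus (x : Uqg D).
  by move/uq_bminusP.
have plus (x : G) : @bplus _ _ _ G x -> uq_bplus (x : Uqg D).
  by move/uq_bplusP.
have [Dlin [D1 DM] DK DE DF] := HDelta.
have [[Slin S1 SM] SK SE _] := HS.
have [[trlin tr1 trM] _ _ trF] := Htr.
have [Nf f0 hE hK] := Hf.
have [_ _ htf] := Htf.
have pLl : forall c (y y' x : G), @bminus _ _ _ G y -> @bminus _ _ _ G y' ->
    @bplus _ _ _ G x -> form (c *: y + y') x = c * form y x + form y' x.
  move=> c y y' x hy hy' hx.
  exact: (pairing_linl Hform c (minus _ hy) (minus _ hy') (plus _ hx)).
have pLr : forall c (y x x' : G), @bminus _ _ _ G y -> @bplus _ _ _ G x ->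
    @bplus _ _ _ G x' -> form y (c *: x + x') = c * form y x + form y x'.
  move=> c y x x' hy hx hx'.
  exact: (pairing_linr Hform c (minus _ hy) (plus _ hx) (plus _ hx')).
have pMr : forall (y x x' : G) s, @bminus _ _ _ G y -> @bplus _ _ _ G x ->
    @bplus _ _ _ G x' -> tens_sum (Delta y) s ->
    (forall p, p \in s -> @bminus _ _ _ G p.1 /\ @bminus _ _ _ G p.2) ->
    form y (x * x') = \sum_(p <- s) form p.1 x' * form p.2 x.
  move=> y x x' s hy hx hx' hs h.
  apply: (pairing_mulr Hform (minus _ hy) (plus _ hx) (plus _ hx') hs) => p /h[h1 h2].
  exact: (conj (minus _ h1) (minus _ h2)).
have pMl : forall (y y' x : G) s, @bminus _ _ _ G y -> @bminus _ _ _ G y' ->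
    @bplus _ _ _ G x -> tens_sum (Delta x) s ->
    (forall p, p \in s -> @bplus _ _ _ G p.1 /\ @bplus _ _ _ G p.2) ->
    form (y * y') x = \sum_(p <- s) form y p.1 * form y' p.2.
  move=> y y' x s hy hy' hx hs h.
  apply: (pairing_mull Hform (minus _ hy) (minus _ hy') (plus _ hx) hs) => p /h[h1 h2].
  exact: (conj (plus _ h1) (plus _ h2)).
have pKK i j : form (gK G i) (gK G j) = qt Q i ^ (- qa Q i j).
  apply: etrans (pairing_KK Hform i j) _.
  by rewrite [RHS]qi_expz mulrN.
have q2 := qvar_inv R.
have Nspan (x : G) : uq_nil T wI (x : Uqg D) -> span (gF G) x.
  by move=> [hx _]; exact: (@uq_nminus_span _ (qvar R) _ Q (half_norm (s := D)) erefl x hx).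
have [p hp] := (@nil_bfunction (Cq R) (rank D) Q G Delta form Dlin D1 DM DK DE DF pLl pMr pMl pKK
  (pairing_FE Hform) (pairing_FK Hform) (pairing_KE Hform) pLr
  i0 (@cartan_le0 R D) (@cartan_definite R D) _ _ (frac_cone R[i])
  (@lie_pos R D) (@lie_pos1 R D) (@lie_conj R D) _ (lie_commutative Hcomm)
  tr trlin tr1 trM trF S ad S1 SM SK SE Had (uq_nil T wI) nform (qvar R)
  (@uq_nil1 _ (qvar R) _ Q (half_norm (s := D)) T wI HT)
  (fun x y => @uq_nilM _ (qvar R) _ Q (half_norm (s := D)) T wI x y HT) Nspan
  (nil_form_linl Hnform) (@nil_formE _ _ _ _ _ _ _ _ _ _ _ Hnform) q2 f tf b Nf f0 hE hK htf Hb).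
by exists p => s; rewrite hp.
Qed.
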